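(* Let $k$ be an algebraically closed field of characteristic zero equipped with an automorphism $\sigma$, and suppose $(V,\phi)$ is an isotrivial rational $\sigma$-variety over $(k,\sigma)$. If $(V,\phi)$ has no nonconstant invariant rational functions then it has only finitely many maximal proper invariant subvarieties.
   Context: A superscript $\sigma$ on a variety, rational map or rational function over $k$ denotes its transform under $\sigma$ acting on coefficients. A rational $\sigma$-variety over $(k,\sigma)$ is an irreducible variety $V$ over $k$ with a dominant rational map $\phi:V\dashrightarrow V^\sigma$ over $k$. An invariant subvariety of $(V,\phi)$ is an irreducible Zariski closed $X\subseteq V$ over $k$ such that $X\cap\mathrm{dom}(\phi)\ne\emptyset$ and $\phi(X)$ is Zariski dense in $X^\sigma$; maximality is with respect to inclusion among proper invariant subvarieties (all over $k$). A rational map $g:V\dashrightarrow W$ is equivariant $(V,\phi)\dashrightarrow(W,\psi)$ if $\psi\circ g=g^\sigma\circ\phi$. $(V,\phi)$ is isotrivial if there exist a rational $\sigma$-variety $(Z,\psi)$ over $k$, an $\ell\ge0$, an invariant subvariety $Y$ of $(\mathbb{A}^\ell\times Z,\mathrm{id}\times\psi)$, and an equivariant birational map $g:(V\times Z,\phi\times\psi)\dashrightarrow(Y,\mathrm{id}\times\psi)$ over $k$ commuting with the projections to $Z$. An invariant rational function on $(V,\phi)$ is $\lambda\in k(V)$ with $\lambda=\lambda^\sigma\circ\phi$; nonconstant means $\lambda\notin k$. *)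

(* Defs.v *)
From HB Require Import structures.
From mathcomp Require Import all_boot all_order all_algebra.
From mathcomp Require Import mpoly.
From mathcomp Require Import boolp classical_sets functions cardinality filter.
From mathcomp Require Import topology_structure subtype_topology.

Set Implicit Arguments.
Unset Strict Implicit.
Unset Printing Implicit Defensive.

Import GRing.Theory.
Local Open Scope classical_set_scope.
Local Open Scope ring_scope.

(* Varieties over an algebraically closed field k are treated in Serre's       *)
(* language: a variety is the space of its k-points with the Zariski topology  *)
(* and a sheaf of k-valued functions, locally isomorphic to closed subsets of  *)
(* affine space. The sheaf is recorded through the predicate [regular x f],    *)
(* that f is regular at the point x; it only depends on the germ of f at x, so *)
(* that f may be taken to be a total function. Local affineness, finite type, separation and *)
(* irreducibility are required in [variety].                                   *)
Record fspace (k : Type) := FSpace {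
  fpoint :> topologicalType;
  regular : fpoint -> set (fpoint -> k);
  regular_germ : forall x f g, regular x f ->
    (\forall y \near x, f y = g y) -> regular x g }.

Record field_aut (k : fieldType) := FieldAut {
  aut :> {rmorphism k -> k};
  aut_inv : k -> k;
  autK : cancel aut aut_inv;
  aut_invK : cancel aut_inv aut }.

Section Topology.

Definition irreducible (T : topologicalType) (S : set T) : Prop :=
  S !=set0 /\
  forall A B : set T, closed A -> closed B -> S `<=` A `|` B ->
    S `<=` A \/ S `<=` B.

(* Only used on irreducible spaces, where any two nonempty open sets meet.     *)
Definition generically (T : topologicalType) (P : set T) : Prop := P^° !=set0.

End Topology.

Section Spaces.
Variable k : closedFieldType.

Definition zaff (n : nat) : Type := 'rV[k]_n.
HB.instance Definition _ n := Choice.on (zaff n).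

Definition peval n (p : {mpoly k[n]}) (x : zaff n) : k := p.@[fun i => x 0 i].

Definition zaff_open n (A : set (zaff n)) : Prop :=
  exists S : set {mpoly k[n]}, A = [set x | exists2 p, S p & peval p x != 0].

Fact zaff_openT n : zaff_open [set: zaff n].
Proof.
exists [set 1]; rewrite predeqE => x; split=> // _.
by exists 1 => //; rewrite /peval meval1 oner_eq0.
Qed.

Fact zaff_openI n : setI_closed (@zaff_open n).
Proof.
move=> _ _ [S ->] [S' ->].
exists [set r | exists p q, [/\ S p, S' q & r = p * q]].
rewrite predeqE => x; split=> [[[p Sp px] [q Sq qx]]|[_ [p [q [Sp Sq ->]]]]].
  exists (p * q); first by exists p, q.
  by rewrite /peval mevalM mulf_neq0.
rewrite /peval mevalM mulf_eq0 negb_or => /andP[px qx].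
by split; [exists p|exists q].
Qed.

Fact zaff_open_bigU n (I : Type) (f : I -> set (zaff n)) :
  (forall i, zaff_open (f i)) -> zaff_open (\bigcup_i f i).
Proof.
move=> fo; exists [set p | [set x | peval p x != 0] `<=` \bigcup_i f i].
rewrite predeqE => x; split=> [[i _ fix_]|[p]]; last exact.
have [S fE] := fo i; move: fix_; rewrite fE => -[p Sp px].
by exists p => // y py; exists i => //; rewrite fE; exists p.
Qed.

HB.instance Definition _ n := isOpenTopological.Build (zaff n)
  (@zaff_openT n) (@zaff_openI n) (@zaff_open_bigU n).

Definition zaff_regular n (x : zaff n) : set (zaff n -> k) :=
  [set f | exists p q : {mpoly k[n]},
    peval q x != 0 /\ \forall y \near x, f y = peval p y / peval q y].

Fact zaff_germ n (x : zaff n) f g : zaff_regular x f ->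
  (\forall y \near x, f y = g y) -> zaff_regular x g.
Proof.
move=> [p [q [qx fE]]] fg; exists p, q; split=> //.
by apply: filterS2 fE fg => y -> <-.
Qed.

Definition affine_space (n : nat) : fspace k := FSpace (@zaff_germ n).

Definition induced_regular (X : fspace k) (S : set X) (x : set_type S) :
    set (set_type S -> k) :=
  [set f | exists g,
    regular (set_val x) g /\ \forall y \near x, f y = g (set_val y)].

Fact induced_germ (X : fspace k) (S : set X) (x : set_type S) f g :
  induced_regular x f -> (\forall y \near x, f y = g y) ->
  induced_regular x g.
Proof.
move=> [h [hx fE]] fg; exists h; split=> //.
by apply: filterS2 fE fg => y -> <-.
Qed.

Definition induced (X : fspace k) (S : set X) : fspace k :=
  FSpace (@induced_germ X S).

(* Product of prevarieties: on a product of open sets U and U', the basic      *)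
(* functions are the sums of a_i(x) b_i(y) with a_i, b_i regular on U, U'.     *)
Definition tensor (X Y : fspace k) (U : set X) (U' : set Y) :
    set (X * Y -> k) :=
  [set h | exists n (a : 'I_n -> X -> k) (b : 'I_n -> Y -> k),
    [/\ forall i x, U x -> regular x (a i),
        forall i y, U' y -> regular y (b i) &
        h = fun z => \sum_(i < n) a i z.1 * b i z.2]].

(* An alias, since X * Y already carries the product topology, which is        *)
(* coarser than the Zariski topology.                                          *)
Definition zprod (X Y : fspace k) : Type := (X * Y)%type.
HB.instance Definition _ X Y := Choice.on (zprod X Y).

Definition zprod_basic (X Y : fspace k) : set (set (zprod X Y)) :=
  [set O | exists (U : set X) (U' : set Y) h,
    [/\ open U, open U', tensor U U' h &
        O = [set z | [/\ U z.1, U' z.2 & h z != 0]]]].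

HB.instance Definition _ X Y :=
  isSubBaseTopological.Build (zprod X Y) (@zprod_basic X Y) id.

Definition zprod_regular (X Y : fspace k) (z : zprod X Y) :
    set (zprod X Y -> k) :=
  [set f | exists (U : set X) (U' : set Y) p q,
    [/\ [/\ open U, open U', U z.1 & U' z.2], tensor U U' p, tensor U U' q,
        q z != 0 & \forall w \near z, f w = p w / q w]].

Fact zprod_germ (X Y : fspace k) (z : zprod X Y) f g : zprod_regular z f ->
  (\forall w \near z, f w = g w) -> zprod_regular z g.
Proof.
move=> [U [U' [p [q [UU' hp hq qz fE]]]]] fg; exists U, U', p, q; split=> //.
by apply: filterS2 fE fg => w -> <-.
Qed.

Definition product (X Y : fspace k) : fspace k := FSpace (@zprod_germ X Y).

Definition morphism_on (X Y : fspace k) (U : set X) (f : X -> Y) : Prop :=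
  forall x, U x ->
    {for x, continuous f} /\
    forall h : Y -> k, regular (f x) h -> regular x (h \o f).

Definition isomorphism (X Y : fspace k) (f : X -> Y) : Prop :=
  morphism_on setT f /\
  exists g : Y -> X, [/\ cancel f g, cancel g f & morphism_on setT g].

Definition affine (X : fspace k) : Prop :=
  exists n (C : set (affine_space n)),
    closed C /\ exists f : X -> induced C, isomorphism f.

Definition variety (X : fspace k) : Prop :=
  [/\ irreducible [set: X],
      exists m (U : 'I_m -> set X),
        (forall i, open (U i) /\ affine (induced (U i))) /\
        \bigcup_(i in [set: 'I_m]) U i = setT
    & closed [set z : product X X | z.1 = z.2]].

(* A rational map X --> Y is represented by a morphism on a nonempty open      *)
(* subset of X; all notions below are invariant under the equivalence of       *)
(* representatives, and rely only on [value].                                  *)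
Record rmap (X Y : fspace k) := RMap { mdom : set X; mfun : X -> Y }.

Definition rational_map (X Y : fspace k) (f : rmap X Y) : Prop :=
  [/\ open (mdom f), mdom f !=set0 & morphism_on (mdom f) (mfun f)].

(* x is in the (maximal) domain of definition of f, and f(x) = y.              *)
Definition value (X Y : fspace k) (f : rmap X Y) (x : X) (y : Y) : Prop :=
  exists (U : set X) (g : X -> Y),
    [/\ open U /\ U x, morphism_on U g,
        forall x', U x' -> mdom f x' -> g x' = mfun f x' & g x = y].

Definition rdom (X Y : fspace k) (f : rmap X Y) : set X :=
  [set x | exists y, value f x y].

Definition rimage (X Y : fspace k) (f : rmap X Y) (S : set X) : set Y :=
  [set y | exists2 x, S x & value f x y].

Definition dominant (X Y : fspace k) (f : rmap X Y) : Prop :=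
  closure (rimage f setT) = setT.

Definition birational (X Y : fspace k) (f : rmap X Y) : Prop :=
  rational_map f /\
  exists h : rmap Y X,
    [/\ rational_map h,
        generically (fun x => exists2 y, value f x y & value h y x) &
        generically (fun y => exists2 x, value h y x & value f x y)].

Definition rincl (X Y : fspace k) (S : set Y) (f : rmap X (induced S)) :
    rmap X Y :=
  RMap (mdom f) (fun x => set_val (mfun f x)).

End Spaces.

Section SigmaVarieties.
Variables (k : closedFieldType) (s : field_aut k).

(* The transform V^s is the base change of V along s. It has the same          *)
(* underlying space as V, and its regular functions are the s \o f for f       *)
(* regular on V: in coordinates, the point x of V viewed as a point of V^s is  *)
(* the point s(x), because p^s(s(x)) = s(p(x)) (see [twist_affine_space] and   *)
(* [twist_zeros]). With this identification, X^s is X for a subvariety X, and  *)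
(* g^s is g for a rational map g, while for a rational function lam : V -> k   *)
(* the transform lam^s : V^s -> k is s \o lam.                                 *)
Definition twist_regular (V : fspace k) (x : V) : set (V -> k) :=
  [set f | exists2 g, regular x g & f = s \o g].

Fact twist_germ (V : fspace k) (x : V) f g : twist_regular x f ->
  (\forall y \near x, f y = g y) -> twist_regular x g.
Proof.
move=> [h hx ->] fg; exists (aut_inv s \o g); last first.
  by rewrite funeqE => y; rewrite /comp aut_invK.
by apply: (regular_germ hx); apply: filterS fg => y /= <-; rewrite autK.
Qed.

Definition twist (V : fspace k) : fspace k := FSpace (@twist_germ V).

Definition rtwist (V W : fspace k) (g : rmap V W) : rmap (twist V) (twist W) :=
  @RMap k (twist V) (twist W) (mdom g) (mfun g).

Definition twist_coord n (x : twist (affine_space k n)) : affine_space k n :=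
  map_mx s x.

(* The identity A^n -> (A^n)^s, that is, the inverse of [twist_coord].         *)
Definition untwist_coord n (x : affine_space k n) : twist (affine_space k n) :=
  map_mx (aut_inv s) x.

Lemma peval_map n (p : {mpoly k[n]}) (x : affine_space k n) :
  peval (map_mpoly s p) (twist_coord x) = s (peval p x).
Proof.
rewrite /peval !mevalE rmorph_sum /=.
rewrite (perm_big _ (msupp_map_mpoly _ (fmorph_inj s))) /=.
apply: eq_bigr => m _; rewrite mcoeff_map_mpoly rmorphM rmorph_prod.
by congr (_ * _); apply: eq_bigr => i _; rewrite mxE rmorphXn.
Qed.

Fact aut_inv_zmod : zmod_morphism (aut_inv s).
Proof. exact: can2_zmod_morphism (autK s) (aut_invK s). Qed.

Fact aut_inv_monoid : monoid_morphism (aut_inv s).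
Proof. exact: can2_monoid_morphism (autK s) (aut_invK s). Qed.

HB.instance Definition _ :=
  GRing.isZmodMorphism.Build k k (aut_inv s) aut_inv_zmod.
HB.instance Definition _ :=
  GRing.isMonoidMorphism.Build k k (aut_inv s) aut_inv_monoid.

Lemma twist_coordK n : cancel (@twist_coord n) (@untwist_coord n).
Proof. by move=> x; apply/rowP => i; rewrite !mxE autK. Qed.

Lemma untwist_coordK n : cancel (@untwist_coord n) (@twist_coord n).
Proof. by move=> x; apply/rowP => i; rewrite !mxE aut_invK. Qed.

Lemma map_mpolyK n (p : {mpoly k[n]}) :
  map_mpoly s (map_mpoly (aut_inv s) p) = p.
Proof. by apply/mpolyP => m; rewrite !mcoeff_map_mpoly /= aut_invK. Qed.

Lemma twist_zeros n (S : set {mpoly k[n]}) :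
  @twist_coord n @` [set x | forall p, S p -> peval p x = 0] =
  [set y | forall p, S p -> peval (map_mpoly s p) y = 0].
Proof.
rewrite predeqE => y; split=> [[x Sx <-] p /Sx|Sy].
  by rewrite peval_map => ->; rewrite rmorph0.
exists (untwist_coord y); last exact: untwist_coordK.
move=> p /Sy; rewrite -[y in peval _ y]untwist_coordK peval_map => /eqP.
by rewrite fmorph_eq0 => /eqP.
Qed.

Lemma twist_coord_continuous n : continuous (@twist_coord n).
Proof.
apply/continuousP => A [S ->].
exists [set p | S (map_mpoly s p)]; rewrite predeqE => x; split=> -[p Sp px].
  exists (map_mpoly (aut_inv s) p); first by rewrite /= map_mpolyK.
  by rewrite -(fmorph_eq0 s) -peval_map map_mpolyK.
by exists (map_mpoly s p); rewrite ?peval_map ?fmorph_eq0.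
Qed.

Lemma untwist_coord_continuous n : continuous (@untwist_coord n).
Proof.
apply/continuousP => A [S ->].
exists (map_mpoly s @` S); rewrite predeqE => x.
split=> [[p Sp px]|[_ [p Sp <-] px]].
  exists (map_mpoly s p); first by exists p.
  by rewrite -[x]untwist_coordK peval_map fmorph_eq0.
by exists p; rewrite // -(fmorph_eq0 s) -peval_map untwist_coordK.
Qed.

Lemma twist_affine_space n : isomorphism (@twist_coord n).
Proof.
split=> [x _|].
  split=> [|h [p [q [qx hE]]]]; first exact: twist_coord_continuous.
  exists (aut_inv s \o h \o @twist_coord n); last first.
    by rewrite funeqE => y; rewrite /comp aut_invK.
  exists (map_mpoly (aut_inv s) p), (map_mpoly (aut_inv s) q); split.
    by rewrite -(fmorph_eq0 s) -peval_map map_mpolyK.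
  move: (@twist_coord_continuous n x _ hE) => {}hE.
  apply: (@filterS _ (nbhs x) _ _ _ _ hE) => y /= ->.
  apply: (can_inj (autK s)).
  by rewrite aut_invK fmorph_div -!peval_map !map_mpolyK.
exists (@untwist_coord n); split; first exact: twist_coordK.
  exact: untwist_coordK.
move=> x _; split=> [|_ [h [p [q [qx hE]]] ->]].
  exact: untwist_coord_continuous.
exists (map_mpoly s p), (map_mpoly s q); split.
  by rewrite -[x]untwist_coordK peval_map fmorph_eq0.
move: (@untwist_coord_continuous n x _ hE) => {}hE.
apply: (@filterS _ (nbhs x) _ _ _ _ hE) => y /= ->.
by rewrite fmorph_div -!peval_map untwist_coordK.
Qed.

Definition rational_sigma_variety (V : fspace k) (phi : rmap V (twist V)) :
    Prop :=
  [/\ variety V, rational_map phi & dominant phi].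

Definition invariant_subvariety (V : fspace k) (phi : rmap V (twist V))
    (X : set V) : Prop :=
  [/\ closed X, irreducible X, X `&` rdom phi !=set0 &
      closure (rimage phi X) = (X : set (twist V))].

Definition maximal_invariant (V : fspace k) (phi : rmap V (twist V))
    (X : set V) : Prop :=
  [/\ invariant_subvariety phi X, X <> setT &
      forall X' : set V, invariant_subvariety phi X' -> X' <> setT ->
        X `<=` X' -> X' = X].

Definition equivariant (V W : fspace k) (phi : rmap V (twist V))
    (psi : rmap W (twist W)) (g : rmap V W) : Prop :=
  generically (fun x : V => exists y x' z,
    [/\ value g x y, value psi y z, value phi x x' & value (rtwist g) x' z]).

Definition sprod (V W : fspace k) (phi : rmap V (twist V))
    (psi : rmap W (twist W)) : rmap (product V W) (twist (product V W)) :=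
  @RMap k (product V W) (twist (product V W))
    [set z | mdom phi z.1 /\ mdom psi z.2]
    (fun z => (mfun phi z.1, mfun psi z.2)).

Definition sid n : rmap (affine_space k n) (twist (affine_space k n)) :=
  RMap setT (@untwist_coord n).

(* The map g takes its values in Y; the structure map of Y is the restriction  *)
(* of id x psi, so equivariance is tested in the ambient A^l x Z.              *)
Definition isotrivial (V : fspace k) (phi : rmap V (twist V)) : Prop :=
  exists (Z : fspace k) (psi : rmap Z (twist Z)) (l : nat)
    (Y : set (product (affine_space k l) Z))
    (g : rmap (product V Z) (induced Y)),
    [/\ rational_sigma_variety psi,
        invariant_subvariety (sprod (sid l) psi) Y,
        birational g,
        equivariant (sprod phi psi) (sprod (sid l) psi) (rincl g) &
        generically (fun x : product V Z =>
          exists2 y, value g x y & (set_val y).2 = x.2)].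

Definition rational_function (V : fspace k) (U : set V) (lam : V -> k) : Prop :=
  [/\ open U, U !=set0 & forall x, U x -> regular x lam].

Definition invariant_function (V : fspace k) (phi : rmap V (twist V))
    (U : set V) (lam : V -> k) : Prop :=
  rational_function U lam /\
  generically (fun x : V =>
    U x /\ exists y, [/\ value phi x y, U y & lam x = s (lam y)]).

Definition constant_function (V : fspace k) (U : set V) (lam : V -> k) : Prop :=
  exists c : k, forall x, U x -> lam x = c.

End SigmaVarieties.

(* Main.v *)
Require Import Defs.
From HB Require Import structures.
From mathcomp Require Import all_boot all_order all_algebra finmap.
From mathcomp Require Import mpoly zify ring.
From mathcomp Require Import boolp classical_sets functions cardinality filter.
From mathcomp Require Import topology_structure initial_topology subtype_topology.

Set Implicit Arguments.
Unset Strict Implicit.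
Unset Printing Implicit Defensive.

Import GRing.Theory.
Local Open Scope classical_set_scope.
Local Open Scope ring_scope.

(** For a rational sigma-variety (V, phi) the twist of V has the points of V, so
phi is a self-map of V along which functions are transformed by
tau(f) = s o f o phi; a subvariety X is invariant when phi maps it densely into
itself.

It suffices to find a nonempty open subset of V that no proper invariant
subvariety meets ([invariants_sparse]). Indeed, by Noetherian induction, a
closed set W contains only finitely many maximal invariant subvarieties
([finite_maximal_in]): if their union is not dense in W, pass to its closure; if
W is a union of two smaller closed sets, treat these separately; and an
irreducible W in which the union is dense is itself invariant
([dense_union_invariant]). Noetherianity comes from Hilbert's basis theorem
([poly_noetherian]).

Let (Z, psi) trivialise (V, phi). Let K and L be the function fields of V and Z,
F the function field of V x Z with the operator tau of phi x psi, and C the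
subfield of tau-fixed elements, the constants.

A proper invariant X produces a constant. By isotriviality the coordinates of V
are quotients of sums of terms l(z) b(v, z) with l in L and b a constant
([isotrivial_ratio]); hence a polynomial function vanishing on X, but not on V,
gives such a sum f that vanishes on X x Z and is not zero. Divide f by one of its
coefficients l, and subtract the result from its image under tau: this makes f
shorter unless f is already, up to a factor in L, a constant. So some nonzero
constant vanishes on X x Z ([constant_vanishing_on]).

Constants do not vanish at a general point of V. As V has no nonconstant
invariant rational function, the same manipulation shows that K and C are
linearly disjoint: constants that are linearly dependent over K are so over k
([linear_disjoint]). Let d be the least number of elements of L over whose field
L is algebraic. Starting from d such elements and exchanging them for constants
as long as possible, one obtains constants y_1, ..., y_r and d - r elements of L
over which, together with K, the field F is algebraic, and such that C is
algebraic over K(y) ([constants_basis]). By linear disjointness every nonzero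
constant b is a root of a polynomial over k[y] whose constant term q_0(y) is a
nonzero polynomial in y. Now restrict to {x} x Z for a general x in V: L is still
algebraic over the field generated by the d elements consisting of the y_i(x, .)
and the d - r elements of L, so by the minimality of d the y_i(x, .) are
algebraically independent over k ([constants_transcendence]). If b vanished on
{x} x Z, so would q_0(y), a contradiction. The condition on x involves only the
y_i, neither b nor X, which gives the required open set. *)

(** * Relative algebraic closure and exchange *)

Section RelativeClosure.
Variable F : fieldType.
Implicit Types (S A M : set F) (x y u : F) (p q : {poly F}).

Definition subring A : Prop :=
  [/\ A 1, forall x y, A x -> A y -> A (x - y)
    & forall x y, A x -> A y -> A (x * y)].

(** The conditions are bundled so that such a set can carry a canonical
field structure, to which the theory of algebraic elements applies. *)
Record subfield := Subfield {
  sf_set :> set F;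
  sf1 : sf_set 1;
  sfB : forall x y, sf_set x -> sf_set y -> sf_set (x - y);
  sfV : forall x y, sf_set x -> sf_set y -> sf_set (x / y) }.

Section SubfieldType.
Variable M : subfield.
Definition sf_pred : {pred F} := fun x => `[< sf_set M x >].
Fact sf_divring : divring_closed sf_pred.
Proof.
by split; [apply/asboolP; exact: sf1
  |move=> x y /asboolP Mx /asboolP My; apply/asboolP; apply: sfB
  |move=> x y /asboolP Mx /asboolP My; apply/asboolP; apply: sfV].
Qed.
HB.instance Definition _ := GRing.isDivringClosed.Build F sf_pred sf_divring.
Definition sf_sort := {x : F | x \in sf_pred}.
HB.instance Definition _ := SubType.on sf_sort.
HB.instance Definition _ := Choice.on sf_sort.
HB.instance Definition _ := [SubChoice_isSubIntegralDomain of sf_sort by <:].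
HB.instance Definition _ := [SubIntegralDomain_isSubField of sf_sort by <:].
End SubfieldType.

Lemma subring0 A : subring A -> A 0.
Proof. by move=> [A1 AB _]; rewrite -(subrr 1); apply: AB. Qed.
Lemma subringD A x y : subring A -> A x -> A y -> A (x + y).
Proof.
move=> hA Ax Ay; have [_ AB _] := hA.
by rewrite -[y]opprK; apply: (AB) => //; rewrite -sub0r; apply: (AB) => //; apply: subring0.
Qed.
Lemma subringX A x n : subring A -> A x -> A (x ^+ n).
Proof.
move=> [A1 _ AM] Ax; elim: n => [|n IH]; rewrite ?expr0 // exprS; exact: AM.
Qed.
Lemma subring_sum A (I : Type) (r : seq I) (P : pred I) (f : I -> F) :
  subring A -> (forall i, P i -> A (f i)) -> A (\sum_(i <- r | P i) f i).
Proof.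
move=> hA hf; elim/big_rec: _ => [|i x Pi Ax]; first exact: subring0.
by apply: subringD => //; apply: hf.
Qed.

Definition relatively_closed M : Prop :=
  [/\ subring M, forall x, M x -> M x^-1
    & forall p x, p != 0 -> (forall i, M p`_i) -> root p x -> M x].

(** The algebraic closure in F of the field generated by S. As an intersection
it is minimal and idempotent by definition; equations for its elements are
recovered from [algebraic_set_closed]. *)
Definition rcl S : set F :=
  [set x | forall M, relatively_closed M -> S `<=` M -> M x].

Lemma rcl_sub S : S `<=` rcl S.
Proof. by move=> x Sx M _; apply. Qed.

Lemma rcl_min S M : relatively_closed M -> S `<=` M -> rcl S `<=` M.
Proof. by move=> hM SM x; apply. Qed.

Lemma rcl_closed S : relatively_closed (rcl S).
Proof.
split; first split.
- by move=> M [[M1 _ _] _ _] _.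
- by move=> x y hx hy M hM SM; have [[_ MB _] _ _] := hM; apply: MB; [apply: hx|apply: hy].
- by move=> x y hx hy M hM SM; have [[_ _ MM] _ _] := hM; apply: MM; [apply: hx|apply: hy].
- by move=> x hx M hM SM; have [_ MV _] := hM; apply: MV; apply: hx.
move=> p x p0 hp px M hM SM; have [_ _ Mr] := hM.
by apply: (Mr p) => // i; apply: hp.
Qed.

Lemma rcl_mono S S' : S `<=` rcl S' -> rcl S `<=` rcl S'.
Proof. by move=> SS'; apply: rcl_min => //; apply: rcl_closed. Qed.

Definition algebraic_set A : set F :=
  [set x | exists p, [/\ p != 0, forall i, A p`_i & root p x]].

Section AlgebraicSet.
Variables (A : set F) (hA : subring A).

Definition frac_set : set F := [set x | exists a b, [/\ A a, A b, b != 0 & x = a / b]].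

Fact frac1 : frac_set 1.
Proof. have [A1 _ _] := hA; by exists 1, 1; rewrite oner_neq0 divr1. Qed.
Fact fracB x y : frac_set x -> frac_set y -> frac_set (x - y).
Proof.
have [A1 AB AM] := hA.
move=> [a [b [Aa Ab b0 ->]]] [c [d [Ac Ad d0 ->]]].
exists (a * d - c * b), (b * d); split; [by apply: AB;
  apply: AM|exact: AM|by rewrite mulf_neq0|].
by rewrite -mulNr addf_div // mulNr.
Qed.
Fact fracV x y : frac_set x -> frac_set y -> frac_set (x / y).
Proof.
have [A1 AB AM] := hA.
move=> [a [b [Aa Ab b0 ->]]] [c [d [Ac Ad d0 ->]]].
have [->|c0] := eqVneq c 0.
  by rewrite mul0r invr0 mulr0; exists 0, 1; rewrite oner_neq0 mul0r; split=> //;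
    apply: subring0.
exists (a * d), (b * c); split; [exact: AM|exact: AM|by rewrite mulf_neq0|].
by rewrite invf_div mulf_div.
Qed.
Definition frac_field := Subfield frac1 fracB fracV.

Lemma common_denominator p : (forall i, frac_set p`_i) ->
  exists d, [/\ A d, d != 0 & forall i, A (d * p`_i)].
Proof.
have [A1 AB AM] := hA => hp.
suff [d [Ad d0 dP]] : exists d, [/\ A d, d != 0 & forall i, (i < size p)%N -> A (d * p`_i)].
  exists d; split=> // i; case: (ltnP i (size p)) => [/dP//|ip].
  by rewrite nth_default // mulr0; apply: subring0.
elim: (size p) => [|n [d [Ad d0 dP]]]; first by exists 1; rewrite oner_neq0; split.
have [a [b [Aa Ab b0 pn]]] := hp n.
exists (d * b); split; [exact: AM|by rewrite mulf_neq0|] => i.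
rewrite ltnS leq_eqVlt => /orP[/eqP->|/dP Ai].
  by rewrite pn mulrACA divff // mulr1; apply: AM.
by rewrite -mulrA [b * _]mulrC mulrA; apply: AM.
Qed.

Lemma algebraic_setE x : algebraic_set A x <-> algebraicOver (val : sf_sort frac_field -> F) x.
Proof.
split=> [[p [p0 Ap px]]|[p p0 px]].
  have hp i : p`_i \in sf_pred frac_field.
    by apply/asboolP; exists p`_i, 1; have [A1 _ _] := hA; rewrite oner_neq0 divr1.
  pose q := \poly_(i < size p) (Sub p`_i (hp i) : sf_sort frac_field).
  have qE : map_poly val q = p.
    apply/polyP => i; rewrite coef_map coef_poly; case: ltnP => //= ip.
    by rewrite nth_default.
  by exists q; rewrite ?qE //; apply: contra_neq p0 => q0; rewrite -qE q0 map_poly0.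
have [|d [Ad d0 dP]] := @common_denominator (map_poly val p).
  by move=> i; rewrite coef_map; case: p`_i => y hy /=; move/asboolP: hy.
exists (d *: map_poly val p); split.
- by rewrite scaler_eq0 (negbTE d0) map_poly_eq0.
- by move=> i; rewrite coefZ.
- by rewrite rootE hornerZ (rootP px) mulr0.
Qed.

(** This set consists of the elements that are algebraic over the fraction
field of A, since denominators of coefficients can be cleared. *)
Lemma algebraic_set_closed : relatively_closed (algebraic_set A).
Proof.
have intE x : algebraic_set A x <-> integralOver (val : sf_sort frac_field -> F) x.
  by rewrite algebraic_setE integral_algebraic.
split; first split.
- by rewrite algebraic_setE; apply: algebraic1.
- by move=> x y; rewrite !algebraic_setE; apply: algebraic_sub.
- by move=> x y; rewrite !algebraic_setE; apply: algebraic_mul.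
- by move=> x; rewrite !algebraic_setE; apply: algebraic_inv.
move=> p x p0 hp px; rewrite intE; apply: (integral_root p0 px).
by move=> _ /(nthP 0)[i ip <-]; rewrite -intE.
Qed.

Lemma sub_algebraic_set : A `<=` algebraic_set A.
Proof.
have [A1 AB _] := hA; move=> x Ax; exists ('X - x%:P);
  rewrite polyXsubC_eq0 root_XsubC eqxx; split=> // i.
have A0 := subring0 hA.
rewrite coefB coefX coefC; apply: AB; first by case: eqP.
by case: eqP.
Qed.

End AlgebraicSet.

Definition adjoin M u : set F := [set x | exists p, (forall i, M p`_i) /\ x = p.[u]].

Lemma adjoin_subring M u : subring M -> subring (adjoin M u).
Proof.
move=> hM; have [M1 MB MM] := hM; have M0 := subring0 hM; split.
- by exists 1; rewrite hornerC; split=> // i; rewrite coefC; case: eqP.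
- move=> _ _ [p [Mp ->]] [q [Mq ->]]; exists (p - q); rewrite hornerD hornerN; split=> // i.
  by rewrite coefB; apply: MB.
move=> _ _ [p [Mp ->]] [q [Mq ->]]; exists (p * q); rewrite hornerM; split=> // i.
by rewrite coefM; apply: subring_sum => // j _; apply: MM.
Qed.

Lemma rcl_adjoin M u : subring M -> rcl (M `|` [set u]) `<=` algebraic_set (adjoin M u).
Proof.
move=> hM; have hA := adjoin_subring u hM.
have [M1 MB MM] := hM; have M0 := subring0 hM.
apply: rcl_min => [|x [Mx|->]]; first exact: algebraic_set_closed.
  apply: sub_algebraic_set => //; exists x%:P; rewrite hornerC; split=> // i.
  by rewrite coefC; case: eqP.
apply: sub_algebraic_set => //; exists 'X; rewrite hornerX; split=> // i.
by rewrite coefX; case: eqP.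
Qed.

(** An equation for x over M[u] is a relation in two variables. Ordered by
powers of u its coefficients are polynomials in x over M; one of them is not the
zero polynomial, so it is not zero at x, which is transcendental over M. Thus the
relation is a nontrivial equation for u over M[x]. *)
Lemma rcl_exchange S x u :
  rcl (S `|` [set u]) x -> ~ rcl S x -> rcl (S `|` [set x]) u.
Proof.
move=> xSu xS; set M := rcl S.
have Mcl : relatively_closed M by exact: rcl_closed.
have [Mring MV Mroot] := Mcl; have M0 := subring0 Mring.
have : algebraic_set (adjoin M u) x.
  apply: rcl_adjoin => //; apply: rcl_mono xSu => y [Sy|->]; apply: rcl_sub;
    [left|right] => //.
  exact: rcl_sub.
move=> [p [p0 hp px]].
have [f fP] := choice hp.
pose n := size p.
pose N := (\max_(j < n) size (f j))%N.
have pE : p = \sum_(j < n) (f j).[u] *: 'X^j.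
  by rewrite -[LHS]coefK poly_def; apply: eq_bigr => j _; rewrite -(fP j).2.
(* p is the sum of the f j (u) X^j; g i is the coefficient of u ^ i. *)
pose g i : {poly F} := \sum_(j < n) (f j)`_i *: 'X^j.
have gM i l : M (g i)`_l.
  rewrite coef_sum; apply: subring_sum => // j _; rewrite coefZ coefXn.
  by have [_ _ MM] := Mring; case: eqP => _; rewrite ?mulr1 ?mulr0 //; exact: (fP j).1.
have fE (j : 'I_n) v : (f j).[v] = \sum_(i < N) (f j)`_i * v ^+ i.
  by apply: horner_coef_wide; apply: (leq_bigmax_cond (F := fun j : 'I_n => size (f j))).
have pgE : p = \sum_(i < N) u ^+ i *: g i.
  rewrite pE; under [RHS]eq_bigr do rewrite scaler_sumr.
  rewrite exchange_big /=; apply: eq_bigr => j _; rewrite fE scaler_suml.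
  by apply: eq_bigr => i _; rewrite scalerA mulrC.
have [i0 gi0] : exists i : 'I_N, g i != 0.
  apply: contrapT => hg; move/eqP: p0; apply; rewrite pgE big1 // => i _.
  have [->|gi] := eqVneq (g i) 0; first by rewrite scaler0.
  by exfalso; apply: hg; exists i.
pose q : {poly F} := \poly_(i < N) (g i).[x].
have q0 : q != 0.
  apply: contra_not_neq xS => qz; apply: (Mroot _ _ gi0 (gM i0)).
  have : q`_i0 = 0 by rewrite qz coef0.
  by rewrite coef_poly ltn_ord rootE => ->.
have [_ _] := rcl_closed (S `|` [set x]); apply; first exact: q0.
  move=> i; rewrite coef_poly; case: ltnP => _.
    have hS' := rcl_closed (S `|` [set x]); have [Sring _ _] := hS'.
    rewrite horner_coef; apply: subring_sum => // l _.
    have [_ _ SM] := Sring; apply: SM.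
      by apply: (@rcl_mono S (S `|` [set x])) (gM i l) => y Sy; apply: rcl_sub; left.
    by apply: subringX l Sring _; apply: rcl_sub; right.
  by have [Sring _ _] := rcl_closed (S `|` [set x]); exact: (subring0 Sring).
rewrite rootE horner_poly; under eq_bigr do rewrite mulrC -hornerZ.
rewrite -horner_sum.
by rewrite -pgE -rootE.
Qed.

End RelativeClosure.

Lemma rcl_image (E F : fieldType) (f : {rmorphism E -> F}) (S : set E) :
  f @` rcl S `<=` rcl (f @` S).
Proof.
move=> _ [x Sx <-]; apply: (Sx (f @^-1` rcl (f @` S))) => [|y Sy]; last by apply: rcl_sub;
  exists y.
have [[M1 MB MM] MV Mr] := rcl_closed (f @` S); split; first split => /=.
- by rewrite rmorph1.
- by move=> y z; rewrite rmorphB; apply: MB.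
- by move=> y z; rewrite rmorphM; apply: MM.
- by move=> y; rewrite /= /preimage /= fmorphV; apply: MV.
move=> p y p0 Mp py; apply: (Mr (map_poly f p)); rewrite ?map_poly_eq0 ?fmorph_root //.
by move=> i; rewrite coef_map; apply: Mp.
Qed.

(** * Algebraic dependence over several variables *)

Section AlgebraicDependence.

Definition widen_last n : 'I_n -> 'I_n.+1 := widen_ord (leqnSn n).

Lemma mmap_muni (E : comNzRingType) (F : comNzRingType) (f : {rmorphism E -> F}) n
    (y : 'I_n.+1 -> F) (q : {mpoly E[n.+1]}) :
  mmap f y q = (map_poly (mmap f (y \o @widen_last n)) (muni q)).[y ord_max].
Proof.
rewrite muniE rmorph_sum horner_sum {1}/mmap; apply: eq_bigr => m _.
rewrite /= map_polyZ /= map_polyXn hornerZ hornerXn mmapZ mmapX /mmap1 big_ord_recr /= mulrA.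
congr (_ * _ * _); apply: eq_bigr => i _.
by rewrite mnmE.
Qed.

(** Evaluation at the variables themselves recovers q from [muni q]. *)
Lemma muni_eq0 (E : comNzRingType) n (q : {mpoly E[n.+1]}) : muni q = 0 -> q = 0.
Proof.
move=> q0; have := mmap_muni (@mpolyC n.+1 E) (fun i => 'X_i) q.
rewrite q0 map_poly0 horner0 => <-.
rewrite {1}[q]mpolyE /mmap; apply: eq_bigr => m _.
by rewrite mmap1_id mul_mpolyC.
Qed.

Lemma mmap_closed (E F : fieldType) (f : {rmorphism E -> F}) n (y : 'I_n -> F)
    (M : set F) (q : {mpoly E[n]}) : subring M -> range f `<=` M ->
  (forall i, M (y i)) -> M (mmap f y q).
Proof.
move=> hM fM yM; have [M1 _ MM] := hM; apply: subring_sum => // m _; apply: (MM).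
  by apply: fM; exists q@_m.
rewrite /mmap1; elim/big_rec: _ => // i x _ Mx; apply: (MM) => //.
exact: subringX.
Qed.

(** Read q as a polynomial in the last variable. Either its coefficients all
vanish at the other y's, which is a relation in fewer variables, or it is an
equation for the last y over the others. *)
Lemma dependent_redundant (E F : fieldType) (f : {rmorphism E -> F}) r
    (y : 'I_r -> F) (q : {mpoly E[r]}) : q != 0 -> mmap f y q = 0 ->
  exists i, rcl (range f `|` [set y j | j in [set j | j != i]]) (y i).
Proof.
elim: r y q => [|r IH] y q q0.
  rewrite [q]nvar0_mpolyC mmapC => /eqP; rewrite fmorph_eq0 => qc.
  by move: q0; rewrite [q]nvar0_mpolyC (eqP qc) mpolyC0 eqxx.
rewrite mmap_muni => qy.
have P0 : muni q != 0 by apply: contra_neq q0; exact: muni_eq0.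
have [Pz|Pn] := eqVneq (map_poly (mmap f (y \o @widen_last r)) (muni q)) 0.
  have lc0 : lead_coef (muni q) != 0 by rewrite lead_coef_eq0.
  have [|i hi] := IH (y \o @widen_last r) _ lc0.
    by rewrite lead_coefE -coef_map Pz coef0.
  exists (widen_last i); apply: rcl_mono hi => _ [[a _ <-]|[j ji <-]]; apply: rcl_sub.
    by left; exists a.
  by right; exists (widen_last j) => //; apply: contra ji.
exists ord_max; set S := _ `|` _.
have [Sring _ Sroot] := rcl_closed S; apply: (Sroot _ _ Pn); last by rewrite rootE qy.
move=> i; rewrite coef_map /=; apply: mmap_closed => //.
  by move=> x fx; apply: rcl_sub; left.
move=> j; apply: rcl_sub; right; exists (widen_last j) => //=.
by rewrite -val_eqE /= neq_ltn ltn_ord.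
Qed.

(** The polynomial expressions in y over K form a ring over which b is
algebraic. *)
Lemma rcl_dependent (F : fieldType) (K : set F) r (y : 'I_r -> F) b : subring K ->
  rcl (K `|` range y) b ->
  exists p : {poly {mpoly F[r]}},
    [/\ p != 0, forall i m, K (p`_i)@_m & (map_poly (meval y) p).[b] = 0].
Proof.
move=> hK; have [K1 KB KM] := hK; have K0 := subring0 hK.
pose A : set F := [set x | exists p : {mpoly F[r]}, (forall m, K p@_m) /\ x = p.@[y]].
have hA : subring A.
  split.
  - exists 1; rewrite meval1; split=> // m.
    by rewrite mcoeff1; case: eqP.
  - move=> _ _ [p [Kp ->]] [q [Kq ->]]; exists (p - q); rewrite mevalB; split=> // m.
    by rewrite mcoeffB; apply: KB.
  move=> _ _ [p [Kp ->]] [q [Kq ->]]; exists (p * q); rewrite mevalM; split=> // m.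
  by rewrite mcoeffM; apply: subring_sum => // i _; apply: KM.
have KA : K `|` range y `<=` A.
  move=> x [Kx|[i _ <-]].
    exists x%:MP; rewrite mevalC; split=> // m.
    by rewrite mcoeffC; case: eqP; rewrite ?mulr1 ?mulr0.
  exists 'X_i; rewrite mevalXU; split=> // m.
  by rewrite mcoeffX; case: eqP.
have sub : K `|` range y `<=` algebraic_set A.
  by move=> x /KA; apply: sub_algebraic_set.
move/(rcl_min (algebraic_set_closed hA) sub) => [P [P0 AP Pb]].
have [f fP] := choice AP.
pose p := \poly_(i < size P) f i.
have pP : map_poly (meval y) p = P.
  apply/polyP => i; rewrite coef_map coef_poly /=; case: ltnP => iP;
    first by rewrite -(fP i).2.
  by rewrite meval0 nth_default.
exists p; split.
- by apply: contra_neq P0 => p0; rewrite -pP p0 map_poly0.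
- move=> i m; rewrite coef_poly; case: ltnP => _; first exact: (fP i).1.
  by rewrite mcoeff0.
- by rewrite pP; apply/rootP.
Qed.

End AlgebraicDependence.

(** * Hilbert's basis theorem *)

Definition ideal (R : comNzRingType) (I : set R) : Prop :=
  [/\ I 0, forall x y, I x -> I y -> I (x + y) & forall a x, I x -> I (a * x)].

Definition ideal_gen (R : comNzRingType) (s : seq R) : set R :=
  [set x | forall J, ideal J -> [set` s] `<=` J -> J x].

Definition noetherian (R : comNzRingType) : Prop :=
  forall I : set R, ideal I -> exists s : seq R, [set` s] `<=` I /\ I `<=` ideal_gen s.

Lemma ideal_gen_ideal (R : comNzRingType) (s : seq R) : ideal (ideal_gen s).
Proof.
split.
- by move=> J [J0 _ _] _.
- by move=> x y hx hy J hJ sJ; have [_ JD _] := hJ; apply: JD; [apply: hx|apply: hy].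
- by move=> a x hx J hJ sJ; have [_ _ JM] := hJ; apply: JM; apply: hx.
Qed.

Lemma ideal_gen_sub (R : comNzRingType) (s : seq R) : [set` s] `<=` ideal_gen s.
Proof. by move=> x xs J _; apply. Qed.

Lemma ideal_gen_mono (R : comNzRingType) (s t : seq R) :
  {subset s <= t} -> ideal_gen s `<=` ideal_gen t.
Proof. by move=> st x hx J hJ tJ; apply: hx => // y /= /st; apply: tJ. Qed.

Lemma surjective_noetherian (R S : comNzRingType) (f : {rmorphism R -> S}) :
  (forall y, exists x, f x = y) -> noetherian R -> noetherian S.
Proof.
move=> fs nR I [I0 ID IM]; have [|s [sI Is]] := nR (f @^-1` I).
  split; first by rewrite /preimage /= rmorph0.
    by move=> x y hx hy; rewrite /preimage /= rmorphD; apply: ID.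
  by move=> a x hx; rewrite /preimage /= rmorphM; apply: IM.
exists (map f s); split; first by move=> _ /= /mapP[x xs ->]; exact: sI.
move=> y; have [x <-] := fs y; move=> /Is hx.
have [J0 JD JM] := ideal_gen_ideal (map f s).
apply: (hx (f @^-1` ideal_gen (map f s))).
  split; first by rewrite /preimage /= rmorph0.
    by move=> u v hu hv; rewrite /preimage /= rmorphD; apply: JD.
  by move=> a u hu; rewrite /preimage /= rmorphM; apply: JM.
by move=> u /= us; apply: ideal_gen_sub; rewrite /= map_f.
Qed.

Lemma field_noetherian (F : fieldType) : noetherian F.
Proof.
move=> I [I0 _ IM]; case: (pselect (exists2 a, I a & a != 0)) => [[a Ia a0]|h].
  exists [:: a]; split=> [x /=|x _]; first by rewrite inE => /eqP->.
  have [_ _ JM] := ideal_gen_ideal [:: a].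
  rewrite -[x](divfK a0); apply: JM; apply: ideal_gen_sub; exact: mem_head.
exists [::]; split=> // x Ix; have -> : x = 0.
  by apply/eqP/negP => /negP x0; apply: h; exists x.
by have [] := ideal_gen_ideal ([::] : seq F).
Qed.

Section HilbertBasis.
Variables (R : comNzRingType) (nR : noetherian R).
Variables (I : set {poly R}) (hI : ideal I).

Let lead n : set R := [set a | exists f, [/\ I f, (size f <= n.+1)%N & f`_n = a]].

Let lead_ideal n : ideal (lead n).
Proof.
have [I0 ID IM] := hI; split.
- by exists 0; rewrite size_poly0 coef0.
- move=> _ _ [f [If sf <-]] [g [Ig sg <-]]; exists (f + g); rewrite coefD; split=> //;
  first exact: ID.
  by rewrite (leq_trans (size_polyD _ _)) // geq_max sf sg.
- move=> a _ [f [If sf <-]]; exists (a%:P * f); split; first exact: IM.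
    by rewrite mul_polyC (leq_trans (size_scale_leq _ _)).
  by rewrite coefCM.
Qed.

Let lead_mono n m : (n <= m)%N -> lead n `<=` lead m.
Proof.
have [_ _ IM] := hI.
move=> nm _ [f [If sf <-]]; exists ('X^(m - n) * f); split; first exact: IM.
  rewrite (leq_trans (size_polyMleq _ _)) // size_polyXn /=.
  by move: sf nm; move: (seq.size f) => z; lia.
by rewrite coefXnM ltnNge leq_subr /= subKn.
Qed.

(** For fixed G the coefficients attained form an ideal, so it is enough to
attain the generators s. *)
Let lead_gen n (s : seq R) : [set` s] `<=` lead n -> exists G : seq {poly R},
  [set` G] `<=` I /\ forall a, ideal_gen s a -> exists g,
    [/\ ideal_gen G g, (size g <= n.+1)%N & g`_n = a].
Proof.
move=> sl; have [G [GI GP]] : exists G : seq {poly R}, [set` G] `<=` I /\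
    forall a, a \in s -> exists g, [/\ g \in G, (size g <= n.+1)%N & g`_n = a].
  elim: s sl => [|a s IH] sl; first by exists [::].
  have [|G [GI GP]] := IH; first by move=> x /= xs; apply: sl; rewrite /= inE xs orbT.
  have [f [If sf fa]] := sl a (mem_head _ _).
  exists (f :: G); split; first by move=> x /=; rewrite inE => /orP[/eqP->|/GI].
  move=> b; rewrite inE => /orP[/eqP->|/GP[g [gG sg gb]]]; first by exists f; rewrite mem_head.
  by exists g; rewrite inE gG orbT.
exists G; split=> // a ha.
apply: (ha [set a | exists g, [/\ ideal_gen G g, (size g <= n.+1)%N & g`_n = a]]).
  have [J0 JD JM] := ideal_gen_ideal G; split.
  - by exists 0; rewrite size_poly0 coef0.
  - move=> _ _ [f [If sf <-]] [g [Ig sg <-]]; exists (f + g); rewrite coefD; split=> //;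
    first exact: JD.
    by rewrite (leq_trans (size_polyD _ _)) // geq_max sf sg.
  - move=> c _ [f [If sf <-]]; exists (c%:P * f); split; first exact: JM.
      by rewrite mul_polyC (leq_trans (size_scale_leq _ _)).
    by rewrite coefCM.
move=> x /= /GP [g [gG sg gx]]; exists g; split=> //; exact: ideal_gen_sub.
Qed.

Let attains (G : seq {poly R}) n : Prop :=
  forall a, lead n a -> exists g, [/\ ideal_gen G g, (size g <= n.+1)%N & g`_n = a].

Let attains_mono (G G' : seq {poly R}) n : {subset G <= G'} -> attains G n -> attains G' n.
Proof.
move=> GG hG a /hG [g [gG sg ga]]; exists g; split=> //; exact: ideal_gen_mono gG.
Qed.

(** The ideals of leading coefficients grow with the degree, and their union is
generated in some degree N; powers of the variable serve the degrees above N. *)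
Let attains_large : exists N G, [set` G] `<=` I /\ forall n, (N <= n)%N -> attains G n.
Proof.
pose L : set R := [set a | exists n, lead n a].
have [|s [sL Ls]] := nR (I := L).
  split.
  - by exists 0%N; have [] := lead_ideal 0%N.
  - move=> x y [n xn] [m ym]; exists (maxn n m); have [_ D _] := lead_ideal (maxn n m).
    by apply: D; [apply: lead_mono xn; exact: leq_maxl|apply: lead_mono ym; exact: leq_maxr].
  - by move=> a x [n xn]; exists n; have [_ _ M] := lead_ideal n; apply: M.
have [N sN] : exists N, [set` s] `<=` lead N.
  elim: (s) sL => [|a t IH] sL; first by exists 0%N.
  have [|N hN] := IH; first by move=> x /= xt; apply: sL; rewrite /= inE xt orbT.
  have [n an] := sL a (mem_head _ _); exists (maxn N n) => x /=.
  rewrite inE => /orP[/eqP->|/hN xN]; first exact: lead_mono (leq_maxr _ _) _ an.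
  exact: lead_mono (leq_maxl _ _) _ xN.
have [G [GI GP]] := lead_gen sN; exists N, G; split=> // n Nn a an.
have [|g [gG sg ga]] := GP a; first by apply: Ls; exists n.
have [_ _ JM] := ideal_gen_ideal G.
exists ('X^(n - N) * g); split; first exact: JM.
  rewrite (leq_trans (size_polyMleq _ _)) // size_polyXn /=.
  by move: sg Nn; move: (seq.size g) => z; lia.
by rewrite coefXnM ltnNge leq_subr /= subKn.
Qed.

Let attains_all : exists G, [set` G] `<=` I /\ forall n, attains G n.
Proof.
have [N [G [GI GP]]] := attains_large.
have [G' [GI' GP']] : exists G', [set` G'] `<=` I /\ forall n, (n < N)%N -> attains G' n.
  elim: N {GP} => [|N [G' [GI' GP']]]; first by exists [::].
  have [s [sN Ns]] := nR (lead_ideal N).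
  have [H [HI HP]] := lead_gen sN.
  exists (H ++ G'); split; first by move=> x /=; rewrite mem_cat => /orP[/HI|/GI'].
  move=> n; rewrite ltnS leq_eqVlt => /orP[/eqP->|/GP' h].
    by apply: (@attains_mono H) => [x xH|a /Ns /HP //]; rewrite mem_cat xH.
  by apply: attains_mono h => x xG; rewrite mem_cat xG orbT.
exists (G ++ G'); split; first by move=> x /=; rewrite mem_cat => /orP[/GI|/GI'].
move=> n; case: (leqP N n) => [/GP|/GP']; apply: attains_mono => x xG;
  rewrite mem_cat xG ?orbT //.
Qed.

(** Subtracting an element of the ideal generated by G with the same leading
term lowers the degree of f. *)
Lemma poly_ideal_finite : exists G, [set` G] `<=` I /\ I `<=` ideal_gen G.
Proof.
have [G [GI GP]] := attains_all; exists G; split=> // f.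
have [I0 ID IM] := hI; have [J0 JD JM] := ideal_gen_ideal G.
have GI' : ideal_gen G `<=` I by move=> x; apply.
have [n] := ubnP (size f); elim: n f => // n IH f; rewrite ltnS => sf If.
have [f0|f0] := eqVneq f 0; first by rewrite f0.
have sf0 : (0 < size f)%N by rewrite size_poly_gt0.
have [|g [gG sg gf]] := GP (size f).-1 (lead_coef f).
  by exists f; split=> //; rewrite prednK.
rewrite prednK // in sg.
rewrite -[f](subrK g); apply: JD => //; apply: IH; last first.
  by apply: ID => //; rewrite -mulN1r; apply: IM; exact: GI'.
apply: leq_trans sf; rewrite ltnNge; apply/negP => h.
have sfg : (size (f - g)%R <= size f)%N.
  by rewrite (leq_trans (size_polyD _ _)) // size_polyN geq_max leqnn.
have sfgE : size (f - g) = size f by apply/eqP; rewrite eqn_leq sfg h.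
have : lead_coef (f - g) = 0 by rewrite lead_coefE sfgE coefB gf -lead_coefE subrr.
move/eqP; rewrite lead_coef_eq0 => /eqP fg0.
by move: sfgE; rewrite fg0 size_poly0 => e; move: sf0; rewrite -e.
Qed.
End HilbertBasis.

Theorem poly_noetherian (R : comNzRingType) : noetherian R -> noetherian {poly R}.
Proof. by move=> nR I hI; apply: poly_ideal_finite. Qed.

Theorem mpoly_noetherian (k : fieldType) n : noetherian {mpoly k[n]}.
Proof.
elim: n => [|n IH].
  apply: (surjective_noetherian (f := @mpolyC 0 k)); last exact: field_noetherian.
  by move=> y; exists y@_0%MM; rewrite [RHS]nvar0_mpolyC.
pose f : {rmorphism {mpoly k[n]} -> {mpoly k[n.+1]}} :=
  mmap (@mpolyC n.+1 k) ((fun i => 'X_i) \o @widen_last n).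
apply: (surjective_noetherian (f :=
  (horner_eval ('X_ord_max : {mpoly k[n.+1]}) \o map_poly f))); last exact: poly_noetherian.
move=> q; exists (muni q); rewrite /= /horner_eval -mmap_muni.
rewrite {2}[q]mpolyE /mmap; apply: eq_bigr => m _.
by rewrite mmap1_id mul_mpolyC.
Qed.

(** * Local rings of regular functions *)

Section LocalRing.
Variable k : closedFieldType.

(** For an arbitrary sheaf of functions [regular] has no algebraic closure
properties; these are the ones of varieties at a point, the last one being that
regular functions are continuous. *)
Record local_ring (X : fspace k) (x : X) : Prop := LocalRing {
  regular_cst : forall c, regular x (fun=> c);
  regularD : forall f g, regular x f -> regular x g -> regular x (fun y => f y + g y);
  regularM : forall f g, regular x f -> regular x g -> regular x (fun y => f y * g y);
  regularV : forall f, regular x f -> f x != 0 -> regular x (fun y => (f y)^-1);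
  regular_neq0 : forall f, regular x f -> f x != 0 -> \forall y \near x, f y != 0 }.

Definition locally_ringed (X : fspace k) := forall x : X, local_ring x.

Lemma peval_open n (p : {mpoly k[n]}) : open [set x : affine_space k n | peval p x != 0].
Proof.
exists [set p]; rewrite predeqE => x; split=> /=; first by exists p.
by move=> [_ ->].
Qed.

Lemma peval_near n (p : {mpoly k[n]}) (x : affine_space k n) : peval p x != 0 ->
  \forall y \near x, peval p y != 0.
Proof. by move=> px; apply: (open_nbhs_nbhs (A := [set x | peval p x != 0])); split=> //;
  apply: peval_open. Qed.

Lemma affine_coord_regular n (c : affine_space k n) j :
  regular c (fun u : zaff k n => u 0 j).
Proof.
exists 'X_j, 1; rewrite /peval meval1 oner_neq0; split=> //.
by near=> y; rewrite mevalXU meval1 divr1.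
Unshelve. all: by end_near. Qed.

Lemma affine_space_local_ring n : locally_ringed (affine_space k n).
Proof.
move=> x; split.
- move=> c; exists c%:MP, 1; rewrite /peval meval1 oner_neq0; split=> //.
  by near=> y; rewrite /peval mevalC meval1 divr1.
- move=> f g [p [q [qx fE]]] [p' [q' [qx' gE]]].
  exists (p * q' + p' * q), (q * q'); rewrite {1}/peval mevalM mulf_neq0 //; split=> //.
  have := peval_near qx; have := peval_near qx'; rewrite /peval => n1 n2.
  near=> y; rewrite mevalD !mevalM -addf_div; last 2 first.
  + by near: y.
  + by near: y.
  by congr (_ + _); near: y.
- move=> f g [p [q [qx fE]]] [p' [q' [qx' gE]]].
  exists (p * p'), (q * q'); rewrite {1}/peval mevalM mulf_neq0 //; split=> //.
  near=> y; rewrite /peval !mevalM -mulf_div.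
  by congr (_ * _); near: y.
- move=> f [p [q [qx fE]]] fx; exists q, p; split.
    by move: fx; rewrite (nbhs_singleton fE) mulf_eq0 negb_or => /andP[].
  by apply: filterS fE => y ->; rewrite invf_div.
- move=> f [p [q [qx fE]]] fx.
  have px : peval p x != 0 by move: fx; rewrite (nbhs_singleton fE) mulf_eq0 negb_or =>
    /andP[].
  have := peval_near px; have := peval_near qx => n1 n2.
  near=> y; have -> : f y = peval p y / peval q y by near: y.
  by rewrite mulf_neq0 ?invr_eq0 //; near: y.
Unshelve. all: by end_near. Qed.

Lemma set_val_continuous (X : fspace k) (S : set X) : continuous (set_val : induced S -> X).
Proof. exact: initial_continuous. Qed.

Lemma near_set_val (X : fspace k) (S : set X) (x : induced S) (P : set X) :
  (\forall y \near set_val x, P y) -> \forall y \near x, P (set_val y).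
Proof. exact: set_val_continuous. Qed.

Lemma near_induced (X : fspace k) (U : set X) (x : induced U) (P : set X) : open U ->
  (\forall y \near x, P (set_val y)) -> \forall y \near set_val x, P y.
Proof.
move=> oU [_ [[B oB <-] /= Bx BP]].
have Ux : U (set_val x) by exact: set_valP.
apply: (filterS (P := B `&` U)); last first.
  by apply: open_nbhs_nbhs; split=> //; apply: openI.
move=> y [By Uy]; have := BP (exist _ y (mem_set Uy)); rewrite /= !set_valE; exact.
Qed.

Lemma induced_local_ring (X : fspace k) (S : set X) (x : induced S) :
  local_ring (set_val x) -> local_ring x.
Proof.
move=> [rc rD rM rV rn]; split.
- by move=> c; exists (fun=> c); split=> //; near=> y.
- move=> f g [f' [rf ff']] [g' [rg gg']]; exists (fun y => f' y + g' y); split;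
  first exact: rD.
  by near=> y; congr (_ + _); near: y.
- move=> f g [f' [rf ff']] [g' [rg gg']]; exists (fun y => f' y * g' y); split;
  first exact: rM.
  by near=> y; congr (_ * _); near: y.
- move=> f [f' [rf ff']] fx; exists (fun y => (f' y)^-1); split.
    by apply: rV => //; rewrite -(nbhs_singleton ff').
  by near=> y; congr (_^-1); near: y.
- move=> f [f' [rf ff']] fx; have := rn _ rf; rewrite -(nbhs_singleton ff') =>
  /(_ fx) /near_set_val h.
  near=> y; have -> : f y = f' (set_val y) by near: y.
  by near: y.
Unshelve. all: by end_near. Qed.

Lemma open_local_ring (X : fspace k) (U : set X) (x : induced U) : open U ->
  local_ring x -> local_ring (set_val x).
Proof.
move=> oU [rc rD rM rV rn].
have res f : regular (set_val x) f -> regular x (f \o set_val).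
  by move=> rf; exists f; split=> //; near=> y.
have ext f : regular x (f \o set_val) -> regular (set_val x) f.
  move=> [g [rg fg]]; apply: (regular_germ rg).
  apply: (near_induced (P := fun y => g y = f y) oU).
  by apply: filterS fg => y /= ->.
split.
- by move=> c; apply: ext; apply: (rc c).
- by move=> f g /res rf /res rg; apply: ext; apply: (rD _ _ rf rg).
- by move=> f g /res rf /res rg; apply: ext; apply: (rM _ _ rf rg).
- by move=> f /res rf fx; apply: ext; apply: (rV _ rf fx).
- move=> f /res rf fx; apply: (near_induced (P := fun y => f y != 0) oU).
  exact: (rn _ rf fx).
Unshelve. all: by end_near. Qed.

Lemma iso_local_ring (X Y : fspace k) (f : X -> Y) (x : X) : isomorphism f ->
  local_ring (f x) -> local_ring x.
Proof.
move=> [mf [g [fK gK mg]]] [rc rD rM rV rn].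
have push h : regular x h -> regular (f x) (h \o g).
  by move=> rh; have [_] := mg (f x) Logic.I; apply; rewrite fK.
have pull h : regular (f x) (h \o g) -> regular x h.
  move=> rh; have [_ /(_ _ rh)] := mf x Logic.I.
  by congr (regular x _); rewrite funeqE => y /=; rewrite fK.
split.
- by move=> c; apply: pull; apply: rc.
- by move=> h h' /push rh /push rh'; apply: pull; apply: (rD _ _ rh rh').
- by move=> h h' /push rh /push rh'; apply: pull; apply: (rM _ _ rh rh').
- by move=> h /push rh hx; apply: pull; apply: (rV _ rh); rewrite /= fK.
- move=> h /push rh hx; have [cf _] := mf x Logic.I.
  have := rn _ rh; rewrite /= fK => /(_ hx) hn.
  have hn2 : nbhs x (f @^-1` [set y | h (g y) != 0]) by exact: (cf _ hn).
  by apply: (filterS _ hn2) => y; rewrite /= fK.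
Qed.

(** The properties hold on affine space, and pass to subspaces, along
isomorphisms, and from an open subspace to the whole space. *)
Lemma variety_local_ring (X : fspace k) : variety X -> locally_ringed X.
Proof.
move=> [_ [m [U [hU cov]]] _] x.
have [i _ Ux] : (\bigcup_(i in [set: 'I_m]) U i) x by rewrite cov.
have [oU [n [C [_ [f hf]]]]] := hU i.
have -> : x = set_val (exist _ x (mem_set Ux) : induced (U i)) by [].
apply: open_local_ring => //; apply: (iso_local_ring hf).
exact/induced_local_ring/affine_space_local_ring.
Qed.

End LocalRing.

(** * Products of varieties and generic points of irreducible sets *)

Section Product.
Variable k : closedFieldType.
Variables X Y : fspace k.

(** The topology of a product is given by a subbase, on which continuity can be
tested. *)
Lemma zprod_continuous (T : topologicalType) (f : T -> product X Y) (t : T) :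
  (forall O, zprod_basic O -> O (f t) -> \forall u \near t, O (f u)) ->
  {for t, continuous f}.
Proof.
move=> fO A; rewrite nbhsE => -[B [[D Dsub <-] [E DE Eft]] BA].
have [D' D'sub EE] := Dsub _ DE.
have : nbhs t (f @^-1` E).
  rewrite -EE preimage_bigcap; apply: filter_bigI => O OD.
  apply: fO; first by have := D'sub _ OD; rewrite inE.
  by move: Eft; rewrite -EE => /(_ O); apply.
by apply: filterS => u Eu; apply: BA; exists E.
Qed.

Lemma zprod_basic_open (O : set (product X Y)) : zprod_basic O -> open O.
Proof.
move=> bO; exists [set O]; last by rewrite bigcup_set1.
move=> _ ->; exists [fset O]%fset.
  by move=> P /fset1P ->; apply/mem_set.
by rewrite set_fset1 bigcap_set1.
Qed.

Hypothesis lrX : locally_ringed X.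
Hypothesis lrY : locally_ringed Y.

Lemma regular_lincomb (Z : fspace k) (z : Z) n (c : 'I_n -> k) (b : 'I_n -> Z -> k) :
  local_ring z -> (forall i, regular z (b i)) -> regular z (fun y => \sum_(i < n) c i * b i y).
Proof.
move=> lz; elim: n c b => [|n IH] c b hb.
  have -> : (fun y => \sum_(i < 0) c i * b i y) = (fun=> 0).
    by rewrite funeqE => y; rewrite big_ord0.
  exact: regular_cst.
have -> : (fun y => \sum_(i < n.+1) c i * b i y) =
  (fun y => c ord0 * b ord0 y + \sum_(i < n) c (lift ord0 i) * b (lift ord0 i) y).
  by rewrite funeqE => y; rewrite big_ord_recl.
apply: regularD => //; last exact: IH.
by apply: regularM => //; apply: regular_cst.
Qed.

Lemma slice_l_continuous (y : Y) : continuous (fun x : X => (x, y) : product X Y).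
Proof.
move=> x; apply: zprod_continuous =>
  O [U [U' [h [oU oU' [n [a [b [ha hb ->]]]] ->]]]] /= [Ux U'y hxy].
have reg : regular x (fun u => \sum_(i < n) a i u * b i y).
  under eq_fun do under eq_bigr do rewrite mulrC.
  by apply: regular_lincomb => // i; apply: ha.
have := regular_neq0 (lrX x) reg hxy => n1.
have n2 : nbhs x U by apply: open_nbhs_nbhs.
by near=> u; split=> //; near: u.
Unshelve. all: by end_near. Qed.

Lemma slice_r_continuous (x : X) : continuous (fun y : Y => (x, y) : product X Y).
Proof.
move=> y; apply: zprod_continuous =>
  O [U [U' [h [oU oU' [n [a [b [ha hb ->]]]] ->]]]] /= [Ux U'y hxy].
have reg : regular y (fun u => \sum_(i < n) a i x * b i u).
  by apply: regular_lincomb => // i; apply: hb.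
have := regular_neq0 (lrY y) reg hxy => n1.
have n2 : nbhs y U' by apply: open_nbhs_nbhs.
by near=> u; split=> //; near: u.
Unshelve. all: by end_near. Qed.

Lemma tensor1 (c : k) (U : set X) (U' : set Y) : tensor U U' (fun=> c).
Proof.
exists 1%N, (fun _ _ => c), (fun _ _ => 1); split.
- by move=> i x _; apply: (regular_cst (lrX x)).
- by move=> i x _; apply: (regular_cst (lrY x)).
- by rewrite funeqE => z; rewrite big_ord1 mulr1.
Qed.

Lemma tensor_l (a : X -> k) (U : set X) (U' : set Y) :
  (forall x, U x -> regular x a) -> tensor U U' (fun z => a z.1).
Proof.
move=> ha; exists 1%N, (fun _ => a), (fun _ _ => 1); split.
- by move=> i x /ha.
- by move=> i x _; apply: (regular_cst (lrY x)).
- by rewrite funeqE => z; rewrite big_ord1 mulr1.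
Qed.

Lemma tensor_r (b : Y -> k) (U : set X) (U' : set Y) :
  (forall x, U' x -> regular x b) -> tensor U U' (fun z => b z.2).
Proof.
move=> ha; exists 1%N, (fun _ _ => 1), (fun _ => b); split.
- by move=> i x _; apply: (regular_cst (lrX x)).
- by move=> i x /ha.
- by rewrite funeqE => z; rewrite big_ord1 mul1r.
Qed.

Lemma tensorD (U1 U2 : set X) (U1' U2' : set Y) f g :
  tensor U1 U1' f -> tensor U2 U2' g ->
  tensor (U1 `&` U2) (U1' `&` U2') (fun z => f z + g z).
Proof.
move=> [n [a [b [ha hb ->]]]] [m [a' [b' [ha' hb' ->]]]].
exists (n + m)%N, (fun i : 'I_(n+m) => match fintype.split i with inl j => a j | inr j =>
  a' j end),
  (fun i : 'I_(n+m) => match fintype.split i with inl j => b j | inr j => b' j end); split.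
- by move=> i x [U1x U2x]; case: (fintype.split i) => j; [apply: ha|apply: ha'].
- by move=> i x [U1x U2x]; case: (fintype.split i) => j; [apply: hb|apply: hb'].
rewrite funeqE => z; rewrite big_split_ord /=; congr (_ + _); apply: eq_bigr => i _.
  by case: splitP => j /= => [/ord_inj ->//|h]; have := ltn_ord i; rewrite h ltnNge leq_addr.
case: splitP => j /= => [h|/addnI/ord_inj -> //].
by have := ltn_ord j; rewrite -h ltnNge leq_addr.
Qed.

Lemma tensorM (U1 U2 : set X) (U1' U2' : set Y) f g :
  tensor U1 U1' f -> tensor U2 U2' g ->
  tensor (U1 `&` U2) (U1' `&` U2') (fun z => f z * g z).
Proof.
move=> [n [a [b [ha hb ->]]]]; elim: n a b ha hb => [|n IH] a b ha hb tg.
  have -> : (fun z => (\sum_(i < 0) a i z.1 * b i z.2) * g z) = (fun=> 0).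
    by rewrite funeqE => z; rewrite big_ord0 mul0r.
  exact: tensor1.
have -> : (fun z => (\sum_(i < n.+1) a i z.1 * b i z.2) * g z) =
   (fun z => a ord0 z.1 * b ord0 z.2 * g z +
     (\sum_(i < n) a (lift ord0 i) z.1 * b (lift ord0 i) z.2) * g z).
  by rewrite funeqE => z; rewrite big_ord_recl mulrDl.
rewrite -[U1 `&` U2]setIid -[U1' `&` U2']setIid; apply: tensorD; last first.
  by apply: (IH (fun i => a (lift ord0 i)) (fun i => b (lift ord0 i))) => // i x;
    [apply: ha|apply: hb].
case: tg => m [a' [b' [ha' hb' ->]]].
exists m, (fun i x => a ord0 x * a' i x), (fun i x => b ord0 x * b' i x); split.
- by move=> i x [h h']; apply: regularM => //; [apply: ha|apply: ha'].
- by move=> i x [h h']; apply: regularM => //; [apply: hb|apply: hb'].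
by rewrite funeqE => z; rewrite mulr_sumr; apply: eq_bigr => i _; rewrite mulrACA.
Qed.

Lemma tensor_neq0_near (U : set X) (U' : set Y) p (z : product X Y) : open U -> open U' ->
  tensor U U' p -> U z.1 -> U' z.2 -> p z != 0 -> \forall w \near z, p w != 0.
Proof.
move=> oU oU' tp Uz U'z pz.
have : open_nbhs z [set w : product X Y | [/\ U w.1, U' w.2 & p w != 0]].
  by split=> //; apply: zprod_basic_open; exists U, U', p.
by move=> /open_nbhs_nbhs; apply: filterS => w [].
Qed.

Lemma product_local_ring : locally_ringed (product X Y).
Proof.
move=> z; split.
- move=> c; exists setT, setT, (fun=> c), (fun=> 1); split.
  + by split=> //; apply: openT.
  + exact: tensor1.
  + exact: tensor1.
  + exact: oner_neq0.
  + by near=> w; rewrite divr1.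
- move=> f g [U [U' [p [q [[oU oU' Uz U'z] tp tq qz fE]]]]].
  move=> [W [W' [p' [q' [[oW oW' Wz W'z] tp' tq' qz' gE]]]]].
  have sU : U `&` W = (U `&` W) `&` (U `&` W) by rewrite setIid.
  have sU' : U' `&` W' = (U' `&` W') `&` (U' `&` W') by rewrite setIid.
  exists (U `&` W), (U' `&` W'), (fun z => p z * q' z + p' z * q z), (fun z => q z * q' z);
    split.
  + by split=> //; exact: openI.
  + rewrite sU sU'; apply: tensorD; first exact: tensorM.
    by rewrite [U `&` W]setIC [U' `&` W']setIC; apply: tensorM.
  + exact: tensorM.
  + by rewrite mulf_neq0.
  have n1 := tensor_neq0_near oU oU' tq Uz U'z qz.
  have n2 := tensor_neq0_near oW oW' tq' Wz W'z qz'.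
  near=> w; rewrite -addf_div; last 2 first.
  + by near: w.
  + by near: w.
  by congr (_ + _); near: w.
- move=> f g [U [U' [p [q [[oU oU' Uz U'z] tp tq qz fE]]]]].
  move=> [W [W' [p' [q' [[oW oW' Wz W'z] tp' tq' qz' gE]]]]].
  exists (U `&` W), (U' `&` W'), (fun z => p z * p' z), (fun z => q z * q' z); split.
  + by split=> //; exact: openI.
  + exact: tensorM.
  + exact: tensorM.
  + by rewrite mulf_neq0.
  near=> w; rewrite -mulf_div.
  by congr (_ * _); near: w.
- move=> f [U [U' [p [q [[oU oU' Uz U'z] tp tq qz fE]]]]] fz.
  exists U, U', q, p; split=> //.
    by move: fz; rewrite (nbhs_singleton fE) mulf_eq0 negb_or => /andP[].
  by apply: (filterS _ fE) => w ->; rewrite invf_div.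
- move=> f [U [U' [p [q [[oU oU' Uz U'z] tp tq qz fE]]]]] fz.
  have pz : p z != 0 by move: fz; rewrite (nbhs_singleton fE) mulf_eq0 negb_or => /andP[].
  have n1 := tensor_neq0_near oU oU' tq Uz U'z qz.
  have n2 := tensor_neq0_near oU oU' tp Uz U'z pz.
  near=> w; have -> : f w = p w / q w by near: w.
  by rewrite mulf_neq0 ?invr_eq0 //; near: w.
Unshelve. all: by end_near. Qed.

Lemma tensor_regular (U : set X) (U' : set Y) p (z : product X Y) : open U -> open U' ->
  tensor U U' p -> U z.1 -> U' z.2 -> regular z p.
Proof.
move=> oU oU' tp Uz U'z; exists U, U', p, (fun=> 1); split=> //.
- exact: tensor1.
- exact: oner_neq0.
- by near=> w; rewrite divr1.
Unshelve. all: by end_near. Qed.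

(** At a fixed x a tensor is a k-linear combination of functions regular on
Y. *)
Lemma slice_regular (f : X * Y -> k) (x : X) (y : Y) :
  regular ((x, y) : product X Y) f -> regular y (fun u => f (x, u)).
Proof.
move=> [U [U' [p [q [[oU oU' /= Ux U'y] [n [a [b [ha hb pE]]]] [m [a' [b' [ha' hb' qE]]]]
  qz fE]]]]].
have rp : regular y (fun u => p (x, u)).
  by rewrite pE /=; apply: regular_lincomb => // i; apply: hb.
have rq : regular y (fun u => q (x, u)).
  by rewrite qE /=; apply: regular_lincomb => // i; apply: hb'.
apply: (regular_germ (regularM (lrY y) rp (regularV (lrY y) rq qz))).
have h : nbhs y [set u | f (x, u) = p (x, u) / q (x, u)].
  exact: (@slice_r_continuous x y _ fE).
by apply: (filterS _ h) => u /= ->.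
Qed.

Lemma open_rect (U : set X) (U' : set Y) : open U -> open U' ->
  open [set z : product X Y | U z.1 /\ U' z.2].
Proof.
move=> oU oU'; apply: zprod_basic_open; exists U, U', (fun=> 1); split=> //.
  exact: tensor1.
by rewrite predeqE => z; split=> [[]|[]] //=; split=> //; exact: oner_neq0.
Qed.

Lemma open_fst (U : set X) : open U -> open [set z : product X Y | U z.1].
Proof.
move=> oU; have := open_rect oU (@openT Y); congr open.
by rewrite predeqE => z; split=> [[]|].
Qed.
Lemma open_snd (U : set Y) : open U -> open [set z : product X Y | U z.2].
Proof.
move=> oU; have := open_rect (@openT X) oU; congr open.
by rewrite predeqE => z; split=> [[]|].
Qed.

Lemma open_slice_r (O : set (product X Y)) x : open O -> open [set y | O (x, y)].
Proof. by move=> oO; have /continuousP := @slice_r_continuous x; apply. Qed.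
Lemma open_slice_l (O : set (product X Y)) y : open O -> open [set x | O (x, y)].
Proof. by move=> oO; have /continuousP := @slice_l_continuous y; apply. Qed.

Lemma open_proj_l (O : set (product X Y)) : open O -> open [set x | exists y, O (x, y)].
Proof.
move=> oO; have -> : [set x | exists y, O (x, y)] = \bigcup_y [set x | O (x, y)].
  by rewrite predeqE => x; split=> [[y]|[y]]; exists y.
by apply: bigcup_open => y _; apply: open_slice_l.
Qed.

End Product.

Section Irreducible.
Variable T : topologicalType.

Lemma irreducible_meet (S A B : set T) : irreducible S -> open A -> open B ->
  A `&` S !=set0 -> B `&` S !=set0 -> (A `&` B) `&` S !=set0.
Proof.
move=> [_ irr] oA oB [a [Aa Sa]] [b [Bb Sb]]; apply: contrapT => h.
have := irr (~` A) (~` B) (open_closedC oA) (open_closedC oB).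
case.
- move=> s Ss; apply: contrapT => /not_orP [/contrapT As /contrapT Bs].
  by apply: h; exists s.
- by move=> /(_ a Sa).
- by move=> /(_ b Sb).
Qed.

(** For irreducible S this is a filter in P: the neighbourhoods of the generic
point of S. *)
Definition generic_on (S P : set T) : Prop :=
  exists O, [/\ open O, O `&` S !=set0 & O `&` S `<=` P].

Lemma gen_filter (S : set T) : irreducible S -> ProperFilter (generic_on S).
Proof.
move=> irr; split.
  by move=> [O [_ [x Ox] sub]]; apply: (sub x Ox).
split.
- by exists setT; split=> //; [exact: openT|rewrite setTI; case: irr].
- move=> P Q [A [oA nA AP]] [B [oB nB BQ]]; exists (A `&` B); split.
  + exact: openI.
  + exact: irreducible_meet.
  + by move=> x [[Ax Bx] Sx]; split; [apply: AP|apply: BQ].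
- by move=> P Q PQ [O [oO nO OP]]; exists O; split=> // x /OP /PQ.
Qed.

Lemma gen_open (S O : set T) : open O -> O `&` S !=set0 -> generic_on S O.
Proof. by move=> oO nO; exists O; split=> // x []. Qed.

Lemma genT P : generically P <-> generic_on setT P.
Proof.
split=> [[x Px]|[O [oO [x [Ox _]] OP]]].
  exists (P°); split; first exact: open_interior.
    by exists x.
  by move=> y [/interior_subset].
exists x; rewrite /interior nbhsE; exists O; first by split.
by move=> y Oy; apply: OP.
Qed.

Lemma near_gen (x : T) (P : set T) : nbhs x P -> generic_on setT P.
Proof.
rewrite nbhsE => -[B [oB Bx] BP]; exists B; split=> //; first by exists x.
by move=> y [By _]; apply: BP.
Qed.

Lemma gen_ex (S P : set T) : generic_on S P -> exists2 x, S x & P x.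
Proof. by move=> [O [_ [x [Ox Sx]] OP]]; exists x => //; apply: OP. Qed.
End Irreducible.

(** Two nonempty open sets have projections to X that meet inside S, at x say;
their slices over x are then nonempty open sets of Y, and meet. *)
Lemma product_irreducible (k : closedFieldType) (X Y : fspace k) (S : set X) :
  locally_ringed X -> locally_ringed Y -> irreducible S -> irreducible [set: Y] ->
  irreducible [set z : product X Y | S z.1].
Proof.
move=> lrX lrY irrS irrY; have [[x Sx] _] := irrS; have [[y _] _] := irrY; split.
  by exists (x, y).
move=> A B cA cB sub; apply: contrapT => /not_orP [hA hB].
have oA := closed_openC cA; have oB := closed_openC cB.
have [[x1 y1] /= [Sx1 nA1]] : exists z : product X Y, S z.1 /\ (~` A) z.
  by apply: contrapT => h; apply: hA => z Sz; apply: contrapT => Az; apply: h; exists z.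
have [[x2 y2] /= [Sx2 nB2]] : exists z : product X Y, S z.1 /\ (~` B) z.
  by apply: contrapT => h; apply: hB => z Sz; apply: contrapT => Az; apply: h; exists z.
have [x0 [[[y1' A1] [y2' B2]] Sx0]] :=
  irreducible_meet irrS (open_proj_l lrX oA) (open_proj_l lrX oB)
   (ex_intro _ x1 (conj (ex_intro _ y1 nA1) Sx1)) (ex_intro _ x2 (conj (ex_intro _ y2 nB2)
     Sx2)).
have [y0 [[nA nB] _]] :=
  irreducible_meet irrY (open_slice_r lrY x0 oA) (open_slice_r lrY x0 oB)
  (ex_intro _ y1' (conj A1 Logic.I)) (ex_intro _ y2' (conj B2 Logic.I)).
by case: (sub (x0, y0) Sx0).
Qed.

(** * The field of rational functions *)

Section FunctionField.
Variable k : closedFieldType.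

(** What makes generic germs of regular functions a field. *)
Record ispace := ISpace {
  isp :> fspace k;
  isp_lr : locally_ringed isp;
  isp_irr : irreducible [set: isp] }.

Variable X : ispace.
Implicit Types f g : X -> k.

Definition rational f : Prop :=
  exists U : set X, [/\ open U, U !=set0 & forall x, U x -> regular x f].

Definition aeq f g : Prop := generic_on [set: X] (fun x => f x = g x).

#[local] Instance gen_pfilter : ProperFilter (generic_on [set: X]).
Proof. exact/gen_filter/isp_irr. Qed.

Lemma gen_openT (O : set X) : open O -> O !=set0 -> generic_on setT O.
Proof. by move=> oO nO; apply: gen_open => //; rewrite setIT. Qed.

Lemma aeq_refl f : aeq f f.
Proof. by apply: filterS (filterT (F := generic_on [set: X])). Qed.
Lemma aeq_sym f g : aeq f g -> aeq g f.
Proof. by apply: filterS. Qed.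
Lemma aeq_trans f g h : aeq f g -> aeq g h -> aeq f h.
Proof. by apply: filterS2 => x -> ->. Qed.

Lemma open_meet (U V : set X) : open U -> open V -> U !=set0 -> V !=set0 -> U `&` V !=set0.
Proof.
move=> oU oV nU nV; have := irreducible_meet (isp_irr X) oU oV.
by rewrite !setIT; apply.
Qed.

Lemma rational_cst c : rational (fun=> c).
Proof.
have [[x _] _] := isp_irr X.
exists setT; split; [exact: openT|by exists x|by move=> y _; apply: (regular_cst (isp_lr y))].
Qed.

Lemma rationalD f g : rational f -> rational g -> rational (fun x => f x + g x).
Proof.
move=> [U [oU nU rf]] [V [oV nV rg]]; exists (U `&` V); split;
  [exact: openI|exact: open_meet|].
by move=> x [/rf rfx /rg rgx]; apply: (regularD (isp_lr x)).
Qed.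

Lemma rationalM f g : rational f -> rational g -> rational (fun x => f x * g x).
Proof.
move=> [U [oU nU rf]] [V [oV nV rg]]; exists (U `&` V); split;
  [exact: openI|exact: open_meet|].
by move=> x [/rf rfx /rg rgx]; apply: (regularM (isp_lr x)).
Qed.

Lemma rationalN f : rational f -> rational (fun x => - f x).
Proof.
move=> rf; have := rationalM (rational_cst (-1)) rf; congr rational.
by rewrite funeqE => x; rewrite mulN1r.
Qed.

Lemma regular_open_neq0 (U : set X) f : open U -> (forall x, U x -> regular x f) ->
  open (U `&` [set x | f x != 0]).
Proof.
move=> oU rf; rewrite openE => x [Ux /= fx]; rewrite /interior.
by apply: filterI; [apply: open_nbhs_nbhs|apply: (regular_neq0 (isp_lr x)) => //; apply: rf].
Qed.

Lemma rational_dichotomy f : rational f -> aeq f (fun=> 0) \/ generic_on setT (fun x =>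
  f x != 0).
Proof.
move=> [U [oU nU rf]].
case: (pselect (U `&` [set x | f x != 0] !=set0)) => [ne|ne].
  right; have := gen_openT (regular_open_neq0 oU rf) ne.
  by apply: filterS => x [].
left; apply: filterS (gen_openT oU nU) => x Ux.
by apply/eqP/negP => /negP fx; apply: ne; exists x.
Qed.

Lemma rational_neq0 f : rational f -> ~ aeq f (fun=> 0) -> generic_on setT (fun x => f x != 0).
Proof. by move=> /rational_dichotomy []. Qed.

Lemma rationalV f : rational f -> rational (fun x => (f x)^-1).
Proof.
move=> [U [oU nU rf]].
case: (pselect (U `&` [set x | f x != 0] !=set0)) => [ne|ne].
  exists (U `&` [set x | f x != 0]); split=> //; first exact: regular_open_neq0.
  by move=> x [Ux fx]; apply: (regularV (isp_lr x)) => //; apply: rf.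
exists U; split=> // x Ux.
apply: (regular_germ (regular_cst (isp_lr x) 0)).
apply: filterS (open_nbhs_nbhs (conj oU Ux)) => y Uy.
have -> : f y = 0 by apply/eqP/negP => /negP fy; apply: ne; exists y.
by rewrite invr0.
Qed.

(** Where f - g does not vanish is open, and an open set on which f and g
differ would meet the open set on which they agree. *)
Lemma regular_agree (U : set X) f g : open U -> (forall x, U x -> regular x f) ->
  (forall x, U x -> regular x g) -> aeq f g -> forall x, U x -> f x = g x.
Proof.
move=> oU rf rg fg x Ux; apply/eqP; rewrite -subr_eq0; apply/negP => /negP h.
have rfg y : U y -> regular y (fun z => f z - g z).
  move=> Uy; apply: (regularD (isp_lr y)); first exact: rf.
  have := regularM (isp_lr y) (regular_cst (isp_lr y) (-1)) (rg y Uy).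
  by congr regular; rewrite funeqE => z; rewrite mulN1r.
have ne : (U `&` [set x | f x - g x != 0]) !=set0 by exists x.
have [y _ [[Uy /= h1] h2]] := gen_ex (filterI (gen_openT (regular_open_neq0 oU rfg) ne) fg).
by move: h1; rewrite h2 subrr eqxx.
Qed.

Definition canon f : X -> k := xget (fun=> 0) [set g | rational g /\ aeq f g].

Lemma canonP f : rational f -> rational (canon f) /\ aeq f (canon f).
Proof.
move=> rf; rewrite /canon; case: xgetP => [g _ //|] /(_ f) h.
by exfalso; apply: h; split=> //; exact: aeq_refl.
Qed.

Lemma canon_eq f g : aeq f g -> canon f = canon g.
Proof.
move=> fg; congr xget; rewrite predeqE => h; split=> -[rh fh]; split=> //.
  exact: aeq_trans (aeq_sym fg) fh.
exact: aeq_trans fg fh.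
Qed.

(** A class of rational functions under generic equality is represented by a
chosen member, so that elements of the field have values at points and equality
of elements is equality of functions. *)
Record ratfun := RatFun {
  rep : X -> k;
  rep_rational : rational rep;
  rep_canon : canon rep = rep }.

HB.instance Definition _ := gen_eqMixin ratfun.
HB.instance Definition _ := gen_choiceMixin ratfun.

Lemma rep_inj : injective rep.
Proof.
move=> [f rf cf] [g rg cg] /= fg; subst g.
by rewrite (Prop_irrelevance rf rg) (Prop_irrelevance cf cg).
Qed.

Fact germ_rational f : rational (if pselect (rational f) then canon f else canon (fun=> 0)).
Proof.
case: pselect => rf; first by have [] := canonP rf.
by have [] := canonP (rational_cst 0).
Qed.
Fact germ_canon f : canon (if pselect (rational f) then canon f else canon (fun=> 0)) =
   (if pselect (rational f) then canon f else canon (fun=> 0)).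
Proof.
case: pselect => rf; first by have [_ /canon_eq <-] := canonP rf.
by have [_ /canon_eq <-] := canonP (rational_cst 0).
Qed.
(** The value at a function that is not rational is 0, which makes [germ] total;
it is used on rational functions only. *)
Definition germ f : ratfun := RatFun (germ_rational f) (germ_canon f).

Lemma rep_germ f : rational f -> aeq (rep (germ f)) f.
Proof.
move=> rf; rewrite /germ /=; case: pselect => [rf'|//].
by have [_ h] := canonP rf; apply: aeq_sym.
Qed.

Lemma germ_eq f g : aeq f g -> rational f -> rational g -> germ f = germ g.
Proof.
move=> fg rf rg; apply: rep_inj; rewrite /germ /=.
by case: pselect => // rf'; case: pselect => // rg'; apply: canon_eq.
Qed.

Lemma germ_rep a : germ (rep a) = a.
Proof.
apply: rep_inj; rewrite /germ /=; case: pselect => [h|]; first exact: rep_canon.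
by have := rep_rational a.
Qed.

Lemma ratfun_eq a b : aeq (rep a) (rep b) -> a = b.
Proof. by move=> /germ_eq h; rewrite -(germ_rep a) -(germ_rep b); apply: h;
  exact: rep_rational. Qed.

Definition rf_add a b := germ (fun x => rep a x + rep b x).
Definition rf_mul a b := germ (fun x => rep a x * rep b x).
Definition rf_opp a := germ (fun x => - rep a x).
Definition rf_inv a := germ (fun x => (rep a x)^-1).
Definition rf_cst c := germ (fun=> c).

Lemma rep_add a b : aeq (rep (rf_add a b)) (fun x => rep a x + rep b x).
Proof. by apply: rep_germ; apply: rationalD; exact: rep_rational. Qed.
Lemma rep_mul a b : aeq (rep (rf_mul a b)) (fun x => rep a x * rep b x).
Proof. by apply: rep_germ; apply: rationalM; exact: rep_rational. Qed.
Lemma rep_opp a : aeq (rep (rf_opp a)) (fun x => - rep a x).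
Proof. by apply: rep_germ; apply: rationalN; exact: rep_rational. Qed.
Lemma rep_inv a : aeq (rep (rf_inv a)) (fun x => (rep a x)^-1).
Proof. by apply: rep_germ; apply: rationalV; exact: rep_rational. Qed.
Lemma rep_cst c : aeq (rep (rf_cst c)) (fun=> c).
Proof. by apply: rep_germ; exact: rational_cst. Qed.

Fact rf_addA : associative rf_add.
Proof.
move=> a b c; apply: ratfun_eq.
have h1 := rep_add a (rf_add b c); have h2 := rep_add b c.
have h3 := rep_add (rf_add a b) c; have h4 := rep_add a b.
apply: filterS2 (filterI h1 h2) (filterI h3 h4) => x [-> ->] [-> ->].
by rewrite addrA.
Qed.
Fact rf_addC : commutative rf_add.
Proof.
by move=> a b; apply: ratfun_eq; apply: filterS2 (rep_add a b) (rep_add b a) => x -> ->;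
  rewrite addrC.
Qed.
Fact rf_add0 : left_id (rf_cst 0) rf_add.
Proof.
move=> a; apply: ratfun_eq.
by apply: filterS2 (rep_add (rf_cst 0) a) (rep_cst 0) => x -> ->; rewrite add0r.
Qed.
Fact rf_addN : left_inverse (rf_cst 0) rf_opp rf_add.
Proof.
move=> a; apply: ratfun_eq.
apply: filterS2 (rep_add (rf_opp a) a) (filterI (rep_opp a) (rep_cst 0)) => x -> [-> ->].
by rewrite addNr.
Qed.
HB.instance Definition _ := GRing.isZmodule.Build ratfun rf_addA rf_addC rf_add0 rf_addN.

Fact rf_mulA : associative rf_mul.
Proof.
move=> a b c; apply: ratfun_eq.
have h1 := rep_mul a (rf_mul b c); have h2 := rep_mul b c.
have h3 := rep_mul (rf_mul a b) c; have h4 := rep_mul a b.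
apply: filterS2 (filterI h1 h2) (filterI h3 h4) => x [-> ->] [-> ->].
by rewrite mulrA.
Qed.
Fact rf_mulC : commutative rf_mul.
Proof.
by move=> a b; apply: ratfun_eq; apply: filterS2 (rep_mul a b) (rep_mul b a) => x -> ->;
  rewrite mulrC.
Qed.
Fact rf_mul1 : left_id (rf_cst 1) rf_mul.
Proof.
move=> a; apply: ratfun_eq.
by apply: filterS2 (rep_mul (rf_cst 1) a) (rep_cst 1) => x -> ->; rewrite mul1r.
Qed.
Fact rf_mulDl : left_distributive rf_mul rf_add.
Proof.
move=> a b c; apply: ratfun_eq.
have h1 := rep_mul (rf_add a b) c; have h2 := rep_add a b.
have h3 := rep_add (rf_mul a c) (rf_mul b c); have h4 := rep_mul a c; have h5 := rep_mul b c.
apply: filterS2 (filterI h1 h2) (filterI h3 (filterI h4 h5)) => x [-> ->] [-> [-> ->]].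
by rewrite mulrDl.
Qed.
Fact rf_1neq0 : rf_cst 1 != rf_cst 0.
Proof.
apply/eqP => h.
have := rep_cst 1; rewrite h => h1.
have [x _ [/= -> /eqP]] := gen_ex (filterI h1 (rep_cst 0)).
by rewrite oner_eq0.
Qed.
HB.instance Definition _ :=
  GRing.Zmodule_isComNzRing.Build ratfun rf_mulA rf_mulC rf_mul1 rf_mulDl rf_1neq0.

Fact rf_mulVf (a : ratfun) : a != 0 -> rf_inv a * a = 1.
Proof.
move=> a0; apply: ratfun_eq.
have an0 : generic_on setT (fun x => rep a x != 0).
  apply: rational_neq0; first exact: rep_rational.
  move=> az; move/eqP: a0; apply; apply: ratfun_eq.
  by apply: filterS2 az (rep_cst 0) => x -> ->.
apply: filterS2 (filterI (rep_mul (rf_inv a) a) (rep_inv a)) (filterI an0 (rep_cst 1)).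
by move=> x [-> ->] [a0' ->]; rewrite mulVf.
Qed.
Fact rf_inv0 : rf_inv 0 = 0.
Proof.
apply: ratfun_eq; apply: filterS2 (rep_inv 0) (rep_cst 0) => x.
by move=> -> ->; rewrite invr0.
Qed.
HB.instance Definition _ := GRing.ComNzRing_isField.Build ratfun rf_mulVf rf_inv0.

Lemma repD (a b : ratfun) : aeq (rep (a + b)) (fun x => rep a x + rep b x).
Proof. exact: rep_add. Qed.
Lemma repM (a b : ratfun) : aeq (rep (a * b)) (fun x => rep a x * rep b x).
Proof. exact: rep_mul. Qed.
Lemma repN (a : ratfun) : aeq (rep (- a)) (fun x => - rep a x).
Proof. exact: rep_opp. Qed.
Lemma repV (a : ratfun) : aeq (rep (a^-1)) (fun x => (rep a x)^-1).
Proof. exact: rep_inv. Qed.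
Lemma rep0 : aeq (rep 0) (fun=> 0).
Proof. exact: rep_cst. Qed.
Fact rf_cst_zmod : zmod_morphism rf_cst.
Proof.
move=> c d; apply: ratfun_eq.
have h1 := rep_cst (c - d); have h2 := repD (rf_cst c) (- rf_cst d).
have h3 := repN (rf_cst d).
apply: filterS2 (filterI h1 (filterI h2 h3)) (filterI (rep_cst c) (rep_cst d)).
by move=> x [-> [-> ->]] [-> ->].
Qed.
Fact rf_cst_monoid : monoid_morphism rf_cst.
Proof.
split=> // c d; apply: ratfun_eq.
apply: filterS2 (filterI (rep_cst (c * d)) (repM (rf_cst c) (rf_cst d))) (filterI (rep_cst
  c) (rep_cst d)).
by move=> x [-> ->] [-> ->].
Qed.
HB.instance Definition _ := GRing.isZmodMorphism.Build k ratfun rf_cst rf_cst_zmod.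
HB.instance Definition _ := GRing.isMonoidMorphism.Build k ratfun rf_cst rf_cst_monoid.

End FunctionField.
#[local] Existing Instance gen_pfilter.

(** * The function field of a product and specialisation *)

Section ClassMorphism.
Variables (k : closedFieldType) (X : ispace k).

Lemma germD (f g : X -> k) : rational f -> rational g -> germ (fun x =>
  f x + g x) = germ f + germ g.
Proof.
move=> rf rg; apply: ratfun_eq; have h := repD (germ f) (germ g).
have h' := rep_germ (rationalD rf rg).
by apply: filterS2 (filterI h h') (filterI (rep_germ rf) (rep_germ rg)) => x [-> ->] [-> ->].
Qed.

Lemma germM (f g : X -> k) : rational f -> rational g -> germ (fun x =>
  f x * g x) = germ f * germ g.
Proof.
move=> rf rg; apply: ratfun_eq; have h := repM (germ f) (germ g).
have h' := rep_germ (rationalM rf rg).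
by apply: filterS2 (filterI h h') (filterI (rep_germ rf) (rep_germ rg)) => x [-> ->] [-> ->].
Qed.

Lemma germV (f : X -> k) : rational f -> germ (fun x => (f x)^-1) = (germ f)^-1.
Proof.
move=> rf; apply: ratfun_eq; have h := repV (germ f); have h' := rep_germ (rationalV rf).
by apply: filterS2 (filterI h h') (rep_germ rf) => x [-> ->] ->.
Qed.

Lemma rational_sum (I : Type) (r : seq I) (f : I -> X -> k) : (forall i, rational (f i)) ->
  rational (fun x => \sum_(i <- r) f i x).
Proof.
move=> hf; elim: r => [|i r IH].
  by under eq_fun do rewrite big_nil; apply: rational_cst.
by under eq_fun do rewrite big_cons; apply: rationalD.
Qed.

Lemma germ_sum (I : Type) (r : seq I) (f : I -> X -> k) : (forall i, rational (f i)) ->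
  germ (fun x => \sum_(i <- r) f i x) = \sum_(i <- r) germ (f i).
Proof.
move=> hf; elim: r => [|i r IH].
  by rewrite big_nil; under eq_fun do rewrite big_nil.
rewrite big_cons -IH -germD //; last exact: rational_sum.
by congr germ; rewrite funeqE => x; rewrite big_cons.
Qed.

Lemma rationalX n (f : X -> k) : rational f -> rational (fun x => f x ^+ n).
Proof.
move=> rf; elim: n => [|n IH]; first exact: (rational_cst X 1).
by under eq_fun do rewrite exprS; apply: rationalM.
Qed.

Lemma germX n (f : X -> k) : rational f -> germ (fun x => f x ^+ n) = germ f ^+ n.
Proof.
move=> rf; elim: n => [//|n IH].
rewrite exprS -IH -germM //; last exact: rationalX.
by congr germ; rewrite funeqE => x; rewrite exprS.
Qed.

Lemma germ_eq0 (f : X -> k) : rational f -> germ f = 0 <-> aeq f (fun=> 0).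
Proof.
move=> rf; split=> [f0|f0].
  by apply: aeq_trans (aeq_sym (rep_germ rf)) _; rewrite f0; exact: rep0.
by apply: germ_eq => //; apply: rational_cst.
Qed.

End ClassMorphism.

Section ProductField.
Variables (k : closedFieldType) (V Z : ispace k).

Fact iprod_irr : irreducible [set: product V Z].
Proof.
have := product_irreducible (isp_lr (i:=V)) (isp_lr (i:=Z)) (isp_irr V) (isp_irr Z).
by congr irreducible; rewrite predeqE.
Qed.
Definition iprod : ispace k :=
  ISpace (product_local_ring (isp_lr (i:=V)) (isp_lr (i:=Z))) iprod_irr.

Lemma iopen_proj (O : set iprod) : open O -> open [set x : V | exists z, O (x, z)].
Proof. exact: (@open_proj_l k V Z (isp_lr (i:=V)) O). Qed.
Lemma iopen_slice (O : set iprod) (x : V) : open O -> open [set z : Z | O (x, z)].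
Proof. exact: (@open_slice_r k V Z (isp_lr (i:=Z)) O x). Qed.

Lemma gen_l (S P : set V) : generic_on S P ->
  generic_on [set z : product V Z | S z.1] (fun z => P z.1).
Proof.
move=> [O [oO [x [Ox Sx]] OP]]; have [[z _] _] := isp_irr Z.
exists [set w | O w.1]; split; first exact: (open_fst (isp_lr (i:=V)) (isp_lr (i:=Z))).
  by exists (x, z).
by move=> w [Ow Sw]; apply: OP.
Qed.

Lemma gen_r (S : set V) (P : set Z) : S !=set0 -> generic_on setT P ->
  generic_on [set z : product V Z | S z.1] (fun z => P z.2).
Proof.
move=> [x Sx] [O [oO [z [Oz _]] OP]].
exists [set w | O w.2]; split; first exact: (open_snd (isp_lr (i:=V)) (isp_lr (i:=Z))).
  by exists (x, z).
by move=> w [Ow Sw]; apply: OP.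
Qed.

Lemma genT_l (P : set V) : generic_on setT P -> generic_on [set: iprod] (fun z => P z.1).
Proof. by move=> /gen_l; congr generic_on; rewrite predeqE. Qed.
Lemma genT_r (P : set Z) : generic_on setT P -> generic_on [set: iprod] (fun z => P z.2).
Proof.
have [nV _] := isp_irr V.
by move=> /(gen_r nV); congr generic_on; rewrite predeqE.
Qed.

Lemma gen_slice (P : set iprod) : generic_on setT P ->
  generic_on [set: V] (fun x => generic_on [set: Z] (fun z => P (x, z))).
Proof.
move=> [O [oO [[x z] [Oxz _]] OP]].
exists [set x | exists z, O (x, z)]; split.
- exact: iopen_proj.
- by exists x; split=> //; exists z.
move=> u [[w Ouw] _]; exists [set z | O (u, z)]; split.
- exact: iopen_slice.
- by exists w.
- by move=> v [Ouv _]; apply: OP.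
Qed.

Lemma rational_l (f : V -> k) : rational f -> @rational _ iprod (fun z => f z.1).
Proof.
move=> [U [oU [x Ux] rf]]; have [[z _] _] := isp_irr Z.
exists [set w | U w.1]; split; first exact: (open_fst (isp_lr (i:=V)) (isp_lr (i:=Z))).
  by exists (x, z).
move=> w Uw; apply: (tensor_regular (isp_lr (i:=V)) (isp_lr (i:=Z)) oU openT) => //.
exact: (tensor_l (isp_lr (i:=Z))).
Qed.

Lemma rational_r (f : Z -> k) : rational f -> @rational _ iprod (fun z => f z.2).
Proof.
move=> [U [oU [x Ux] rf]]; have [[z _] _] := isp_irr V.
exists [set w | U w.2]; split; first exact: (open_snd (isp_lr (i:=V)) (isp_lr (i:=Z))).
  by exists (z, x).
move=> w Uw; apply: (tensor_regular (isp_lr (i:=V)) (isp_lr (i:=Z)) openT oU) => //.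
exact: (tensor_r (isp_lr (i:=V))).
Qed.

Definition pull_l (a : ratfun V) : ratfun iprod := @germ _ iprod (fun z => rep a z.1).
Definition pull_r (a : ratfun Z) : ratfun iprod := @germ _ iprod (fun z => rep a z.2).

Lemma pull_l_germ f : rational f -> pull_l (germ f) = @germ _ iprod (fun z => f z.1).
Proof.
move=> rf; apply: germ_eq;
  [exact: genT_l (rep_germ rf)|exact/rational_l/rep_rational|exact: rational_l].
Qed.
Lemma pull_r_germ f : rational f -> pull_r (germ f) = @germ _ iprod (fun z => f z.2).
Proof.
move=> rf; apply: germ_eq;
  [exact: genT_r (rep_germ rf)|exact/rational_r/rep_rational|exact: rational_r].
Qed.

Lemma rep_pull_l a : aeq (rep (pull_l a)) (fun z => rep a z.1).
Proof. by apply: rep_germ; apply/rational_l/rep_rational. Qed.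
Lemma rep_pull_r a : aeq (rep (pull_r a)) (fun z => rep a z.2).
Proof. by apply: rep_germ; apply/rational_r/rep_rational. Qed.

Fact pull_l_zmod : zmod_morphism pull_l.
Proof.
move=> a b; apply: ratfun_eq.
have h1 := rep_pull_l (a - b); have h2 := genT_l (repD a (- b)); have h3 := genT_l (repN b).
have h4 := repD (pull_l a) (- pull_l b); have h5 := repN (pull_l b).
apply: filterS2 (filterI h1 (filterI h2 h3))
  (filterI (filterI h4 h5) (filterI (rep_pull_l a) (rep_pull_l b))).
by move=> x [-> [-> ->]] [[-> ->] [-> ->]].
Qed.
Fact pull_l_monoid : monoid_morphism pull_l.
Proof.
split; first by rewrite [LHS](@pull_l_germ (fun=> 1)) //; apply: rational_cst.
move=> a b; apply: ratfun_eq.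
have h1 := rep_pull_l (a * b); have h2 := genT_l (repM a b).
have h4 := repM (pull_l a) (pull_l b).
apply: filterS2 (filterI h1 h2) (filterI h4 (filterI (rep_pull_l a) (rep_pull_l b))).
by move=> x [-> ->] [-> [-> ->]].
Qed.
HB.instance Definition _ :=
  GRing.isZmodMorphism.Build (ratfun V) (ratfun iprod) pull_l pull_l_zmod.
HB.instance Definition _ :=
  GRing.isMonoidMorphism.Build (ratfun V) (ratfun iprod) pull_l pull_l_monoid.

Fact pull_r_zmod : zmod_morphism pull_r.
Proof.
move=> a b; apply: ratfun_eq.
have h1 := rep_pull_r (a - b); have h2 := genT_r (repD a (- b)); have h3 := genT_r (repN b).
have h4 := repD (pull_r a) (- pull_r b); have h5 := repN (pull_r b).
apply: filterS2 (filterI h1 (filterI h2 h3))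
  (filterI (filterI h4 h5) (filterI (rep_pull_r a) (rep_pull_r b))).
by move=> x [-> [-> ->]] [[-> ->] [-> ->]].
Qed.
Fact pull_r_monoid : monoid_morphism pull_r.
Proof.
split; first by rewrite [LHS](@pull_r_germ (fun=> 1)) //; apply: rational_cst.
move=> a b; apply: ratfun_eq.
have h1 := rep_pull_r (a * b); have h2 := genT_r (repM a b).
have h4 := repM (pull_r a) (pull_r b).
apply: filterS2 (filterI h1 h2) (filterI h4 (filterI (rep_pull_r a) (rep_pull_r b))).
by move=> x [-> ->] [-> [-> ->]].
Qed.
HB.instance Definition _ :=
  GRing.isZmodMorphism.Build (ratfun Z) (ratfun iprod) pull_r pull_r_zmod.
HB.instance Definition _ :=
  GRing.isMonoidMorphism.Build (ratfun Z) (ratfun iprod) pull_r pull_r_monoid.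

Lemma pull_l_cst c : pull_l (rf_cst V c) = rf_cst iprod c.
Proof. by rewrite [LHS]pull_l_germ //; apply: rational_cst. Qed.
Lemma pull_r_cst c : pull_r (rf_cst Z c) = rf_cst iprod c.
Proof. by rewrite [LHS]pull_r_germ //; apply: rational_cst. Qed.

Lemma range_subring (E F : fieldType) (f : {rmorphism E -> F}) : subring (range f).
Proof.
split; first by exists 1 => //; rewrite rmorph1.
  by move=> _ _ [x _ <-] [y _ <-]; exists (x - y); rewrite ?rmorphB.
by move=> _ _ [x _ <-] [y _ <-]; exists (x * y); rewrite ?rmorphM.
Qed.

Lemma germ_tensor (U : set V) (U' : set Z) p (M : set (ratfun iprod)) : open U -> open U' ->
  U !=set0 -> U' !=set0 -> tensor U U' p -> subring M -> range pull_l `<=` M ->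
    range pull_r `<=` M ->
  @rational _ iprod p /\ M (germ (p : iprod -> k)).
Proof.
move=> oU oU' nU nU' [n [a [b [ha hb pE]]]] hM KM LM.
have ra i : rational (a i) by exists U; split=> // x Ux; apply: ha.
have rb i : rational (b i) by exists U'; split=> // x Ux; apply: hb.
have rab i : @rational _ iprod (fun z => a i z.1 * b i z.2).
  by apply: rationalM; [apply: rational_l|apply: rational_r].
split; first by rewrite pE; apply: rational_sum.
rewrite pE (@germ_sum _ iprod _ _ (fun i z => a i z.1 * b i z.2)) //.
apply: subring_sum => // i _; rewrite (@germM _ iprod (fun z => a i z.1) (fun z => b i z.2)).
- have [_ _ MM] := hM; apply: MM.
    by apply: KM; exists (germ (a i)) => //; rewrite pull_l_germ.
  by apply: LM; exists (germ (b i)) => //; rewrite pull_r_germ.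
- exact: rational_l.
- exact: rational_r.
Qed.

(** Near a point a rational function on V x Z is a quotient of two tensors. *)
Lemma product_field_generated : rcl (range pull_l `|` range pull_r) = setT.
Proof.
rewrite predeqE => a; split=> // _; set M := rcl _.
have [U [oU [z Uz] ra]] := rep_rational a.
have [W [W' [p [q [[oW oW' Wz W'z] tp tq qz aE]]]]] := ra z Uz.
have [hM MV _] := rcl_closed (range pull_l `|` range pull_r).
have KM : range pull_l `<=` M by move=> x hx; apply: rcl_sub; left.
have LM : range pull_r `<=` M by move=> x hx; apply: rcl_sub; right.
have [nW nW'] : W !=set0 /\ W' !=set0 by split; [exists z.1|exists z.2].
have [rp Mp] := germ_tensor oW oW' nW nW' tp hM KM LM.
have [rq Mq] := germ_tensor oW oW' nW nW' tq hM KM LM.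
have -> : a = germ (p : iprod -> k) / germ (q : iprod -> k).
  rewrite -germV // -germM //; last exact: rationalV.
  rewrite -{1}[a]germ_rep; apply: germ_eq; first last.
  - by apply: rationalM => //; apply: rationalV.
  - exact: rep_rational.
  exact: near_gen aE.
by have [_ _ MM] := hM; apply: MM => //; apply: MV.
Qed.

(** Restriction to the fibre over x. It depends on the chosen representative, but
for a given a only for x in a proper closed subset of V, and it is compatible
with the field operations for general x. *)
Definition specialise (x : V) (a : ratfun iprod) : ratfun Z := germ (fun z => rep a (x, z)).

Lemma slice_rational (f : iprod -> k) : rational f -> generic_on [set: V] (fun x =>
  rational (fun z => f (x, z))).
Proof.
move=> [U [oU [[x z] Uxz] rf]].
exists [set x | exists z, U (x, z)]; split.
- exact: iopen_proj.
- by exists x; split=> //; exists z.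
move=> u [[w Uuw] _]; exists [set z | U (u, z)]; split.
- exact: iopen_slice.
- by exists w.
by move=> v Uuv; apply: (slice_regular (isp_lr (i:=Z))); apply: rf.
Qed.

Lemma specialise_germ (f : iprod -> k) : rational f -> generic_on [set: V] (fun x =>
  specialise x (germ f) = germ (fun z => f (x, z))).
Proof.
move=> rf; apply: filterS2 (gen_slice (rep_germ rf)) (filterI (slice_rational rf)
  (slice_rational (rep_rational (germ f)))).
by move=> x e [r1 r2]; apply: germ_eq.
Qed.

Lemma specialiseD a b : generic_on [set: V] (fun x =>
  specialise x (a + b) = specialise x a + specialise x b).
Proof.
rewrite -{1}[a]germ_rep -{1}[b]germ_rep -germD; [|exact: rep_rational|exact: rep_rational].
apply: filterS2 (specialise_germ (rationalD (rep_rational a) (rep_rational b)))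
  (filterI (slice_rational (rep_rational a)) (slice_rational (rep_rational b))) => x ->
    [ra rb].
by rewrite germD.
Qed.
Lemma specialiseM a b : generic_on [set: V] (fun x =>
  specialise x (a * b) = specialise x a * specialise x b).
Proof.
rewrite -{1}[a]germ_rep -{1}[b]germ_rep -germM; [|exact: rep_rational|exact: rep_rational].
apply: filterS2 (specialise_germ (rationalM (rep_rational a) (rep_rational b)))
  (filterI (slice_rational (rep_rational a)) (slice_rational (rep_rational b))) => x ->
    [ra rb].
by rewrite germM.
Qed.
Lemma specialiseV a : generic_on [set: V] (fun x => specialise x a^-1 = (specialise x a)^-1).
Proof.
rewrite -{1}[a]germ_rep -germV; last exact: rep_rational.
apply: filterS2 (specialise_germ (rationalV (rep_rational a))) (slice_rational
  (rep_rational a)) => x -> ra.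
by rewrite germV.
Qed.
Lemma specialise_pull_l a : generic_on [set: V] (fun x =>
  specialise x (pull_l a) = rf_cst Z (rep a x)).
Proof. exact: (specialise_germ (rational_l (rep_rational a))). Qed.
Lemma specialise_pull_r a : generic_on [set: V] (fun x => specialise x (pull_r a) = a).
Proof. by apply: filterS (specialise_germ (rational_r (rep_rational a))) => x ->;
  rewrite germ_rep. Qed.
Lemma specialise0 : generic_on [set: V] (fun x => specialise x 0 = 0).
Proof. by apply: filterS (specialise_pull_r 0) => x; rewrite rmorph0. Qed.
Lemma specialise1 : generic_on [set: V] (fun x => specialise x 1 = 1).
Proof. by apply: filterS (specialise_pull_r 1) => x; rewrite rmorph1. Qed.
Lemma specialiseB a b : generic_on [set: V] (fun x =>
  specialise x (a - b) = specialise x a - specialise x b).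
Proof.
apply: filterS2 (specialiseD (a - b) b) specialise0 => x; rewrite subrK => ->;
  by rewrite addrK.
Qed.
Lemma specialiseX a n : generic_on [set: V] (fun x =>
  specialise x (a ^+ n) = specialise x a ^+ n).
Proof.
elim: n => [|n IH]; first exact: specialise1.
by rewrite exprS; apply: filterS2 (specialiseM a (a ^+ n)) IH => x -> ->; rewrite exprS.
Qed.
Lemma specialise_sum (I : Type) (r : seq I) (f : I -> ratfun iprod) :
  generic_on [set: V] (fun x =>
    specialise x (\sum_(i <- r) f i) = \sum_(i <- r) specialise x (f i)).
Proof.
elim: r => [|i r IH].
  by apply: filterS specialise0 => x; rewrite !big_nil.
rewrite big_cons; apply: filterS2 (specialiseD (f i) (\sum_(j <- r) f j)) IH => x -> ->.
by rewrite big_cons.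
Qed.
Lemma specialise_neq0 a : a != 0 -> generic_on [set: V] (fun x => specialise x a != 0).
Proof.
move=> a0; apply: filterS2 (specialiseM a a^-1) (filterI (specialiseV a) specialise1) => x.
rewrite divff // => e [_ e1]; apply/negP => /eqP sa.
by move: e; rewrite e1 sa mul0r => /eqP; rewrite oner_eq0.
Qed.

(** The elements whose restriction to a general fibre is algebraic over S x
form a relatively closed field: an equation restricts to an equation, and its
leading coefficient remains nonzero on a general fibre. *)
Lemma specialise_rcl (S : V -> set (ratfun Z)) (S' : set (ratfun iprod)) :
  (forall x, range (rf_cst Z) `<=` S x) ->
  (forall a, S' a -> generic_on [set: V] (fun x => rcl (S x) (specialise x a))) ->
  forall a, rcl (range pull_l `|` S') a -> generic_on [set: V] (fun x =>
    rcl (S x) (specialise x a)).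
Proof.
move=> kS S'S a; pose M : set (ratfun iprod) := [set a | generic_on [set: V] (fun x =>
  rcl (S x) (specialise x a))].
suff hM : relatively_closed M.
  apply: (rcl_min hM) => b [[c _ <-]|S'b]; last exact: S'S.
  apply: filterS (specialise_pull_l c) => x ->; apply: rcl_sub; apply: kS.
  by exists (rep c x).
split; first split.
- apply: filterS specialise1 => x ->; have [[h _ _] _ _] := rcl_closed (S x); exact: h.
- move=> b c hb hc; apply: filterS2 (specialiseB b c) (filterI hb hc) => x -> [hbx hcx].
  by have [[_ h _] _ _] := rcl_closed (S x); exact: h.
- move=> b c hb hc; apply: filterS2 (specialiseM b c) (filterI hb hc) => x -> [hbx hcx].
  by have [[_ _ h] _ _] := rcl_closed (S x); exact: h.
- move=> b hb; apply: filterS2 (specialiseV b) hb => x -> hbx.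
  by have [_ h _] := rcl_closed (S x); exact: h.
move=> p b p0 hp pb.
have lc : generic_on [set: V] (fun x => specialise x (lead_coef p) != 0).
  by apply: specialise_neq0; rewrite lead_coef_eq0.
have hall : generic_on [set: V] (fun x => forall i : 'I_(size p),
  rcl (S x) (specialise x p`_i)).
  by apply: (@filter_forall _ _ (fun (i : 'I_(size p)) x =>
    rcl (S x) (specialise x p`_i)) (generic_on [set: V]) _) => i; exact: (hp i).
have hX : generic_on [set: V] (fun x => forall i : 'I_(size p),
  specialise x (p`_i * b ^+ i) = specialise x p`_i * specialise x b ^+ i).
  apply: (@filter_forall _ _ (fun (i : 'I_(size p)) x =>
    specialise x (p`_i * b ^+ i) = specialise x p`_i * specialise x b ^+ i) (generic_on
    [set: V]) _) => i.
  by apply: filterS2 (specialiseM p`_i (b ^+ i)) (specialiseX b i) => x -> ->.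
have hsum := specialise_sum (index_enum 'I_(size p)) (fun i : 'I_(size p) => p`_i * b ^+ i).
apply: filterS2 (filterI lc hall) (filterI hX (filterI hsum specialise0)) =>
  x [lcx hx] [hXx [hs s0]].
pose q := \poly_(i < size p) specialise x p`_i.
have [Sring _ Sroot] := rcl_closed (S x); apply: (Sroot q).
- apply: contra_neq lcx => q0; have : q`_(size p).-1 = 0 by rewrite q0 coef0.
  by rewrite coef_poly prednK ?size_poly_gt0 // leqnn.
- move=> i; rewrite coef_poly; case: ltnP => [ip|_]; last exact: subring0.
  exact: (hx (Ordinal ip)).
rewrite rootE horner_poly; under eq_bigr do rewrite -hXx.
by rewrite -hs -horner_coef (rootP pb) s0.
Qed.

(** Take n, the number of elements of L, minimal among the generating families
that mix size zeta elements of C and L. If a constant b were not algebraic over K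
and ys, it could be exchanged for the first element of zs on which it depends. *)
Lemma constants_basis (C : set (ratfun iprod)) (zeta : seq (ratfun Z)) :
  rcl (range (rf_cst Z) `|` [set` zeta]) = setT ->
  exists ys zs, [/\ forall y, y \in ys -> C y, (size ys + size zs)%N = size zeta,
    rcl (range pull_l `|` ([set` ys] `|` pull_r @` [set` zs])) = setT &
    C `<=` rcl (range pull_l `|` [set` ys])].
Proof.
move=> gen_zeta.
pose Q n := exists ys zs, [/\ forall y, y \in ys -> C y, (size ys + size zs)%N = size zeta,
    rcl (range pull_l `|` ([set` ys] `|` pull_r @` [set` zs])) = setT & size zs = n].
have exQ : exists n, `[< Q n >].
  exists (size zeta); apply/asboolP; exists [::], zeta; split=> //.
  apply/seteqP; split=> // a _;
    have : rcl (range pull_l `|` range pull_r) a by rewrite product_field_generated.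
  apply: rcl_mono => {}a [ha|[c _ <-]]; first by apply: rcl_sub; left.
  have : (pull_r @` rcl (range (rf_cst Z) `|` [set` zeta])) (pull_r c).
    by exists c => //; rewrite gen_zeta.
  move/rcl_image; apply: rcl_mono => _ [b [[e _ <-]|bz] <-].
    by rewrite /= pull_r_cst -pull_l_cst; apply: rcl_sub; left; exists (rf_cst V e).
  by apply: rcl_sub; right; right; exists b.
have [n /asboolP[ys [zs [Cys szs gens sn]]] nmin] := ex_minnP exQ.
exists ys, zs; split=> // b Cb; apply: contrapT => bnot.
pose S i := range pull_l `|` ([set` ys] `|` pull_r @` [set` take i zs]).
have exi : exists i, `[< rcl (S i) b >].
  by exists (size zs); apply/asboolP; rewrite /S take_size gens.
have [[|i] /asboolP bi imin] := ex_minnP exi.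
  apply: bnot; apply: rcl_mono bi => a [ha|[ha|[c /=]]]; last by rewrite take0.
    by apply: rcl_sub; left.
  by apply: rcl_sub; right.
have iz : (i < size zs)%N.
  rewrite ltnNge; apply/negP => zi; have := imin i; rewrite ltnn => h; apply: notF; apply: h.
  by apply/asboolP; move: bi; rewrite /S !take_oversize // ltnW.
have nbi : ~ rcl (S i) b.
  by move=> h; have := imin i; rewrite ltnn => h'; apply: notF; apply: h'; apply/asboolP.
set z := nth 0 zs i.
have zr : rcl (S i `|` [set b]) (pull_r z).
  apply: rcl_exchange nbi; apply: rcl_mono bi => a [ha|[ha|[c /=]]].
  - by apply: rcl_sub; left; left.
  - by apply: rcl_sub; left; right; left.
  rewrite (take_nth 0 iz) mem_rcons inE => /orP[/eqP->|ct] <-; apply: rcl_sub; first by right.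
  by left; right; right; exists c.
have : (n <= n.-1)%N.
  apply: nmin; apply/asboolP; exists (b :: ys), (take i zs ++ drop i.+1 zs); split.
  - by move=> y; rewrite inE => /orP[/eqP->//|/Cys].
  - rewrite /= size_cat size_drop size_takel ?(ltnW iz) // -szs.
    by move: (size zs) (size ys) iz => u v; lia.
  - apply/seteqP; split=> // a _; have : [set: ratfun iprod] a by [].
    rewrite -gens; apply: rcl_mono => {}a [ha|[ha|[c /= cz <-]]].
    + by apply: rcl_sub; left.
    + by apply: rcl_sub; right; left; rewrite /= inE; apply/orP; right.
    have [->|cnz] := eqVneq c z.
      apply: rcl_mono zr => e [[he|[he|[d dt <-]]]|->]; apply: rcl_sub.
      - by left.
      - by right; left; rewrite /= inE; apply/orP; right.
      - by right; right; exists d => //=; rewrite mem_cat; apply/orP; left.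
      - by right; left; rewrite /= inE eqxx.
    apply: rcl_sub; right; right; exists c => //=.
    move: cz; rewrite -{1}(cat_take_drop i zs) (drop_nth 0 iz) !mem_cat inE -/z (negbTE cnz).
    by [].
  - rewrite size_cat size_drop size_takel ?(ltnW iz) // -sn.
    by move: (size zs) iz => u; lia.
by move: iz; rewrite sn; case: (n) => // m _; rewrite ltnn.
Qed.

End ProductField.

(** * Constants of the product system *)

Lemma filter_all_seq (T : Type) (I : eqType) (F : set_system T) (r : seq I) (P : I -> set T) :
  Filter F -> (forall i, i \in r -> F (P i)) -> F (fun x => forall i, i \in r -> P i x).
Proof.
move=> FF; elim: r => [|i r IH] h; first by apply: filterS filterT => x _ i; rewrite in_nil.
apply: filterS2 (h i (mem_head _ _)) (IH _) => [x Pi Pr j|j jr].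
  by rewrite inE => /orP[/eqP->|/Pr].
by apply: h; rewrite inE jr orbT.
Qed.

Section LinearDisjointness.
Variables (k : closedFieldType) (s : field_aut k) (V Z : ispace k).
Variables (phi : V -> V) (psi : Z -> Z).
Notation T := (iprod V Z).
Definition prod_map (w : T) : T := (phi w.1, psi w.2).
Hypothesis prod_map_gen : forall P : set T,
  generic_on setT P -> generic_on setT (fun w => P (prod_map w)).
Hypothesis phi_rational : forall e : V -> k, rational e -> rational (fun v => s (e (phi v))).
Hypothesis invariant_constant : forall e : V -> k, rational e ->
  aeq (fun v => s (e (phi v))) e -> exists c, aeq e (fun=> c).

Definition tau_fixed (f : T -> k) : Prop := aeq (fun w => s (f (prod_map w))) f.

(** Normalise a coefficient to 1 and subtract the relation from its transform:
since the f's are fixed, the coefficients e become tau(e) - e and one term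
disappears. By induction there is a relation over k, or all the normalised
coefficients are invariant, hence constant. *)
Lemma linear_disjoint (I : eqType) (r : seq I) (e : I -> V -> k) (f : I -> T -> k) :
  uniq r -> (forall i, rational (e i)) -> (forall i, tau_fixed (f i)) ->
  @aeq _ T (fun w => \sum_(i <- r) e i w.1 * f i w) (fun=> 0) ->
  (forall i, i \in r -> aeq (e i) (fun=> 0)) \/
  exists2 l : I -> k, (exists2 i, i \in r & l i != 0) &
    @aeq _ T (fun w => \sum_(i <- r) l i * f i w) (fun=> 0).
Proof.
move=> + + ff; elim: r e => [|i r IH] e /= ur re er0; first by left.
have /andP[ir {}ur] := ur.
have ext : (exists2 l : I -> k, (exists2 i, i \in r & l i != 0) &
    @aeq _ T (fun w => \sum_(i <- r) l i * f i w) (fun=> 0)) ->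
  exists2 l : I -> k, (exists2 j, j \in i :: r & l j != 0) &
    @aeq _ T (fun w => \sum_(i <- i :: r) l i * f i w) (fun=> 0).
  move=> [l [j jr lj] lr]; exists (fun j => if j == i then 0 else l j).
    exists j; first by rewrite inE jr orbT.
    by case: (eqVneq j i) => // ji; move: jr; rewrite ji (negbTE ir).
  apply: filterS lr => w lw; rewrite -[RHS]lw big_cons /= eqxx mul0r add0r.
  apply: eq_big_seq => j' jr'; case: eqP => // ji; by move: jr'; rewrite ji (negbTE ir).
have [ei|ei] := rational_dichotomy (re i).
  have [|h|h] := IH e ur re; last by right; apply: ext.
    by apply: filterS2 er0 (genT_l Z ei) => w; rewrite big_cons => + eiw;
      rewrite eiw mul0r add0r.
  by left=> j; rewrite inE => /orP[/eqP->|/h].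
pose g j v := e j v / e i v.
have rg j : rational (g j) by apply: rationalM => //; apply: rationalV.
have gr0 : @aeq _ T (fun w => f i w + \sum_(j <- r) g j w.1 * f j w) (fun=> 0).
  apply: filterS2 er0 (genT_l Z ei) => w; rewrite big_cons => + eiw.
  move=> /(congr1 (fun x => (e i w.1)^-1 * x));
    rewrite mulr0 mulrDr mulrA mulVf // mul1r mulr_sumr => h; rewrite -[RHS]h.
  by congr (_ + _); apply: eq_bigr => j _; rewrite mulrA [_^-1 * _]mulrC.
pose e' j v := s (g j (phi v)) - g j v.
have re' j : rational (e' j).
  by apply: rationalD; [exact: phi_rational|exact: rationalN].
have ffr : generic_on setT (fun w : T => forall j, j \in i :: r ->
  s (f j (prod_map w)) = f j w).
  by apply: (@filter_all_seq _ _ (generic_on [set: T]) (i :: r) (fun j w =>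
    s (f j (prod_map w)) = f j w)) => j _; exact: ff.
have e'r0 : @aeq _ T (fun w => \sum_(j <- r) e' j w.1 * f j w) (fun=> 0).
  apply: filterS2 (filterI gr0 (prod_map_gen gr0)) ffr => w [h1 /(congr1 s) h2] hf.
  rewrite rmorph0 rmorphD rmorph_sum hf ?mem_head // in h2.
  have : \sum_(j <- r) s (g j (phi w.1)) * f j w = \sum_(j <- r) g j w.1 * f j w.
    apply: (addrI (f i w)); rewrite h1 -[RHS]h2; congr (_ + _).
    by apply: eq_big_seq => j jr; rewrite [RHS]rmorphM hf // inE jr orbT.
  by move=> h; under eq_bigr do rewrite mulrBl; rewrite sumrB h subrr.
have [e'0|h] := IH e' ur re' e'r0; last by right; apply: ext.
right.
have : forall j, exists c, j \in r -> aeq (g j) (fun=> c).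
  move=> j; case: (boolP (j \in r)) => [jr|]; last by exists 0.
  have [|c hc] := invariant_constant (rg j); last by exists c.
  by apply: filterS (e'0 j jr) => v /eqP; rewrite subr_eq0 => /eqP.
move=> /choice [c hc].
exists (fun j => if j == i then 1 else c j).
  by exists i; rewrite ?mem_head // eqxx oner_neq0.
have hcr : generic_on setT (fun w : T => forall j, j \in r -> g j w.1 = c j).
  apply: (@filter_all_seq _ _ (generic_on [set: T]) r (fun j w => g j w.1 = c j)) => j jr.
  exact: (genT_l Z (hc j jr)).
apply: filterS2 gr0 hcr => w gw hw; rewrite -[RHS]gw big_cons /= eqxx mul1r; congr (_ + _).
apply: eq_big_seq => j jr; case: eqP => [ji|_]; last by rewrite hw.
by move: jr; rewrite ji (negbTE ir).
Qed.

Definition tau_constants : set (ratfun T) := [set a | tau_fixed (rep a)].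

Lemma tau_constant_germ f : rational f -> tau_fixed f -> tau_constants (germ f).
Proof.
move=> rf tf; have h := rep_germ rf.
by apply: filterS2 (filterI h tf) (prod_map_gen h) => w /= [-> <-] ->.
Qed.

Lemma tau_constants1 : tau_constants 1.
Proof.
apply: tau_constant_germ; first exact: rational_cst.
by apply: filterS filterT => w _; rewrite rmorph1.
Qed.

Lemma tau_constantsM a b : tau_constants a -> tau_constants b -> tau_constants (a * b).
Proof.
move=> ha hb; have h := repM a b.
apply: filterS2 (filterI h (prod_map_gen h)) (filterI ha hb) => w [-> ->] [<- <-].
by rewrite rmorphM.
Qed.

Lemma tau_constantsX a n : tau_constants a -> tau_constants (a ^+ n).
Proof.
move=> ha; elim: n => [|n IH]; first exact: tau_constants1.
by rewrite exprS; apply: tau_constantsM.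
Qed.

Lemma poly_split_X (R : nzRingType) (q : {poly R}) : q != 0 ->
  exists (q' : {poly R}) (j : nat), q'`_0 != 0 /\ q = q' * 'X^j.
Proof.
have [n] := ubnP (size q); elim: n q => // n IH q; rewrite ltnS => qn q0.
have [q00|] := eqVneq q`_0 0; last by exists q, 0%N; rewrite expr0 mulr1.
pose q1 : {poly R} := \poly_(i < (size q).-1) q`_i.+1.
have qE : q = q1 * 'X.
  apply/polyP => i; rewrite coefMX; case: i => [|i] //=; rewrite coef_poly; case: ltnP =>
    // iq.
  by rewrite nth_default // -[size q]prednK ?size_poly_gt0.
have q10 : q1 != 0 by apply: contra_neq q0 => h; rewrite qE h mul0r.
have [|//|q' [j [q'0 q1E]]] := IH q1.
  by move: qn; rewrite {1}qE size_mulX.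
by exists q', j.+1; rewrite exprSr mulrA -q1E.
Qed.

(** The second property combines [constants_basis] with linear disjointness.
For the third, restrict to a general fibre the fact that F is algebraic over K,
the y's and the remaining elements of L: if the restricted y's were dependent over
k, one of them could be omitted, and k(Z) would be algebraic over fewer than
size zeta of its elements. *)
Lemma constants_transcendence (zeta : seq (ratfun Z)) :
  rcl (range (rf_cst Z) `|` [set` zeta]) = setT ->
  (forall l : seq (ratfun Z), rcl (range (rf_cst Z) `|` [set` l]) = setT ->
    (size zeta <= size l)%N) ->
  exists r (y : 'I_r -> ratfun T), [/\ forall i, tau_constants (y i),
    forall b, tau_constants b -> b != 0 -> exists q : {poly {mpoly k[r]}},
      q`_0 != 0 /\ (map_poly (mmap (rf_cst T) y) q).[b] = 0 &
    generic_on [set: V] (fun x => forall q : {mpoly k[r]}, q != 0 ->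
      mmap (rf_cst Z) (fun i => specialise x (y i)) q != 0)].
Proof.
move=> gz minz; have [ys [zs [Cys szs gens Ccl]]] := constants_basis tau_constants gz.
pose r := size ys; pose y := tnth (in_tuple ys).
have ymem i : y i \in ys by exact: mem_tnth.
have yrange : [set` ys] `<=` range y.
  by move=> b /= /(nthP 0)[i iys <-]; exists (Ordinal iys) => //; rewrite /y (tnth_nth 0).
exists r, y; split=> [i|b Cb b0|]; first exact/Cys/ymem.
- have hK : subring (range (@pull_l k V Z)) by exact: range_subring.
  have [|p [p0 Kp pb]] := @rcl_dependent _ (range (@pull_l k V Z)) r y b hK.
    apply: rcl_mono (Ccl _ Cb) => a [ha|/yrange ha]; apply: rcl_sub; [by left|by right;
      exact: ha].
  have /choice [a aP] : forall im : nat * 'X_{1..r}, exists a, pull_l Z a = (p`_im.1)@_im.2.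
    by move=> [i m] /=; have [a _ <-] := Kp i m; exists a.
  pose I := [seq (i, m) | i <- iota 0 (size p), m <- msupp p`_i].
  pose mon (im : nat * 'X_{1..r}) : ratfun T := mmap1 y im.2 * b ^+ im.1.
  have uI : uniq I.
    apply: allpairs_uniq_dep; [exact: iota_uniq|by move=> i _; exact: msupp_uniq|].
    by move=> [i m] [i' m'] _ _ /= [-> ->].
  have Cmon im : tau_constants (mon im).
    apply: tau_constantsM; last exact: tau_constantsX.
    rewrite /mmap1; elim/big_rec: _ => [|i c _ hc]; first exact: tau_constants1.
    by apply: tau_constantsM => //; apply: tau_constantsX; apply/Cys/ymem.
  have relF : \sum_(im <- I) pull_l Z (a im) * mon im = 0.
    rewrite -[RHS]pb (horner_coef_wide b (size_poly _ _)).
    rewrite -(big_mkord xpredT (fun i =>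
      (map_poly (meval y) p)`_i * b ^+ i)) /index_iota subn0.
    rewrite big_allpairs_dep /=; apply: eq_bigr => i _; rewrite coef_map /= mevalE mulr_suml.
    by apply: eq_bigr => m _; rewrite aP mulrA.
  have rsum (c : nat * 'X_{1..r} -> V -> k) : (forall im, rational (c im)) ->
      @germ _ T (fun w => \sum_(im <- I) c im w.1 * rep (mon im) w) =
      \sum_(im <- I) pull_l Z (germ (c im)) * mon im.
    move=> rc; rewrite (@germ_sum _ T _ I (fun im w => c im w.1 * rep (mon im) w)) => [|im].
      apply: eq_bigr => im _.
      rewrite (@germM _ T (fun w => c im w.1)) ?germ_rep ?pull_l_germ //;
        first exact: rational_l.
      exact: rep_rational.
    by apply: rationalM; [exact: rational_l|exact: rep_rational].
  have rsumR (c : nat * 'X_{1..r} -> V -> k) : (forall im, rational (c im)) ->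
      @rational _ T (fun w => \sum_(im <- I) c im w.1 * rep (mon im) w).
    move=> rc; apply: (@rational_sum _ T _ I (fun im w => c im w.1 * rep (mon im) w)) => im.
    by apply: rationalM; [exact: rational_l|exact: rep_rational].
  have [|||h|[l [im0 im0I l0] lr]] := linear_disjoint (r := I) (e := fun im =>
    rep (a im)) (f := fun im => rep (mon im)) uI.
  + by move=> im; apply: rep_rational.
  + exact: Cmon.
  + apply/germ_eq0; first by apply: (rsumR (fun im => rep (a im))) => im; exact: rep_rational.
    rewrite (rsum (fun im => rep (a im))) => [|im]; last exact: rep_rational.
    by under eq_bigr do rewrite germ_rep.
  + exfalso; move/eqP: p0; apply; apply/polyP => i; rewrite coef0; apply/mpolyP => m;
    rewrite mcoeff0.
    have [//|pim] := eqVneq (p`_i)@_m 0.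
    have imI : (i, m) \in I.
      apply/allpairsPdep; exists i, m; split=> //; last by rewrite mcoeff_msupp.
      rewrite mem_iota /= add0n ltnNge; apply: contra pim => /(nth_default 0) ->.
      by rewrite mcoeff0.
    have := h _ imI; rewrite /= => /(germ_eq0 (rep_rational _)); rewrite germ_rep => a0.
    by rewrite -(aP (i, m)) a0 rmorph0.
  (* Indexing by distinct monomials makes q nonzero as soon as one l im is. *)
  pose q : {poly {mpoly k[r]}} := \sum_(im <- I) (l im *: 'X_[im.2]) *: 'X^(im.1).
  have qb : (map_poly (mmap (rf_cst T) y) q).[b] = 0.
    rewrite rmorph_sum horner_sum /=.
    have cz : @germ _ T (fun w => \sum_(im <- I) l im * rep (mon im) w) = 0.
      apply/germ_eq0 => //; apply: (rsumR (fun im _ => l im)) => im; exact: rational_cst.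
    rewrite -[RHS]cz (rsum (fun im _ => l im)) => [|im]; last exact: rational_cst.
    apply: eq_bigr => im _; rewrite map_polyZ /= map_polyXn hornerZ hornerXn mmapZ mmapX.
    have -> : pull_l Z (germ (fun=> l im)) = rf_cst T (l im) by exact: pull_l_cst.
    by rewrite mulrA.
  have q0 : q != 0.
    apply: contraNneq l0 => q0.
    have := congr1 (fun u : {poly {mpoly k[r]}} => (u`_im0.1)@_im0.2) q0.
    rewrite coef0 mcoeff0 coef_sum raddf_sum /= (bigD1_seq im0) //= big1 => [|im im_im0].
      by rewrite addr0 coefZ coefXn eqxx mulr1 mcoeffZ mcoeffX eqxx mulr1 => ->.
    rewrite coefZ coefXn; case: (eqVneq im0.1 im.1) => [e1|_]; last by rewrite mulr0 mcoeff0.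
    rewrite mulr1 mcoeffZ mcoeffX; case: (eqVneq im.2 im0.2) => [e2|_]; last by rewrite mulr0.
    by case/eqP: im_im0; case: (im) (im0) e1 e2 => [i m] [i' m'] /= -> ->.
  have [q' [j [q'0 qE]]] := poly_split_X q0.
  exists q'; split=> //; move: qb; rewrite qE rmorphM /= map_polyXn hornerM hornerXn => /eqP.
  by rewrite mulf_eq0 expf_eq0 (negbTE b0) andbF orbF => /eqP.
(* On a general fibre all of k(Z) is algebraic over these d elements. *)
pose S x := range (rf_cst Z) `|` [set` [seq specialise x (y i) | i <- enum 'I_r] ++ zs].
have spS a : generic_on [set: V] (fun x => rcl (S x) (specialise x a)).
  apply: (specialise_rcl (S := S) (S' := [set` ys] `|` (@pull_r k V Z) @` [set` zs])).
  - by move=> x c hc; left.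
  - move=> b [/yrange [i _ <-]|[c /= cz <-]].
      apply: filterS filterT => x _; apply: rcl_sub; right => /=.
      by rewrite mem_cat; apply/orP; left; apply/mapP; exists i; rewrite ?mem_enum.
    apply: filterS (specialise_pull_r V c) => x ->; apply: rcl_sub; right => /=.
    by rewrite mem_cat cz orbT.
  by rewrite gens.
have gall : generic_on [set: V] (fun x => forall c, c \in zeta -> rcl (S x) c).
  apply: (@filter_all_seq _ _ (generic_on [set: V]) zeta (fun c x => rcl (S x) c)) => c _.
  by apply: filterS2 (spS (pull_r V c)) (specialise_pull_r V c) => x + e; rewrite e.
apply: filterS gall => x hx q q0; apply/negP => /eqP /(dependent_redundant q0) [i hi].
have := minz ([seq specialise x (y j) | j <- enum 'I_r & j != i] ++ zs).
have szf : (size [seq j <- enum 'I_r | j != i] < r)%N.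
  rewrite size_filter -[X in (_ < X)%N](size_enum_ord r) -(count_predC (pred1 i) (enum
    'I_r)) addnC.
  by rewrite -[X in (X < _)%N]addn0 ltn_add2l -has_count has_pred1 mem_enum.
rewrite leqNgt size_cat size_map -szs ltn_add2r szf => h; apply: notF; apply: h.
apply/seteqP; split=> // c _; have : rcl (range (rf_cst Z) `|` [set` zeta]) c by rewrite gz.
apply: rcl_mono => {}c [hc|/= cz]; first by apply: rcl_sub; left.
have := hx c cz; apply: rcl_mono => {}c {cz} [hc|/=]; first by apply: rcl_sub; left.
rewrite mem_cat => /orP[/mapP[j _ ->]|cz]; last first.
  by apply: rcl_sub; right; rewrite /= mem_cat cz orbT.
have [->|ji] := eqVneq j i.
  apply: (rcl_mono _ hi) => d [hd|[j' j'i <-]]; apply: rcl_sub; [by left|right] => /=.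
  by rewrite mem_cat; apply/orP; left; apply/mapP; exists j' => //;
    rewrite mem_filter mem_enum andbT; exact: j'i.
apply: rcl_sub; right; rewrite /= mem_cat; apply/orP; left.
by apply/mapP; exists j => //; rewrite mem_filter mem_enum andbT.
Qed.
End LinearDisjointness.

(** * Affine charts *)

Section PolynomialFunctions.
Variable k : closedFieldType.

(** Several classes of functions below are given by predicates; this is what is
needed to substitute their members into polynomials. *)
Definition fun_algebra (T : Type) (R : set (T -> k)) : Prop :=
  [/\ forall c, R (fun=> c), forall f g, R f -> R g -> R (fun x => f x + g x) &
      forall f g, R f -> R g -> R (fun x => f x * g x)].

Lemma fun_algebraX (T : Type) (R : set (T -> k)) f n : fun_algebra R -> R f -> R (fun x =>
  f x ^+ n).
Proof.
move=> [Rc _ RM] Rf; elim: n => [|n IH]; first exact: Rc.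
by under eq_fun do rewrite exprS; apply: RM.
Qed.

Lemma fun_algebra_sum (T I : Type) (R : set (T -> k)) (r : seq I) (f : I -> T -> k) :
  fun_algebra R -> (forall i, R (f i)) -> R (fun x => \sum_(i <- r) f i x).
Proof.
move=> [Rc RD _] Rf; elim: r => [|i r IH]; first by under eq_fun do rewrite big_nil.
by under eq_fun do rewrite big_cons; apply: RD.
Qed.

Lemma fun_algebra_meval (T : Type) (R : set (T -> k)) n (f : 'I_n -> T ->
  k) (p : {mpoly k[n]}) :
  fun_algebra R -> (forall i, R (f i)) -> R (fun x => p.@[fun i => f i x]).
Proof.
move=> RA Rf; have [Rc RD RM] := RA.
under eq_fun do rewrite mevalE; apply: fun_algebra_sum => // m.
apply: (RM (fun=> p@_m)) => //.
elim: (index_enum _) => [|i r IH]; first by under eq_fun do rewrite big_nil.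
by under eq_fun do rewrite big_cons; apply: RM => //; apply: fun_algebraX.
Qed.

Lemma regular_algebra (X : fspace k) (U : set X) : locally_ringed X ->
  fun_algebra [set f | forall x, U x -> regular x f].
Proof.
move=> lr; split=> [c x _|f g rf rg x Ux|f g rf rg x Ux].
- exact: regular_cst.
- by apply: regularD => //; [apply: rf|apply: rg].
- by apply: regularM => //; [apply: rf|apply: rg].
Qed.

Lemma rational_algebra (X : ispace k) : fun_algebra [set f : X -> k | rational f].
Proof. by split=> [c|f g|f g]; [exact: rational_cst|exact: rationalD|exact: rationalM]. Qed.

Lemma germ_meval (X : ispace k) n (f : 'I_n -> X -> k) (p : {mpoly k[n]}) :
  (forall i, rational (f i)) ->
  germ (fun x => p.@[fun i => f i x]) = mmap (rf_cst X) (fun i => germ (f i)) p.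
Proof.
move=> rf.
have rprod m (r : seq 'I_n) : rational (fun x => \prod_(i <- r) f i x ^+ m i) /\
   germ (fun x => \prod_(i <- r) f i x ^+ m i) = \prod_(i <- r) germ (f i) ^+ m i.
  elim: r => [|i r [IH1 IH2]].
    rewrite big_nil; under [fun x => _]eq_fun do rewrite big_nil.
    by split; [exact: rational_cst|].
  have rX := rationalX (m i) (rf i).
  under [fun x => _]eq_fun do rewrite big_cons.
  by split; [exact: rationalM|rewrite germM // big_cons germX // IH2].
under eq_fun do rewrite mevalE.
rewrite (@germ_sum _ X _ _ (fun m x => p@_m * \prod_(i < n) f i x ^+ m i)) => [|m].
  apply: eq_bigr => m _; have [h1 h2] := rprod m (index_enum _).
  by rewrite (@germM _ X (fun=> p@_m)) ?h2 //; exact: rational_cst.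
by apply: (@rationalM _ X (fun=> p@_m)); [exact: rational_cst|have [] :=
  rprod m (index_enum _)].
Qed.

End PolynomialFunctions.

Section Charts.
Variables (k : closedFieldType).

(** The coordinates are total functions on X, arbitrary outside U. *)
Record chart (X : fspace k) (U : set X) n (x : X -> affine_space k n) : Prop := Chart {
  chart_open : open U;
  chart_regular : forall v j, U v -> regular v (fun u => x u 0 j);
  chart_quotient : forall v f, U v -> regular v f -> exists p q : {mpoly k[n]},
    peval q (x v) != 0 /\ \forall u \near v, f u = peval p (x u) / peval q (x u);
  chart_basis : forall v O, U v -> open O -> O v -> exists p : {mpoly k[n]},
    peval p (x v) != 0 /\ forall u, U u -> peval p (x u) != 0 -> O u }.

Lemma affine_chart (X : fspace k) (U : set X) : open U -> affine (induced U) ->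
  exists n (x : X -> affine_space k n), chart U x.
Proof.
move=> oU [n [C [_ [f [mf [g [fK gK mg]]]]]]]; exists n.
pose x (v : X) : affine_space k n :=
  if pselect (U v) is left h then set_val (f (exist _ v (mem_set h))) else 0.
have xE (v : induced U) : x (set_val v) = set_val (f v).
  rewrite /x; case: pselect => [h|[]]; last exact: set_valP.
  by congr (set_val (f _)); apply: val_inj.
exists x; split=> //.
- move=> v j Uv; have -> : v = set_val (exist _ v (mem_set Uv) : induced U) by [].
  set v' : induced U := exist _ _ _.
  have [_ /(_ (fun c => (set_val c : zaff k n) 0 j))] := mf v' Logic.I.
  case.
    exists (fun c : zaff k n => c 0 j); split; last by near=> y.
    exact: affine_coord_regular.
  move=> h [rh hE]; apply: (regular_germ rh).
  apply: (near_induced (P := fun u => h u = x u 0 j) oU).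
  by apply: filterS hE => u /= <-; rewrite xE.
- move=> v h Uv; have -> : v = set_val (exist _ v (mem_set Uv) : induced U) by [].
  set v' : induced U := exist _ _ _ => rh.
  have rh' : regular v' (h \o set_val) by exists h; split=> //; near=> y.
  have [_ /(_ (h \o set_val))] := mg (f v') Logic.I.
  rewrite fK => /(_ rh') [h' [[p [q [qf hE]]] hgE]]; exists p, q; rewrite xE; split=> //.
  apply: (near_induced (P := fun u => h u = peval p (x u) / peval q (x u)) oU).
  have [cf _] := mf v' Logic.I.
  have n1 : nbhs v' (f @^-1` [set c | (h \o set_val \o g) c = h' (set_val c)]) by exact:
    (cf _ hgE).
  have n2 : nbhs v' (f @^-1` [set c : induced C | h' (set_val c) = peval p (set_val c) /
    peval q (set_val c)]).
    exact: (cf _ (@near_set_val k (affine_space k n) C (f v') (fun c =>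
      h' c = peval p c / peval q c) hE)).
  apply: (@filterS2 _ (nbhs v') _ _ _ _ _ n1 n2) => u /= h1 h2.
  by rewrite xE -h2 -h1 fK.
- move=> v O Uv oO Ov; pose v' : induced U := exist _ v (mem_set Uv).
  have n1 : nbhs (f v') (g @^-1` (set_val @^-1` O)).
    have [cg _] := mg (f v') Logic.I; apply: cg; rewrite fK.
    by apply: (@near_set_val k X U v' O); apply: open_nbhs_nbhs.
  move: n1 => [_ [[_ [S ->] <-] /= [p Sp pv] BO]]; exists p.
  rewrite (xE v'); split=> // u Uu; pose u' : induced U := exist _ u (mem_set Uu).
  rewrite (xE u') => pu; have := BO (f u'); rewrite /= fK; apply.
  by exists p.
Unshelve. all: by end_near. Qed.

Lemma variety_chart (X : fspace k) : variety X -> exists (U : set X) n (x : X ->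
  affine_space k n),
  U !=set0 /\ chart U x.
Proof.
move=> [[[v _] _] [m [U [hU cov]]] _].
have [i _ Uv] : (\bigcup_(i in [set: 'I_m]) U i) v by rewrite cov.
have [oU /(affine_chart oU) [n [x cx]]] := hU i.
by exists (U i), n, x; split=> //; exists v.
Qed.

Definition ivariety (X : fspace k) (vX : variety X) : ispace k :=
  ISpace (variety_local_ring vX) (let: And3 h _ _ := vX in h).

Lemma chart_generates (X : ispace k) (U : set X) n (x : X -> affine_space k n) :
  U !=set0 -> chart U x ->
  rcl (range (rf_cst X) `|` [set` [seq germ (fun u => x u 0 j) | j <- enum 'I_n]]) = setT.
Proof.
move=> nU cx; have oU := chart_open cx.
apply/seteqP; split=> // a _; set M := rcl _.
have [W [oW nW rW]] := rep_rational a.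
have [v [Wv Uv]] := open_meet oW oU nW nU.
have [p [q [qv aE]]] := chart_quotient cx Uv (rW v Wv).
have rx j : rational (fun u => x u 0 j).
  by exists U; split=> // u Uu; apply: (chart_regular cx).
have [hM MV _] := rcl_closed (range (rf_cst X) `|` [set` [seq germ (fun u =>
  x u 0 j) | j <- enum 'I_n]]).
have Mp (p' : {mpoly k[n]}) : rational (fun u => peval p' (x u)) /\ M (germ (fun u =>
  peval p' (x u))).
  rewrite /peval; split.
    exact: (fun_algebra_meval (f := fun j u => x u 0 j) p' (rational_algebra X) rx).
  rewrite (germ_meval p' rx); apply: mmap_closed => //.
    by move=> c hc; apply: rcl_sub; left.
  by move=> j; apply: rcl_sub; right; apply/mapP; exists j; rewrite ?mem_enum.
have [[rp Mp'] [rq Mq']] := (Mp p, Mp q).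
have -> : a = germ (fun u => peval p (x u)) / germ (fun u => peval q (x u)).
  rewrite -germV // -germM //; last exact: rationalV.
  rewrite -{1}[a]germ_rep; apply: germ_eq; first exact: near_gen aE.
    exact: rep_rational.
  by apply: rationalM => //; exact: rationalV.
by have [_ _ MM] := hM; apply: MM => //; apply: MV.
Qed.

Lemma minimal_generators (X : fspace k) (vX : variety X) (X' := ivariety vX) :
  exists zeta : seq (ratfun X'), rcl (range (rf_cst X') `|` [set` zeta]) = setT /\
    forall l : seq (ratfun X'), rcl (range (rf_cst X') `|` [set` l]) = setT ->
      (size zeta <= size l)%N.
Proof.
have [U [n [x [nU cx]]]] := variety_chart vX.
pose Q m := exists zeta : seq (ratfun X'),
  rcl (range (rf_cst X') `|` [set` zeta]) = setT /\ size zeta = m.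
have exQ : exists m, `[< Q m >].
  eexists; apply/asboolP; eexists; split; last by reflexivity.
  exact: (@chart_generates X' U n x nU cx).
have [m /asboolP[zeta [gz sz]] mmin] := ex_minnP exQ.
exists zeta; split=> // l gl; rewrite sz; apply: mmin; apply/asboolP.
by exists l.
Qed.
End Charts.

(** * Semilinear self-maps and invariant sets *)

Section SemilinearMaps.
Variables (k : closedFieldType) (s : field_aut k).

(** A morphism D -> V^s, with the points of V^s identified with those of V. *)
Record smap (V : fspace k) (D : set V) (f : V -> V) : Prop := SMap {
  smap_open : open D;
  smap_continuous : forall x, D x -> {for x, continuous f};
  smap_regular : forall x h, D x -> regular (f x) h -> regular x (fun u => s (h (f u))) }.

(** The last condition says that the image of X is dense in X. With the third it
makes preimages under f preserve what holds generically on X. *)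
Record invariant_set (V : fspace k) (D : set V) (f : V -> V) (X : set V) : Prop := InvSet {
  inv_irr : irreducible X;
  inv_dom : D `&` X !=set0;
  inv_stable : forall x, D x -> X x -> X (f x);
  inv_dense : forall O, open O -> O `&` X !=set0 -> exists x, [/\ D x, X x & O (f x)] }.

Lemma smap_preimage_open (V : fspace k) (D : set V) f O : smap D f -> open O ->
  open (D `&` f @^-1` O).
Proof.
move=> [oD cf _] oO; rewrite openE => x [Dx Ofx]; rewrite /interior.
apply: filterI; first exact: open_nbhs_nbhs.
by apply: cf => //; apply: open_nbhs_nbhs.
Qed.

Lemma gen_invariant (V : fspace k) (D : set V) f X P : smap D f -> invariant_set D f X ->
  generic_on X P -> generic_on X (fun x => P (f x)).
Proof.
move=> sf iX [O [oO nO OP]]; exists (D `&` f @^-1` O); split.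
- exact: smap_preimage_open.
- by have [x [Dx Xx Ofx]] := inv_dense iX oO nO; exists x.
- by move=> x [[Dx Ofx] Xx]; apply: OP; split=> //; apply: (inv_stable iX).
Qed.

Lemma smap_rational (V : ispace k) (D : set V) f e : smap D f -> invariant_set D f [set: V] ->
  rational e -> rational (fun v => s (e (f v))).
Proof.
move=> sf iV [U [oU nU rU]]; exists (D `&` f @^-1` U); split.
- exact: smap_preimage_open.
- have [|x [Dx _ Ux]] := inv_dense iV oU; first by rewrite setIT.
  by exists x.
- by move=> x [Dx Ux]; apply: (smap_regular sf) => //; apply: rU.
Qed.

Lemma rmap_smap (V : fspace k) (phi : rmap V (twist s V)) : rational_map phi ->
  smap (mdom phi) (mfun phi : V -> V).
Proof.
move=> [oD _ mphi]; split=> // [x Dx|x h Dx rh]; first by have [] := mphi x Dx.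
by have [_ /(_ (s \o h))] := mphi x Dx; apply; exists h.
Qed.

Lemma value_mdom (X Y : fspace k) (f : rmap X Y) x y : mdom f x -> value f x y -> y = mfun f x.
Proof. by move=> Dx [U [g [[_ Ux] _ E <-]]]; apply: E. Qed.

Lemma mdom_value (X Y : fspace k) (f : rmap X Y) x : rational_map f -> mdom f x ->
  value f x (mfun f x).
Proof. by move=> [oD _ mf] Dx; exists (mdom f), (mfun f). Qed.

(** A value of phi at a point outside [mdom phi] is given by a morphism on some
neighbourhood, which agrees with phi on a dense subset of X near that point. *)
Lemma dense_image (V : fspace k) (phi : rmap V (twist s V)) (X : set V) : rational_map phi ->
  irreducible X -> mdom phi `&` X !=set0 -> X `<=` closure (rimage phi X : set V) ->
  forall O : set V, open O -> O `&` X !=set0 -> exists x, [/\ mdom phi x,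
    X x & O (mfun phi x)].
Proof.
move=> [oD _ mphi] irr nD Xcl O oO [y [Oy Xy]].
have [y' [[x Xx [U [g [[oU Ux] mg gE gx]]]] Oy']] := Xcl y Xy O (open_nbhs_nbhs (conj oO Oy)).
have [cg _] := mg x Ux.
have : nbhs x (U `&` g @^-1` O).
  apply: filterI; first exact: open_nbhs_nbhs.
  by apply: cg; rewrite gx; apply: (@open_nbhs_nbhs V).
rewrite nbhsE => -[B [oB Bx] BUO].
have [|x' [[Bx' Dx'] Xx']] := irreducible_meet irr oB oD _ nD; first by exists x.
exists x'; split=> //; have [Ux' Ogx'] := BUO x' Bx'.
by rewrite -gE.
Qed.

Lemma dominant_invariant (V : fspace k) (phi : rmap V (twist s V)) :
  rational_sigma_variety phi -> invariant_set (mdom phi) (mfun phi : V -> V) [set: V].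
Proof.
move=> [vV rphi dphi]; have [irr _ _] := vV; have [_ nD _] := rphi; split=> //.
  by rewrite setIT.
apply: dense_image => //; first by rewrite setIT.
move=> x _; have h : (closure (rimage phi [set: V]) : set (twist s V)) x by rewrite (dphi).
exact: h.
Qed.

Lemma invariant_subvariety_set (V : fspace k) (phi : rmap V (twist s V)) (X : set V) :
  rational_map phi -> invariant_subvariety phi X -> mdom phi `&` X !=set0 ->
  invariant_set (mdom phi) (mfun phi : V -> V) X.
Proof.
move=> rphi [cX irr _ clX] nD; split=> //.
- move=> x Dx Xx; have : closure (rimage phi X) (mfun phi x).
    by apply: subset_closure; exists x => //; apply: mdom_value.
  by rewrite clX.
- apply: dense_image => // x Xx.
  have h : (closure (rimage phi X) : set (twist s V)) x by rewrite clX.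
  exact: h.
Qed.

Section ProductMap.
Variables (V Z : ispace k) (D1 : set V) (f1 : V -> V) (D2 : set Z) (f2 : Z -> Z).
Hypotheses (sf1 : smap D1 f1) (sf2 : smap D2 f2).
Notation T := (iprod V Z).
Notation F := (prod_map (V:=V) (Z:=Z) f1 f2).

Lemma prod_map_continuous (w : T) : D1 w.1 -> D2 w.2 -> {for w, continuous F}.
Proof.
move=> Dw1 Dw2.
apply: (@zprod_continuous k V Z T F w) =>
  O [U [U' [h [oU oU' [n [a [b [ha hb hE]]]] ->]]]] [/= Uw U'w hw].
pose W := D1 `&` f1 @^-1` U; pose W' := D2 `&` f2 @^-1` U'.
have oW : open W by exact: smap_preimage_open.
have oW' : open W' by exact: smap_preimage_open.
pose h' (z : V * Z) := \sum_(i < n) s (a i (f1 z.1)) * s (b i (f2 z.2)).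
have th' : tensor W W' h'.
  exists n, (fun i x => s (a i (f1 x))), (fun i x => s (b i (f2 x))); split=> //.
  - by move=> i x [Dx Ux]; apply: (smap_regular sf1) => //; apply: ha.
  - by move=> i x [Dx Ux]; apply: (smap_regular sf2) => //; apply: hb.
have hE' z : h' z = s (h (f1 z.1, f2 z.2)).
  by rewrite hE rmorph_sum; apply: eq_bigr => i _; rewrite rmorphM.
have : open_nbhs w [set z : T | [/\ W z.1, W' z.2 & h' z != 0]].
  split; last by split=> //; rewrite hE' fmorph_eq0.
  by apply: (@zprod_basic_open k V Z); exists W, W', h'.
move=> /open_nbhs_nbhs; apply: filterS => z [[_ Uz] [_ U'z]].
by rewrite hE' fmorph_eq0.
Qed.

(** Given an open set meeting X x Z, first move the second coordinate into the
image of f2, inside the slice over a point of X; then move the first coordinate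
into the image of X, keeping the second one fixed. *)
Lemma gen_prod_map (X : set V) (P : set T) : invariant_set D1 f1 X ->
  invariant_set D2 f2 [set: Z] ->
  generic_on [set w : T | X w.1] P -> generic_on [set w : T | X w.1] (fun w => P (F w)).
Proof.
move=> iX iZ [O [oO [[v1 z1] [/= Ovz Xv1]] OP]].
have oD : open [set w : T | D1 w.1 /\ D2 w.2].
  exact: (open_rect (isp_lr (i:=V)) (isp_lr (i:=Z)) (smap_open sf1) (smap_open sf2)).
exists ([set w : T | D1 w.1 /\ D2 w.2] `&` F @^-1` O); split.
- rewrite openE => w [[Dw1 Dw2] Ow]; apply: filterI; first exact: open_nbhs_nbhs.
  by apply: prod_map_continuous => //; apply: open_nbhs_nbhs.
- have [|z [Dz _ /= Oz]] := inv_dense iZ (iopen_slice (Z:=Z) v1 oO); first by exists z1.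
  have oS : open [set v : V | O (v, f2 z)].
    exact: (@open_slice_l k V Z (isp_lr (i:=V)) O (f2 z) oO).
  have [|v [Dv Xv /= Ov]] := inv_dense iX oS; first by exists v1.
  by exists (v, z).
- move=> w [[[Dw1 Dw2] Ow] /= Xw]; apply: OP; split=> //=.
  exact: (inv_stable iX).
Qed.

End ProductMap.
End SemilinearMaps.

(** * Constants vanishing on an invariant subvariety *)

Section Span.
Variables (k : closedFieldType) (s : field_aut k) (V Z : ispace k).
Variables (D1 : set V) (phi : V -> V) (D2 : set Z) (psi : Z -> Z).
Hypotheses (sphi : smap s D1 phi) (spsi : smap s D2 psi).
Hypothesis iZ : invariant_set D2 psi [set: Z].
Notation T := (iprod V Z).
Notation F := (prod_map (V:=V) (Z:=Z) phi psi).

Definition fixed_on (O : set T) (b : T -> k) : Prop :=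
  forall w, O w -> regular w b /\ s (b (F w)) = b w.

Lemma fixed_on_algebra O : fixed_on O (fun=> 1) /\
  forall f g, fixed_on O f -> fixed_on O g -> fixed_on O (fun w => f w * g w).
Proof.
split=> [w _|f g hf hg w Ow]; first by rewrite rmorph1; split=> //;
  apply: (regular_cst (isp_lr w)).
have [rf tf] := hf w Ow; have [rg tg] := hg w Ow.
by split; [apply: (regularM (isp_lr w))|rewrite rmorphM tf tg].
Qed.

(** Sums of n products of an element of L and a constant. The number of terms is
recorded because the arguments shorten such sums. *)
Inductive tau_span (O : set T) : nat -> (T -> k) -> Prop :=
| tau_span_nil : tau_span O 0 (fun=> 0)
| tau_span_cons n l b h : rational l -> fixed_on O b -> tau_span O n h ->
    tau_span O n.+1 (fun w => l w.2 * b w + h w).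

Definition tau_spanned O h : Prop := exists n, tau_span O n h.

Lemma tau_span_mono (O O' : set T) n h : O' `<=` O -> tau_span O n h -> tau_span O' n h.
Proof.
move=> sub; elim=> [|m l b h' rl fb _ IH]; first exact: tau_span_nil.
by apply: tau_span_cons => // w /sub; apply: fb.
Qed.

Lemma tau_spanned_term O l b : rational l -> fixed_on O b -> tau_spanned O (fun w =>
  l w.2 * b w).
Proof.
move=> rl fb; exists 1%N; have := tau_span_cons rl fb (tau_span_nil O).
by congr tau_span; rewrite funeqE => w; rewrite addr0.
Qed.

Lemma tau_spannedD O f g : tau_spanned O f -> tau_spanned O g -> tau_spanned O (fun w =>
  f w + g w).
Proof.
move=> [n hf] [m hg]; exists (n + m)%N; elim: hf => [|n' l b h rl fb _ IH].
  by have -> : (fun w => 0 + g w) = g by rewrite funeqE => w; rewrite add0r.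
have := tau_span_cons rl fb IH.
by congr tau_span; rewrite funeqE => w; rewrite addrA.
Qed.

Lemma tau_spanned_scale O l b g : rational l -> fixed_on O b -> tau_spanned O g ->
  tau_spanned O (fun w => l w.2 * b w * g w).
Proof.
move=> rl fb [m hg]; exists m; elim: hg => [|m' l' b' h rl' fb' _ IH].
  by under eq_fun do rewrite mulr0; apply: tau_span_nil.
have [_ fM] := fixed_on_algebra O.
have := tau_span_cons (rationalM rl rl') (fM _ _ fb fb') IH.
by congr tau_span; rewrite funeqE => w; ring.
Qed.

Lemma tau_spannedM O f g : tau_spanned O f -> tau_spanned O g -> tau_spanned O (fun w =>
  f w * g w).
Proof.
move=> [n hf] hg; elim: hf => [|n' l b h rl fb _ IH].
  by exists 0%N; under eq_fun do rewrite mul0r; apply: tau_span_nil.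
have := tau_spannedD (tau_spanned_scale rl fb hg) IH.
by congr tau_spanned; rewrite funeqE => w; rewrite mulrDl.
Qed.

Lemma tau_spanned_algebra O : fun_algebra (tau_spanned O).
Proof.
split; [|exact: tau_spannedD|exact: tau_spannedM].
move=> c; have := tau_spanned_term (rational_cst Z c) (fixed_on_algebra O).1.
by congr tau_spanned; rewrite funeqE => w; rewrite mulr1.
Qed.

Lemma tau_spanned_fixed O b : fixed_on O b -> tau_spanned O b.
Proof.
move=> fb; have := tau_spanned_term (rational_cst Z 1) fb.
by congr tau_spanned; rewrite funeqE => w; rewrite mul1r.
Qed.

Lemma tau_spanned_r O l : rational l -> tau_spanned O (fun w => l w.2).
Proof.
move=> rl; have := tau_spanned_term rl (fixed_on_algebra O).1.
by congr tau_spanned; rewrite funeqE => w; rewrite mulr1.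
Qed.

(** The set O on which the equation holds is kept explicit: a single O has to
serve for all functions f, hence for all invariant subvarieties. *)
Definition tau_ratio (O : set T) (f : T -> k) : Prop :=
  exists D N, [/\ tau_spanned O D, tau_spanned O N & forall w, O w -> D w != 0 /\
    f w * D w = N w].

Lemma tau_ratio_mono (O O' : set T) f : O' `<=` O -> tau_ratio O f -> tau_ratio O' f.
Proof.
move=> sub [D [N [[n hD] [m hN] hf]]]; exists D, N; split.
- by exists n; apply: tau_span_mono hD.
- by exists m; apply: tau_span_mono hN.
- by move=> w /sub /hf.
Qed.

Lemma tau_ratio_spanned O f : tau_spanned O f -> tau_ratio O f.
Proof.
have [sc _ _] := tau_spanned_algebra O.
move=> sf; exists (fun=> 1), f; split; [exact: sc|by []|].
by move=> w _; rewrite oner_neq0 mulr1.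
Qed.

Lemma tau_ratio_algebra O : fun_algebra (tau_ratio O).
Proof.
have [sc sD sM] := tau_spanned_algebra O; split.
- by move=> c; apply: tau_ratio_spanned; apply: sc.
- move=> f g [D [N [hD hN hf]]] [D' [N' [hD' hN' hg]]].
  exists (fun w => D w * D' w), (fun w => N w * D' w + N' w * D w); split.
  + exact: tau_spannedM.
  + by apply: tau_spannedD; apply: tau_spannedM.
  move=> w Ow; have [D0 fD] := hf w Ow; have [D0' gD] := hg w Ow.
  by split; [rewrite mulf_neq0|rewrite -fD -gD; ring].
move=> f g [D [N [hD hN hf]]] [D' [N' [hD' hN' hg]]].
exists (fun w => D w * D' w), (fun w => N w * N' w); split.
+ exact: tau_spannedM.
+ exact: tau_spannedM.
move=> w Ow; have [D0 fD] := hf w Ow; have [D0' gD] := hg w Ow.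
by split; [rewrite mulf_neq0|rewrite -fD -gD; ring].
Qed.

Lemma tau_ratioV O f : tau_ratio O f -> (forall w, O w -> f w != 0) ->
  tau_ratio O (fun w => (f w)^-1).
Proof.
move=> [D [N [hD hN hf]]] f0; exists N, D; split=> // w Ow.
have [D0 fD] := hf w Ow; split; rewrite -fD; first by rewrite mulf_neq0 // f0.
by rewrite mulKf // f0.
Qed.

(** The constants in h are not affected by tau, so c h and its image have the
same ones. *)
Lemma tau_span_difference O n h c : tau_span O n h -> rational c -> exists h',
  tau_span O n h' /\
  forall w, O w -> h' w = s (c (psi w.2) * h (F w)) - c w.2 * h w.
Proof.
move=> sh rc; elim: sh => [|m l b h0 rl fb _ [h0' [sh0 h0E]]].
  by exists (fun=> 0); split; [exact: tau_span_nil|move=> w _; rewrite !mulr0 rmorph0 subr0].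
pose l' z := s (c (psi z) * l (psi z)) - c z * l z.
have rl' : rational l'.
  apply: rationalD; last by apply: rationalN; apply: rationalM.
  apply: (@smap_rational k s Z D2 psi (fun z => c z * l z)) => //.
  exact: rationalM.
exists (fun w => l' w.2 * b w + h0' w); split; first exact: tau_span_cons.
move=> w Ow; rewrite (h0E w Ow) /l'; have [_ tb] := fb w Ow.
rewrite !mulrDr !rmorphD !rmorphM /= tb; ring.
Qed.

Lemma tau_span_regular O n h : tau_span O n h -> exists W : set Z,
  [/\ open W, W !=set0 & forall w, O w -> W w.2 -> regular w h].
Proof.
have [[z _] _] := isp_irr Z.
elim=> [|m l b h' [U [oU nU rU]] fb _ [W [oW nW hW]]].
  exists setT; split; [exact: openT|by exists z|].
  by move=> w _ _; apply: (regular_cst (isp_lr w)).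
exists (U `&` W); split; [exact: openI|exact: open_meet|].
move=> w Ow [Uw Ww]; have [rb _] := fb w Ow.
apply: (regularD (isp_lr w)); last exact: hW.
apply: (regularM (isp_lr w)) => //.
apply: (tensor_regular (isp_lr (i:=V)) (isp_lr (i:=Z)) openT oU) => //.
exact: (tensor_r (isp_lr (i:=V))).
Qed.

(** Let l b be the first term of h and c = 1 / l. The function b + c h0, where h0
is the rest of h, vanishes on X x Z with h, and differs from its image under tau
by a sum h' with fewer terms. If h' is zero, the function is a constant;
otherwise the induction applies to h', which also vanishes on X x Z because X is
invariant. *)
Lemma constant_vanishing_on (O : set T) (X : set V) n h : open O ->
  invariant_set D1 phi X -> O `&` [set w | X w.1] !=set0 ->
  invariant_set D1 phi [set: V] ->
  tau_span O n h -> generic_on [set w : T | X w.1] (fun w => h w = 0) ->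
    ~ generic_on [set: T] (fun w => h w = 0) ->
  exists b W, [/\ open W /\ W !=set0, forall w, O w -> W w.2 -> regular w b,
    @tau_fixed k s V Z phi psi b, generic_on [set w : T | X w.1] (fun w => b w = 0) &
    ~ generic_on [set: T] (fun w => b w = 0)].
Proof.
move=> oO iX nOX iV.
have irrXZ : irreducible [set w : T | X w.1].
  exact: (product_irreducible (isp_lr (i:=V)) (isp_lr (i:=Z)) (inv_irr iX) (isp_irr Z)).
have PF := gen_filter irrXZ.
have genX : X !=set0 by have [] := inv_irr iX.
have genO : generic_on [set w : T | X w.1] O by apply: gen_open.
have genOT : generic_on [set: T] O by apply: gen_openT => //; case: nOX => w [Ow _]; exists w.
elim: n h => [|n IH] h sh hX hT.
  by exfalso; apply: hT; inversion sh; apply: filterS filterT.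
inversion sh as [|n' l b h0 rl fb sh0 en eh]; subst.
have [l0|l0] := rational_dichotomy rl.
  apply: (IH h0) => //.
    by apply: filterS2 hX (gen_r genX l0) => w + lw; rewrite lw mul0r add0r.
  by move=> h00; apply: hT; apply: filterS2 h00 (genT_r V l0) => w -> ->; rewrite mul0r add0r.
pose c z := (l z)^-1.
have rc : rational c by apply: rationalV.
have [h' [sh' h'E]] := tau_span_difference sh0 rc.
pose b1 w := b w + c w.2 * h0 w.
have b1E w : l w.2 != 0 -> l w.2 * b w + h0 w = l w.2 * b1 w.
  by move=> lw; rewrite /b1 /c mulrDr mulVKf.
have b1X : generic_on [set w : T | X w.1] (fun w => b1 w = 0).
  apply: filterS2 hX (gen_r genX l0) => w + lw; rewrite b1E // => /eqP.
  by rewrite mulf_eq0 (negbTE lw) => /eqP.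
have b1T : ~ generic_on [set: T] (fun w => b1 w = 0).
  move=> h1; apply: hT; apply: filterS2 h1 (genT_r V l0) => w bw lw.
  by rewrite b1E // bw mulr0.
have tb1 w : O w -> s (b1 (F w)) = b1 w + h' w.
  move=> Ow; rewrite h'E // /b1 rmorphD; have [_ ->] := fb w Ow.
  rewrite !rmorphM /=; ring.
case: (pselect (generic_on [set: T] (fun w => h' w = 0))) => [h'0|h'0].
  have [Wc [oWc nWc rWc]] := rc.
  have [W0 [oW0 nW0 rW0]] := tau_span_regular sh0.
  exists b1, (Wc `&` W0); split=> //.
  - by split; [exact: openI|exact: open_meet].
  - move=> w Ow [Wcw W0w]; have [rb _] := fb w Ow.
    apply: (regularD (isp_lr w)) => //; apply: (regularM (isp_lr w)); last exact: rW0.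
    apply: (tensor_regular (isp_lr (i:=V)) (isp_lr (i:=Z)) openT oWc) => //.
    exact: (tensor_r (isp_lr (i:=V))).
  - by apply: filterS2 h'0 genOT => w h'w Ow; rewrite tb1 // h'w addr0.
apply: (IH h') => //.
have b1FX := gen_prod_map sphi spsi iX iZ b1X.
apply: filterS2 (filterI b1X b1FX) genO => w [bw bFw] Ow.
by have := tb1 w Ow; rewrite bFw bw rmorph0 add0r.
Qed.
End Span.

(** * Coordinates of an isotrivial system *)

Lemma induced_meet (k : closedFieldType) (X : fspace k) (Y : set X) (A B : set (induced Y)) :
  irreducible Y -> open A -> open B -> A !=set0 -> B !=set0 -> A `&` B !=set0.
Proof.
move=> irr [A' oA' <-] [B' oB' <-] [a Aa] [b Bb].
have [||x [[Ax Bx] Yx]] := irreducible_meet irr oA' oB'.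
- by exists (set_val a); split=> //; exact: set_valP.
- by exists (set_val b); split=> //; exact: set_valP.
by exists (exist _ x (mem_set Yx)).
Qed.

Section Isotrivial.
Variables (k : closedFieldType) (s : field_aut k).
Variables (V Z : ispace k) (phi : rmap V (twist s V)) (psi : rmap Z (twist s Z)).
Notation T := (iprod V Z).
Hypotheses (rphi : rational_map phi) (rpsi : rational_map psi).
Hypotheses (iV : invariant_set (mdom phi) (mfun phi : V -> V) [set: V]).
Hypotheses (iZ : invariant_set (mdom psi) (mfun psi : Z -> Z) [set: Z]).
Variables (l : nat) (Y : set (product (affine_space k l) Z)) (g : rmap T (induced Y)).
Hypothesis irrY : irreducible Y.
Hypothesis bir_g : birational g.
Hypothesis eq_g : @equivariant k s T (product (affine_space k l) Z)
  (sprod phi psi) (sprod (sid s l) psi) (rincl g).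
Hypothesis com_g : generically (fun x : T => exists2 y, value g x y & (set_val y).2 = x.2).

Notation F := (prod_map (V:=V) (Z:=Z) (mfun phi : V -> V) (mfun psi : Z -> Z)).
Notation gg := (mfun g).
Let iY (w : T) : zprod (affine_space k l) Z := set_val (gg w).
Let y (w : T) : affine_space k l := (iY w).1.

Let Gd : set T := mdom g.
Let rg : rational_map g. Proof. by have [] := bir_g. Qed.

Let gg_continuous w : Gd w -> {for w, continuous gg}.
Proof. by have [_ _ mg] := rg => /mg[]. Qed.
Let gg_regular w f : Gd w -> regular (gg w) f -> regular w (f \o gg).
Proof. by have [_ _ mg] := rg => /mg[_]; apply. Qed.

Let lrA : locally_ringed (affine_space k l). Proof. exact: affine_space_local_ring. Qed.
Let lrZ : locally_ringed Z. Proof. exact: isp_lr. Qed.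

Let y_regular w j : Gd w -> regular w (fun w => (y w : zaff k l) 0 j).
Proof.
move=> Gw; apply: (gg_regular (f := fun c => ((set_val c : product _ _).1 : zaff k l) 0 j) Gw).
exists (fun c : product (affine_space k l) Z => (c.1 : zaff k l) 0 j); split; last first.
  by apply: filterS filterT => c.
apply: (tensor_regular lrA lrZ openT openT) => //.
apply: (@tensor_l k (affine_space k l) Z lrZ (fun c : zaff k l => c 0 j)) => x _.
exact: affine_coord_regular.
Qed.

Let oG : open Gd. Proof. by case: rg. Qed.
Let nG : Gd !=set0. Proof. by case: rg. Qed.

Let genG : generic_on [set: T] Gd. Proof. exact: gen_openT. Qed.

Let FgenT P : generic_on [set: T] P -> generic_on [set: T] (fun w => P (F w)).
Proof.
have e : [set: T] = [set w : T | [set: V] w.1] by rewrite predeqE.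
rewrite e => hP; exact: (gen_prod_map (rmap_smap rphi) (rmap_smap rpsi) iV iZ hP).
Qed.

Let gen_phi : generic_on [set: T] (fun w => mdom phi w.1).
Proof.
apply: genT_l; apply: gen_openT; first by case: rphi.
by case: rphi.
Qed.
Let gen_psi : generic_on [set: T] (fun w => mdom psi w.2).
Proof.
apply: genT_r; apply: gen_openT; first by case: rpsi.
by case: rpsi.
Qed.

Let com_gen : generic_on [set: T] (fun w => (iY w).2 = w.2).
Proof.
move/genT: com_g => com; apply: filterS2 com genG => w [c gwc <-] Gw.
by rewrite /iY -(value_mdom Gw gwc).
Qed.

(** The first component of id x psi is the identity of affine space, so
equivariance of g says that the coordinates of g are constants. *)
Let fixed_gen : generic_on [set: T] (fun w => forall j,
  s ((y (F w) : zaff k l) 0 j) = (y w : zaff k l) 0 j).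
Proof.
move/genT: eq_g => eqg.
apply: filterS2 (filterI eqg (filterI genG (FgenT genG))) (filterI com_gen (filterI gen_phi
  gen_psi)).
move=> w [[c [x' [z [v1 v2 v3 v4]]]] [Gw GFw]] [cw [pw qw]] j.
have cE : c = iY w by exact: (@value_mdom k T _ (rincl g) w c Gw v1).
have x'E : x' = F w.
  exact: (@value_mdom k T (twist s T) (sprod phi psi) w x' (conj pw qw) v3).
have zE : z = iY (F w).
  rewrite x'E in v4.
  exact: (@value_mdom k (twist s T) (twist s (product (affine_space k l) Z)) (rtwist s
    (rincl g)) (F w) z GFw v4).
have zE' : z = (untwist_coord s (y w), mfun psi w.2).
  have qc : mdom (sprod (sid s l) psi) c by split=> //; rewrite cE cw.
  have := @value_mdom k (product (affine_space k l) Z) (twist s (product (affine_space k l)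
    Z)) _ c z qc v2.
  by rewrite cE /= cw.
have -> : y (F w) = untwist_coord s (y w) by rewrite /y -/(iY (F w)) -zE zE'.
by rewrite mxE aut_invK.
Qed.

(** Near the point w0 the map g and its inverse h are both defined and inverse
to each other. To find it, start from a general point of Y, where h and then g are
defined, and move it into the domain of the representative of g. *)
Let good_open (U : set V) : open U -> U !=set0 ->
  exists (h : rmap (induced Y) T) (O : set T) (w0 : T),
  [/\ rational_map h, open O /\ O w0, mdom h (gg w0) &
   forall w, O w -> [/\ Gd w, U w.1, (iY w).2 = w.2,
     (forall j, s ((y (F w) : zaff k l) 0 j) = (y w : zaff k l) 0 j) & mfun h (gg w) = w]].
Proof.
move=> oU nU; have [_ [h [rh gh hg]]] := bir_g; have [oH nH mh] := rh.
have [O1 [oO1 nO1 O1P]] := (genT _).1 gh.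
have [W [oW nW WP]] := (genT _).1 hg.
rewrite setIT in nW.
have [y1 [Hy1 Wy1]] := induced_meet irrY oH oW nH nW.
have [x1 _ [U1 [g' [[oU1 U1x] mg' g'E g'x1]]]] := WP y1 (conj Wy1 Logic.I).
have : nbhs x1 (U1 `&` g' @^-1` (mdom h)).
  apply: filterI; first exact: open_nbhs_nbhs.
  have [cg' _] := mg' x1 U1x; apply: cg'; rewrite g'x1; exact: open_nbhs_nbhs.
rewrite nbhsE => -[B [oB Bx1] BU].
have [w1 [Bw1 Gw1]] := @open_meet _ T B Gd oB oG (ex_intro _ x1 Bx1) nG.
have [U1w1 Hw1] := BU w1 Bw1.
have oGH : open (Gd `&` gg @^-1` (mdom h)).
  rewrite openE => w [Gw Hw]; apply: filterI; first exact: open_nbhs_nbhs.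
  by apply: (gg_continuous Gw); apply: open_nbhs_nbhs.
have nGH : (Gd `&` gg @^-1` (mdom h)) !=set0.
  by exists w1; split=> //=; rewrite -g'E.
have gGH : generic_on [set: T] (Gd `&` gg @^-1` (mdom h)) by exact: gen_openT.
have gU : generic_on [set: T] (fun w => U w.1) by apply: genT_l; exact: gen_openT.
have gh' : generic_on [set: T] (fun x => exists2 y, value g x y & value h y x) by apply/genT.
have [O [oO [w0 [Ow0 _]] OP]] :=
  filterI (filterI gGH gU) (filterI gh' (filterI com_gen fixed_gen)).
exists h, O, w0; split=> //; first by have [[[_ Hw0] _] _] := OP w0 (conj Ow0 Logic.I).
move=> w Ow; have [[[Gw Hw] Uw] [[c gwc hcw] [cw fw]]] := OP w (conj Ow Logic.I).
split=> //; apply: esym; apply: (value_mdom Hw).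
by rewrite -(value_mdom Gw gwc).
Qed.

(** Near w0 a coordinate of V is the composite of g with the rational function
induced on Y through h. This function is locally a quotient of tensors on
A^l x Z, that is, an expression in functions of z and the coordinates of g,
which are constants. *)
Lemma isotrivial_ratio (U : set V) n (x : V -> affine_space k n) : U !=set0 -> chart U x ->
  exists O : set T, [/\ open O, O !=set0, forall w, O w -> U w.1 &
    forall j, tau_ratio s (mfun phi) (mfun psi) O (fun w => (x w.1 : zaff k n) 0 j)].
Proof.
move=> nU cx; have oU := chart_open cx.
have [h [O [w0 [rh [oO Ow0] Hw0 OP]]]] := good_open oU nU.
have fixed_y j : fixed_on s (mfun phi) (mfun psi) O (fun w => (y w : zaff k l) 0 j).
  by move=> w Ow; have [Gw _ _ fw _] := OP w Ow; split; [exact: y_regular|exact: fw].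
pose near_ratio (f : T -> k) := exists2 O' : set T, (open O' /\ O' w0) & O' `<=` O /\
  tau_ratio s (mfun phi) (mfun psi) O' f.
have nr_ratio f : tau_ratio s (mfun phi) (mfun psi) O f -> near_ratio f.
  by move=> rf; exists O => //; split.
have nr2 f g' (P : (T -> k) -> (T -> k) -> T -> k) : near_ratio f -> near_ratio g' ->
   (forall O', tau_ratio s (mfun phi) (mfun psi) O' f ->
     tau_ratio s (mfun phi) (mfun psi) O' g' ->
     tau_ratio s (mfun phi) (mfun psi) O' (P f g')) -> near_ratio (P f g').
  move=> [O1 [oO1 O1w] [s1 r1]] [O2 [oO2 O2w] [s2 r2]] hP; exists (O1 `&` O2).
    by split=> //; exact: openI.
  split; first by move=> w [/s1].
  by apply: hP; [apply: tau_ratio_mono r1 => w []|apply: tau_ratio_mono r2 => w []].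
have nr_algebra : fun_algebra near_ratio.
  split.
  - move=> c; apply: nr_ratio.
    by have [rc _ _] := tau_ratio_algebra s (mfun phi) (mfun psi) O; apply: rc.
  - move=> f g' hf hg; apply: (nr2 f g' (fun f g w => f w + g w)) => // O' rf rg'.
    by have [_ rD _] := tau_ratio_algebra s (mfun phi) (mfun psi) O'; apply: rD.
  - move=> f g' hf hg; apply: (nr2 f g' (fun f g w => f w * g w)) => // O' rf rg'.
    by have [_ _ rM] := tau_ratio_algebra s (mfun phi) (mfun psi) O'; apply: rM.
have nr_inv f : near_ratio f -> (\forall w \near w0, f w != 0) -> near_ratio (fun w =>
  (f w)^-1).
  move=> [O1 [oO1 O1w] [s1 r1]]; rewrite /prop_near1 nbhsE => -[O2 [oO2 O2w] f0].
  exists (O1 `&` O2); first by split=> //; exact: openI.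
  split; first by move=> w [/s1].
  apply: tau_ratioV; first by apply: tau_ratio_mono r1 => w [].
  by move=> w [_ /f0].
have nr_ext f f' : near_ratio f -> (\forall w \near w0, f w = f' w) -> near_ratio f'.
  move=> [O1 [oO1 O1w] [s1 r1]]; rewrite /prop_near1 nbhsE => -[O2 [oO2 O2w] ff'].
  exists (O1 `&` O2); first by split=> //; exact: openI.
  split; first by move=> w [/s1].
  have [D [N [hD hN hf]]] := r1; exists D, N; split.
  - by have [m hD'] := hD; exists m; apply: tau_span_mono hD' => w [].
  - by have [m hN'] := hN; exists m; apply: tau_span_mono hN' => w [].
  - by move=> w [O1w' O2w']; rewrite -(ff' w O2w'); apply: hf.
have [Gw0 Uw0 cw0 fw0 hw0] := OP w0 Ow0.
have cont_iY : {for w0, continuous (iY : T -> product (affine_space k l) Z)}.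
  apply: (@continuous_comp _ _ _ gg set_val); first exact: gg_continuous.
  exact: set_val_continuous.
have nearO : nbhs w0 O by exact: open_nbhs_nbhs.
have nr_poly (p : {mpoly k[l]}) : near_ratio (fun w => peval p (y w)).
  apply: nr_ratio; apply: tau_ratio_spanned.
  apply: (fun_algebra_meval (f := fun j w =>
    (y w : zaff k l) 0 j) p (tau_spanned_algebra s (mfun phi) (mfun psi) O)) => j.
  exact/tau_spanned_fixed/fixed_y.
have nearA (P : set (affine_space k l)) : nbhs (y w0) P -> nbhs w0 (fun w => P (y w)).
  rewrite nbhsE => -[B [oB By] BP].
  have : nbhs w0 (iY @^-1` [set c | B c.1]).
    apply: cont_iY; apply: (@open_nbhs_nbhs (product (affine_space k l) Z)); split=> //.
    exact: (open_fst lrA lrZ).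
  by apply: filterS => w /BP.
(* Functions of the coordinates of g, functions of z, and tensors of both. *)
have nr_A (a : affine_space k l -> k) : regular (y w0) a -> near_ratio (fun w => a (y w)).
  move=> [p [q [qy aE]]].
  have qn : \forall w \near w0, peval q (y w) != 0.
    by apply: (nearA (fun c => peval q c != 0)); exact: peval_near.
  have [_ _ nrM] := nr_algebra.
  apply: (nr_ext (fun w => peval p (y w) * (peval q (y w))^-1)).
    by apply: nrM; [exact: nr_poly|apply: nr_inv => //; exact: nr_poly].
  by have := nearA _ aE; apply: filterS => w ->.
have nr_Z (W : set Z) (b : Z -> k) : open W -> W w0.2 -> (forall z, W z -> regular z b) ->
  near_ratio (fun w => b (iY w).2).
  move=> oW Ww rb; have rat : rational b by exists W; split=> //; exists w0.2.
  apply: (nr_ext (fun w => b w.2)); first by apply: nr_ratio;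
    apply/tau_ratio_spanned/tau_spanned_r.
  by apply: filterS nearO => w Ow; have [_ _ ->] := OP w Ow.
have nr_tensor (W : set (affine_space k l)) (W' : set Z) t : open W -> open W' ->
  W (y w0) -> W' w0.2 ->
   tensor W W' t -> near_ratio (fun w => t (iY w)).
  move=> oW oW' Wy Wz [m [a [b [ha hb ->]]]].
  apply: (fun_algebra_sum (f := fun i w => a i (iY w).1 * b i (iY w).2) _ nr_algebra) => i.
  have [_ _ nrM] := nr_algebra; apply: (nrM (fun w => a i (y w)) (fun w => b i (iY w).2)).
    by apply: nr_A; apply: ha.
  by apply: (nr_Z W') => // z; apply: hb.
have nr_x j : near_ratio (fun w => (x w.1 : zaff k n) 0 j).
  have rx : regular w0 (fun w : T => (x w.1 : zaff k n) 0 j).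
    apply: (tensor_regular (isp_lr (i:=V)) (isp_lr (i:=Z)) oU openT) => //.
    apply: (@tensor_l k V Z lrZ (fun v => (x v : zaff k n) 0 j)) => v Uv.
    exact: (chart_regular cx).
  have [_ _ mh] := rh; have [_] := mh _ Hw0; rewrite hw0 =>
    /(_ _ rx) [G' [[W [W' [p [q [[oW oW' Wy Wz] tp tq qz GE]]]]] xE]].
  have Wz' : W' w0.2 by rewrite -cw0.
  have np : near_ratio (fun w => p (iY w)) by exact: (nr_tensor W W').
  have nq : near_ratio (fun w => q (iY w)) by exact: (nr_tensor W W').
  have qn : \forall w \near w0, q (iY w) != 0.
    have n0 : nbhs (iY w0 : product (affine_space k l) Z) (fun c => q c != 0).
      exact: (@tensor_neq0_near k (affine_space k l) Z W W' q (iY w0) oW oW' tq Wy Wz qz).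
    exact: (cont_iY _ n0).
  have [_ _ nrM] := nr_algebra.
  apply: (nr_ext (fun w => p (iY w) * (q (iY w))^-1)); first by apply: nrM => //;
    exact: nr_inv.
  have e1 : nbhs w0 (fun w => (x (mfun h (gg w)).1 : zaff k n) 0 j = G' (iY w)).
    exact: (gg_continuous Gw0 xE).
  have e2 : nbhs w0 (fun w => G' (iY w) = p (iY w) / q (iY w)) by exact: (cont_iY _ GE).
  apply: (@filterS2 _ (nbhs w0) _ _ _ _ _ (filterI e1 e2) nearO) => w [h1 h2] Ow.
  by have [_ _ _ _ hw] := OP w Ow; rewrite -h2 -h1 hw.
have {nr_x} nr_x : forall j, exists O', [/\ open O', O' w0, O' `<=` O &
    tau_ratio s (mfun phi) (mfun psi) O' (fun w => (x w.1 : zaff k n) 0 j)].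
  by move=> j; have [O' [? ?] [? ?]] := nr_x j; exists O'.
have [f fP] := choice nr_x.
exists (O `&` \bigcap_(j in [set: 'I_n]) f j); split.
- rewrite openE => w [Ow fw]; apply: filterI; first exact: open_nbhs_nbhs.
  apply: (@filterS _ (nbhs w) _ (fun u => forall j, f j u)); first by move=> u hu j _;
    exact: hu.
  apply: (@filter_forall _ _ f (nbhs w) _) => j.
  by have [oj _ _ _] := fP j; apply: open_nbhs_nbhs; split=> //; exact: fw.
- by exists w0; split=> // j _; have [] := fP j.
- by move=> w [Ow _]; have [_ Uw _] := OP w Ow.
- by move=> j; have [_ _ _ rj] := fP j; apply: tau_ratio_mono rj => w [_]; apply.
Qed.
End Isotrivial.

(** * Proper invariant subvarieties are not dense *)

Section Sparse.
Variables (k : closedFieldType) (s : field_aut k).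
Variables (V : fspace k) (phi : rmap V (twist s V)).
Hypothesis hphi : rational_sigma_variety phi.
Hypothesis triv : isotrivial phi.
Hypothesis no_inv : forall (U : set V) (lam : V -> k),
  invariant_function phi U lam -> constant_function U lam.

Let vV : variety V. Proof. by case: hphi. Qed.
Let rphi : rational_map phi. Proof. by case: hphi. Qed.
Let V' : ispace k := ivariety vV.
Let sphi : smap s (mdom phi) (mfun phi : V -> V) := rmap_smap rphi.
Let iV : invariant_set (mdom phi) (mfun phi : V -> V) [set: V] := dominant_invariant hphi.

Let invariant_constant (e : V' -> k) : rational e ->
  @aeq k V' (fun v => s (e (mfun phi v))) e -> exists c, aeq e (fun=> c).
Proof.
move=> [U [oU nU rU]] te.
have [c hc] : constant_function U e.
  apply: no_inv; split; first by split.
  apply/genT.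
  have gU : generic_on [set: V'] U by exact: (@gen_openT _ V').
  have gD : generic_on [set: V'] (mdom phi).
    by apply: (@gen_openT _ V'); [case: rphi|case: rphi].
  have gpU : generic_on [set: V'] (fun x => U (mfun phi x)).
    exact: (gen_invariant sphi iV gU).
  apply: (@filterS2 _ (generic_on [set: V']) _ _ _ _ _ (filterI gU gD) (filterI gpU te)) =>
    x [Ux Dx] [Ufx tx].
  split=> //; exists (mfun phi x); split=> //; exact: mdom_value.
by exists c; apply: filterS (@gen_openT _ V' U oU nU) => x /hc.
Qed.

(** The open set consists of the points v of the domain of phi such that the y's
of [constants_transcendence] remain algebraically independent on {v} x Z, and
such that {v} x Z meets the open set O where the y's are regular and the
coordinates of V are expressed through constants. *)
Theorem invariants_sparse : exists V1 : set V, [/\ open V1, V1 !=set0 &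
  forall X, invariant_subvariety phi X -> X <> setT -> forall x, X x -> ~ V1 x].
Proof.
have [Z [psi [l [Y [g [hpsi hY bir_g eq_g com_g]]]]]] := triv.
have [vZ rpsi _] := hpsi.
pose Z' : ispace k := ivariety vZ.
have spsi := rmap_smap rpsi.
have iZ := dominant_invariant hpsi.
have [_ irrY _ _] := hY.
pose T := iprod V' Z'.
pose phi' : V' -> V' := mfun phi; pose psi' : Z' -> Z' := mfun psi.
pose F := prod_map phi' psi' : T -> T.
have prod_map_genT (P : set T) : generic_on setT P -> generic_on setT (fun w => P (F w)).
  have e : [set: T] = [set w : T | [set: V'] w.1] by rewrite predeqE.
  rewrite e => hP; exact: (@gen_prod_map k s V' Z' _ _ _ _ sphi spsi _ _ iV iZ hP).
have phi_rat (e : V' -> k) : rational e -> rational (fun v => s (e (phi' v))).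
  exact: (@smap_rational k s V' _ _ e sphi iV).
have [U [n [x [nU cx]]]] := variety_chart vV.
have [O0 [oO0 nO0 O0U ratx]] :=
  @isotrivial_ratio k s V' Z' phi psi rphi rpsi iV iZ l Y g irrY bir_g eq_g com_g U n x nU cx.
have [zeta [gz minz]] := minimal_generators vZ.
have [r [y [Cy Ralg Rsp]]] :=
  @constants_transcendence k s V' Z' phi' psi' prod_map_genT phi_rat invariant_constant
  zeta gz minz.
(* The y's and the expression of the coordinates determine O before X is chosen. *)
have [O1 [oO1 nO1 yreg]] : exists O1 : set T, [/\ open O1, O1 !=set0 & forall i w, O1 w ->
  regular w (rep (y i))].
  have /choice [f fP] := fun i => rep_rational (y i).
  have : generic_on [set: T] (fun w => forall i, f i w).
    apply: (@filter_forall _ _ f (generic_on [set: T]) _) => i.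
    by have [oi ni _] := fP i; apply: gen_openT.
  move=> [O1 [oO1 nO1 fO]]; exists O1; rewrite setIT in nO1; split=> // i w Ow.
  by have [_ _ ri] := fP i; apply: ri; apply: fO.
pose O := O0 `&` O1.
have oO : open O by exact: openI.
have nO : O !=set0 by exact: (@open_meet _ T).
have [V2 [oV2 nV2 V2P]] := Rsp; rewrite setIT in nV2.
pose V3 : set V := [set v | exists z, O (v, z)].
have oV3 : open V3 by exact: (@iopen_proj k V' Z' O oO).
have nV3 : V3 !=set0 by case: nO => [[v z] Ovz]; exists v, z.
have [oD nD _] := rphi.
exists (V2 `&` V3 `&` mdom phi); split.
- by apply: openI => //; apply: openI.
- by apply: (@open_meet _ V') => //; [exact: openI|exact: (@open_meet _ V')].
move=> X iX XT v Xv [[V2v V3v] Dv].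
have nDX : mdom phi `&` X !=set0 by exists v.
have iX' := invariant_subvariety_set rphi iX nDX.
have [cX irrX _ _] := iX.
pose XZ : set T := [set w | X w.1].
have nOX : O `&` XZ !=set0 by have [z Ovz] := V3v; exists (v, z).
(* X is cut out in the chart, so some polynomial vanishes on X and not on V. *)
have [p [px [v0 [Uv0 pv0]]]] : exists p : {mpoly k[n]},
    (forall u, U u -> X u -> peval p (x u) = 0) /\ exists v0, U v0 /\ peval p (x v0) != 0.
  have nX : (~` X) !=set0.
    by apply: contrapT => h; apply: XT; rewrite predeqE => u; split=> // _;
      apply: contrapT => Xu; apply: h; exists u.
  have [v0 [Uv0 Xv0]] := @open_meet _ V' U (~` X) (chart_open cx) (closed_openC cX) nU nX.
  have [p [pv0 hp]] := chart_basis cx Uv0 (closed_openC cX) Xv0.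
  exists p; split; last by exists v0.
  by move=> u Uu Xu; apply/eqP/negP => /negP /(hp u Uu).
have ratxO j : tau_ratio s phi' psi' O (fun w => (x w.1 : zaff k n) 0 j).
  by apply: tau_ratio_mono (ratx j) => w [].
have [D [N [sD [m sN] pDN]]] :=
  fun_algebra_meval (f := fun j (w : T) => (x w.1 : zaff k n) 0 j) p
  (tau_ratio_algebra s phi' psi' O) ratxO.
have irrXZ : irreducible XZ.
  exact: (product_irreducible (isp_lr (i:=V')) (isp_lr (i:=Z')) irrX (isp_irr Z')).
have PF := gen_filter irrXZ.
have NX : generic_on XZ (fun w => N w = 0).
  exists O; split=> // w [Ow Xw]; have [_ <-] := pDN w Ow.
  have := px w.1 (O0U w Ow.1) Xw; rewrite /peval => ->.
  by rewrite mul0r.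
have NT : ~ generic_on [set: T] (fun w => N w = 0).
  move=> N0.
  have gp : generic_on [set: T] (fun w => U w.1 /\ peval p (x w.1) != 0).
    apply: (@genT_l k V' Z' (fun u => U u /\ peval p (x u) != 0)).
    have rp u : U u -> regular u (fun u => peval p (x u)).
      move: u; apply: (fun_algebra_meval (f := fun j u => (x u : zaff k n) 0 j) p
        (regular_algebra U (isp_lr (i:=V')))).
      by move=> j u Uu; apply: (chart_regular cx).
    have := @gen_openT _ V' _ (@regular_open_neq0 k V' U _ (chart_open cx) rp).
    by apply; exists v0.
  have [w _ [[Nw Ow] [Uw pw]]] := gen_ex (filterI (filterI N0 (gen_openT oO nO)) gp).
  have [Dw] := pDN w Ow; rewrite Nw => /eqP.
  by rewrite mulf_eq0 (negbTE Dw) orbF => /eqP h; move/eqP: pw; apply.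
have [b [W [[oW nW] breg tb bX bT]]] :=
  @constant_vanishing_on k s V' Z' (mdom phi) phi' (mdom psi) psi' sphi spsi iZ O X m N oO
  iX' nOX iV sN NX NT.
pose OW : set T := O `&` [set w | W w.2].
have oW2 : open [set w : T | W w.2] by exact: (open_snd (isp_lr (i:=V')) (isp_lr (i:=Z'))).
have oOW : open OW by exact: openI.
have nOW : OW !=set0.
  by apply: (@open_meet _ T) => //; have [z Wz] := nW; exists (v, z).
have rb : rational b.
  by exists OW; split=> // w [Ow Ww]; exact: breg.
have cb0 : germ b != 0.
  by apply/eqP => /(germ_eq0 rb); exact: bT.
have [q [q0 qb]] := Ralg (germ b) (tau_constant_germ prod_map_genT rb tb) cb0.
pose ev i w : k := (q`_i).@[fun j => rep (y j) w].
pose E w := \sum_(i < size q) ev i w * b w ^+ i.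
have ry j : rational (rep (y j)) by exact: rep_rational.
have rev i : rational (ev i) by exact: (fun_algebra_meval q`_i (rational_algebra T) ry).
have E0 : aeq E (fun=> 0).
  apply/germ_eq0.
    by apply: (@rational_sum _ T) => i; apply: rationalM => //; apply: rationalX.
  rewrite -[RHS]qb (horner_coef_wide _ (size_poly _ _)).
  rewrite (@germ_sum _ T _ _ (fun (i : 'I_(size q)) w => ev i w * b w ^+ i)) => [|i].
    apply: eq_bigr => i _; rewrite germM //; last exact: rationalX.
    rewrite coef_map /= (germ_meval q`_i ry); congr (mmap _ _ _ * _).
      by rewrite funeqE => j; rewrite germ_rep.
    exact: germX.
  by apply: rationalM => //; apply: rationalX.
have alg := regular_algebra OW (isp_lr (i:=T)).
have regy j w : OW w -> regular w (rep (y j)) by move=> [[_ O1w] _]; exact: yreg.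
have regE w : OW w -> regular w E.
  move: w; apply: (fun_algebra_sum (f := fun (i : 'I_(size q)) w =>
    ev i w * b w ^+ i) _ alg) => i.
  have [_ _ rM] := alg; apply: rM; first exact: (fun_algebra_meval q`_i alg regy).
  by apply: (fun_algebraX _ alg) => w [Ow Ww]; exact: breg.
(* E vanishes generically, so also at the points over X, where b and the y's are regular. *)
have EOW w : OW w -> E w = 0.
  apply: (regular_agree oOW regE _ E0) => u _; exact: (regular_cst (isp_lr u)).
have ev0 w : OW w -> b w = 0 -> ev 0%N w = 0.
  move=> OWw bw; have := EOW w OWw; rewrite /E.
  have sq : (0 < size q)%N by rewrite size_poly_gt0; apply: contra_neq q0 => ->; rewrite coef0.
  case: (size q) sq => // sz _; rewrite big_ord_recl expr0 mulr1 big1 ?addr0 // => i _.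
  by rewrite bw expr0n mulr0.
have [Ob [oOb nOb bOb]] := bX.
have nOWX : OW `&` XZ !=set0.
  have [w [[Ow Ww] Xw]] : (O `&` [set w | W w.2]) `&` XZ !=set0.
    apply: irreducible_meet => //.
    by have [z Wz] := nW; exists (v, z).
  by exists w.
have oV2T : open [set w : T | V2 w.1] by exact: (open_fst (isp_lr (i:=V')) (isp_lr (i:=Z'))).
have nV2X : [set w : T | V2 w.1] `&` XZ !=set0 by have [z _] := V3v; exists (v, z).
have n1 := irreducible_meet irrXZ oOW oOb nOWX nOb.
have [[u z] [[[OWu Obu] V2u] Xu]] := irreducible_meet irrXZ (openI oOW oOb) oV2T n1 nV2X.
(* At a point over X where b = 0 the equation E = 0 reduces to its constant term. *)
suff mz : mmap (rf_cst Z') (fun i => specialise u (y i)) q`_0 = 0.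
  by have := V2P u (conj V2u Logic.I) _ q0; rewrite mz eqxx.
pose G : set Z' := [set z | OW (u, z) /\ Ob (u, z)].
have oG : open G.
  by apply: openI; apply: (@iopen_slice k V' Z').
have nG : G !=set0 by exists z.
rewrite -[LHS](@germ_meval k Z' r (fun j z => rep (y j) (u, z)) q`_0) => [|j].
  apply/germ_eq0.
    apply: (fun_algebra_meval (f := fun j z => rep (y j) (u, z)) q`_0
      (rational_algebra Z')) => j.
    exists G; split=> // z' [OWz _].
    exact: (slice_regular (isp_lr (i:=Z')) (regy j (u, z') OWz)).
  apply: filterS (gen_openT oG nG) => z' [OWz Obz].
  by apply: (ev0 (u, z')) => //; apply: bOb; split.
exists G; split=> // z' [OWz _]; exact: (slice_regular (isp_lr (i:=Z')) (regy j (u, z') OWz)).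
Qed.
End Sparse.

(** * Finiteness of the maximal invariant subvarieties *)

Section NoetherianSpace.
Variables (k : closedFieldType) (X : fspace k).

Lemma descending (D : nat -> set X) n m : (forall i, D i.+1 `<=` D i) -> (n <= m)%N ->
  D m `<=` D n.
Proof.
move=> dD /subnK <-; elim: (m - n)%N => [|j IH] //.
by rewrite addSn; apply: subset_trans IH; apply: dD.
Qed.

(** Within a chart a closed set is determined by the polynomials vanishing on
it; the ideals of a descending sequence of closed sets form an ascending
chain. *)
Lemma chart_stationary (U : set X) n (x : X -> affine_space k n) (D : nat -> set X) :
  chart U x -> (forall i, closed (D i)) -> (forall i, D i.+1 `<=` D i) ->
  exists N, forall m, (N <= m)%N -> U `&` D N `<=` D m.
Proof.
move=> cx cD dD.
pose I m : set {mpoly k[n]} := [set p | forall u, U u -> D m u -> peval p (x u) = 0].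
have I_mono a b : (a <= b)%N -> I a `<=` I b.
  by move=> ab p hp u Uu Du; apply: hp => //; apply: descending Du.
pose J : set {mpoly k[n]} := [set p | exists m, I m p].
have [|s [sJ Js]] := mpoly_noetherian (k := k) (n := n) (I := J).
  split.
  - by exists 0%N => u _ _; rewrite /peval meval0.
  - move=> p q [a pa] [b qb]; exists (maxn a b) => u Uu Du.
    rewrite /peval mevalD -!/(peval _ _).
    have hp : I (maxn a b) p by apply: I_mono pa; exact: leq_maxl.
    have hq : I (maxn a b) q by apply: I_mono qb; exact: leq_maxr.
    by rewrite (hp u) // (hq u) // addr0.
  - by move=> a p [m hp]; exists m => u Uu Du;
    rewrite /peval mevalM -!/(peval _ _) (hp u) // mulr0.
have [N sN] : exists N, [set` s] `<=` I N.
  elim: (s) sJ => [|a t IH] sJ; first by exists 0%N.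
  have [|N hN] := IH; first by move=> p /= pt; apply: sJ; rewrite /= inE pt orbT.
  have [m am] := sJ a (mem_head _ _); exists (maxn N m) => p /=.
  rewrite inE => /orP[/eqP->|/hN pN]; first exact: I_mono (leq_maxr _ _) _ am.
  exact: I_mono (leq_maxl _ _) _ pN.
exists N => m Nm u [Uu DNu]; apply: contrapT => nDu.
have [p [pu hp]] := chart_basis cx Uu (closed_openC (cD m)) nDu.
have Jp : J p by exists m => v Uv Dv; apply/eqP/negP => /negP /(hp v Uv).
have INp : I N p.
  apply: (Js p Jp) => //; split.
  - by move=> v _ _; rewrite /peval meval0.
  - by move=> a b ha hb v Uv Dv;
    rewrite /peval mevalD -!/(peval _ _) (ha v) // (hb v) // addr0.
  - by move=> a b hb v Uv Dv; rewrite /peval mevalM -!/(peval _ _) (hb v) // mulr0.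
by move/eqP: pu; apply; apply: INp.
Qed.

Lemma variety_stationary (D : nat -> set X) : variety X ->
  (forall i, closed (D i)) -> (forall i, D i.+1 `<=` D i) ->
  exists N, D N `<=` D N.+1.
Proof.
move=> [_ [m [U [hU cov]]] _] cD dD.
have /choice [N hN] : forall i, exists N, forall m, (N <= m)%N -> U i `&` D N `<=` D m.
  move=> i; have [oU /(affine_chart oU) [n [x cx]]] := hU i.
  exact: chart_stationary cx cD dD.
pose M := \max_(i < m) N i; exists M => u Du.
have [i _ Ui] : (\bigcup_(i in [set: 'I_m]) U i) u by rewrite cov.
have NM : (N i <= M)%N by exact: leq_bigmax.
apply: (hN i M.+1); first by rewrite (leq_trans NM).
by split=> //; apply: descending Du.
Qed.

Lemma closed_ind (Q : set X -> Prop) : variety X ->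
  (forall W, closed W -> (forall W', closed W' -> W' `<=` W -> W' <> W -> Q W') -> Q W) ->
  forall W, closed W -> Q W.
Proof.
move=> vX step W cW; apply: contrapT => nQ.
pose bad := {W : set X | closed W /\ ~ Q W}.
have /choice [next nextP] : forall W : bad, exists W' : bad, sval W' `<=` sval W /\
  sval W' <> sval W.
  move=> [A [cA nA]] /=; apply: contrapT => h; apply: nA; apply: step => // B cB BA AB.
  by apply: contrapT => nB; apply: h; exists (exist _ B (conj cB nB)).
pose D n := sval (iter n next (exist _ W (conj cW nQ) : bad)).
have [|i|N DN] := @variety_stationary D vX.
- by move=> i; rewrite /D; case: (iter _ _ _) => A [].
- by rewrite /D /=; have [] := nextP (iter i next (exist _ W (conj cW nQ) : bad)).
have [h1 h2] := nextP (iter N next (exist _ W (conj cW nQ) : bad)).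
by apply: h2; apply/seteqP; split.
Qed.
End NoetherianSpace.

Section MaximalInvariant.
Variables (k : closedFieldType) (s : field_aut k).
Variables (V : fspace k) (phi : rmap V (twist s V)).

(** For W = V minus a nonempty open set that no proper invariant subvariety
meets, these are the maximal proper invariant subvarieties. *)
Definition maximal_in (W X : set V) : Prop :=
  [/\ invariant_subvariety phi X, X `<=` W &
    forall X', invariant_subvariety phi X' -> X' `<=` W -> X `<=` X' -> X' = X].

(** The closure of phi(W) contains every X in the union, because it contains
the closure of phi(X). Conversely phi maps a dense subset of W into W. *)
Lemma dense_union_invariant (W : set V) : irreducible W ->
  closure (\bigcup_(X in [set X | invariant_subvariety phi X /\ X `<=` W]) X) = W ->
  invariant_subvariety phi W.
Proof.
set B := \bigcup_(X in _) X => irrW clB.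
have BW : B `<=` W by move=> x [X [_ XW]] /XW.
have [[w Ww] _] := irrW.
have [x0 [B0 _]] : B `&` [set: V] !=set0.
  have : closure B w by rewrite clB.
  by move=> /(_ setT filterT).
have [X0 [iX0 X0W] _] := B0.
have [_ _ [x1 [Xx1 dx1]] _] := iX0.
have cW : closed W by rewrite -clB; exact: closed_closure.
split=> //.
- by exists x1; split=> //; apply: X0W.
apply/seteqP; split.
- rewrite [X in _ `<=` X]((closure_id W).1 cW).
  apply: (@closure_subset V) => y [x Wx [U [g [[oU Ux] mg gE gx]]]].
  apply: contrapT => nWy.
  have oW : open (~` W) by exact: closed_openC.
  have [cg _] := mg x Ux.
  have : nbhs x (U `&` g @^-1` (~` W)).
    apply: filterI; first exact: open_nbhs_nbhs.
    by apply: cg; rewrite gx; apply: (@open_nbhs_nbhs V).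
  have clx : closure B x by rewrite clB.
  move=> /clx [x' [[X [iX XW] Xx'] [Ux' nW]]]; apply: nW; apply: XW.
  have [_ _ _ clX] := iX.
  have : closure (rimage phi X) (g x').
    by apply: subset_closure; exists x' => //; exists U, g.
  by rewrite clX.
- rewrite -[X in X `<=` _]clB.
  rewrite [X in _ `<=` X]((closure_id _).1 (@closed_closure V _)).
  apply: (@closure_subset V) => x [X [iX XW] Xx].
  have [_ _ _ clX] := iX.
  have : (X : set (twist s V)) x by [].
  rewrite -{1}clX; apply: closure_subset => y [u Xu vu]; exists u => //; exact: XW.
Qed.

(** Noetherian induction on W. If W is irreducible and the invariant
subvarieties inside it have dense union, then W is the only maximal one; in all
other cases the maximal ones lie in one of at most two smaller closed sets. *)
Lemma finite_maximal_in : variety V -> forall W, closed W ->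
  finite_set [set X | maximal_in W X].
Proof.
move=> vV; apply: closed_ind => // W cW IH.
set W' := closure (\bigcup_(X in [set X | invariant_subvariety phi X /\ X `<=` W]) X).
have W'W : W' `<=` W.
  rewrite [X in _ `<=` X]((closure_id W).1 cW).
  by apply: closure_subset => x [X [_ XW]] /XW.
have [e|ne] := pselect (W' = W); last first.
  apply: sub_finite_set (IH W' (@closed_closure _ _) W'W ne) => X [iX XW maxX]; split=> //.
    by move=> x Xx; apply: subset_closure; exists X.
  by move=> X' iX' X'W'; apply: maxX => //; apply: subset_trans W'W.
have [irrW|nirr] := pselect (irreducible W).
  have iW := dense_union_invariant irrW e.
  apply: (sub_finite_set (B := [set W])); last exact: finite_set1.
  by move=> X [iX XW maxX] /=; apply: esym; exact: maxX.
have [W0|/set0P nW] := eqVneq W set0.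
  apply: (sub_finite_set (B := set0)); last exact: finite_set0.
  by move=> X [[_ [[x Xx] _] _ _] XW _]; have := XW x Xx; rewrite W0.
have [A [B [cA cB WAB nA nB]]] : exists A B : set V,
    [/\ closed A, closed B, W `<=` A `|` B, ~ W `<=` A & ~ W `<=` B].
  apply: contrapT => h; apply: nirr; split=> // A B cA cB WAB.
  by apply: contrapT => /not_orP [nA nB]; apply: h; exists A, B.
have sub C : closed C -> ~ W `<=` C -> finite_set [set X | maximal_in (W `&` C) X].
  move=> cC nC; apply: IH; [exact: closedI|by move=> x []|].
  by move=> e'; apply: nC; rewrite -e' => x [].
apply: (sub_finite_set (B :=
  [set X | maximal_in (W `&` A) X] `|` [set X | maximal_in (W `&` B) X])).
  have red C X : maximal_in W X -> X `<=` C -> maximal_in (W `&` C) X.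
    move=> [iX XW maxX] XC; split=> //; first by move=> x Xx; split; [exact: XW|exact: XC].
    by move=> X' iX' X'WC; apply: maxX => // x /X'WC [].
  move=> X mX; have [iX XW _] := mX; have [_ [_ irrX] _ _] := iX.
  by have [|XA|XB] := irrX A B cA cB; [exact: subset_trans WAB|left; exact: red|right;
    exact: red].
by rewrite finite_setU; split; apply: sub.
Qed.

End MaximalInvariant.

Theorem theorem1p8 (k : closedFieldType) (s : field_aut k)
    (V : fspace k) (phi : rmap V (twist s V)) :
  [pchar k]%R =i pred0 ->
  rational_sigma_variety phi ->
  isotrivial phi ->
  (forall (U : set V) (lam : V -> k),
     invariant_function phi U lam -> constant_function U lam) ->
  finite_set [set X : set V | maximal_invariant phi X]%classic.
Proof.
move=> _ hphi triv no_inv; have [vV _ _] := hphi.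
have [V1 [oV1 [v1 V1v1] sparse]] := invariants_sparse hphi triv no_inv.
apply: sub_finite_set (finite_maximal_in phi vV (open_closedC oV1)) => X [iX XT maxX].
split=> //; first by move=> x Xx; exact: sparse iX XT x Xx.
move=> X' iX' X'W; apply: maxX => // X'T.
by apply: (X'W v1); rewrite ?X'T.
Qed.
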